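(* Suppose $\varepsilon>0$. Then for given $k>0$ there exists a weak solution $(u^k,v^k)\in(L^\infty(Q_T))^2$ of the whole-line problem $$u_t=\phi(u)_{xx}-kuv,\quad v_t=\varepsilon\phi(v)_{xx}-kuv\ \text{ in }\mathbb{R}\times(0,T),\qquad u(x,0)=u_0^k(x),\ v(x,0)=v_0^k(x)\ \text{ for }x\in\mathbb{R},$$ such that for each $J>0$: (i) $\phi(u^k)\in L^2(0,T;W^{1,2}((-J,J)))$ and $\phi(v^k)\in L^2(0,T;W^{1,2}((-J,J)))$; (ii) $(u^k,v^k)$ satisfies $$\int_{\mathbb{R}}u_0^k\Psi(x,0)\,dx+\iint_{Q_T}u^k\Psi_t\,dx\,dt=\iint_{Q_T}\phi(u^k)_x\Psi_x\,dx\,dt+k\iint_{Q_T}\Psi u^kv^k\,dx\,dt,$$ $$\int_{\mathbb{R}}v_0^k\Psi(x,0)\,dx+\iint_{Q_T}v^k\Psi_t\,dx\,dt=\iint_{Q_T}\varepsilon\phi(v^k)_x\Psi_x\,dx\,dt+k\iint_{Q_T}\Psi u^kv^k\,dx\,dt$$ for all $\Psi\in\hat{\mathcal{F}}_T$.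
   Context: Fix $T>0$ and constants $U_0,V_0>0$. Write $Q_T=\mathbb{R}\times(0,T)$ and $\mathbb{R}^+=[0,\infty)$. The function $\phi\in C^2(\mathbb{R})$ is strictly increasing, $\phi'$ is strictly increasing on $[0,\infty)$, $\phi(s)>0$ for $s>0$, and $\phi(0)=\phi'(0)=0$. Initial data: let $u_0^\infty(x)=U_0$ for $x<0$, $u_0^\infty(x)=0$ for $x>0$; $v_0^\infty(x)=0$ for $x<0$, $v_0^\infty(x)=V_0$ for $x>0$. For each $k>0$ the data $u_0^k,v_0^k$ satisfy: (i) $u_0^k,v_0^k\in C^2(\mathbb{R})$; (ii) $0\le u_0^k\le U_0$, $0\le v_0^k\le V_0$; (iii) $u_0^k-u_0^\infty\to0$ and $v_0^k-v_0^\infty\to0$ in $L^1(\mathbb{R})$ as $k\to\infty$; (iv) there is a continuous $\omega:\mathbb{R}^+\to\mathbb{R}^+$ with $\omega(\mu)\to0$ as $\mu\to0$ and $\|u_0^k(\cdot+\delta)-u_0^k\|_{L^1(\mathbb{R})}+\|v_0^k(\cdot+\delta)-v_0^k\|_{L^1(\mathbb{R})}\le\omega(|\delta|)$ for all $k>0$, $\delta\in\mathbb{R}$. $\hat{\mathcal{F}}_T$ is the set of $\Psi\in C^1(\mathbb{R}\times[0,T])$ with $\Psi(\cdot,T)=0$ and $\mathrm{supp}\,\Psi\subset[-J,J]\times[0,T]$ for some $J>0$. *)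

(* Defs.v *)
From HB Require Import structures.
From mathcomp Require Import all_boot all_order all_algebra.
From mathcomp Require Import all_classical all_reals all_analysis.
Set Implicit Arguments.
Unset Strict Implicit.
Unset Printing Implicit Defensive.
Import Order.TTheory GRing.Theory Num.Theory.
Import numFieldNormedType.Exports.
Local Open Scope classical_set_scope.
Local Open Scope ring_scope.

(* Points of the space-time plane are pairs (x, t) : R * R.  Elements of
   Lebesgue spaces are handled through (Borel measurable) representatives. *)

Notation leb R := (@lebesgue_measure R).
Notation leb2 R := (@lebesgue_measure R \x @lebesgue_measure R)%E.

Definition Cn (R : realType) (n : nat) (f : R -> R) : Prop :=
  (forall i x, (i < n)%N -> derivable (derive1n i f) x 1) /\ continuous (derive1n n f).

Definition u0_infty (R : realType) (U0 x : R) : R := if x < 0 then U0 else 0.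

Definition v0_infty (R : realType) (V0 x : R) : R := if 0 < x then V0 else 0.

(* [f \_ D] is [f] extended by 0 outside [D]. *)
Definition Lp_on d (T : measurableType d) (R : realType)
    (mu : {measure set T -> \bar R}) (p : \bar R) (D : set T) (f : T -> R) :
    Prop :=
  (f \_ D) \in Lfun mu p.

Section plane.
Context (R : realType).
Implicit Types (T : R) (f g : R * R -> R).

Definition QT T : set (R * R) := setT `*` `]0, T[.

Definition strip T : set (R * R) := setT `*` `[0, T].

Definition dx f (z : R * R) : R := derive1 (fun x => f (x, z.2)) z.1.

Definition dt f (z : R * R) : R := derive1 (fun t => f (z.1, t)) z.2.

(* C^1 on the closed strip: the first-order partial derivatives exist in the
   open strip and extend continuously to the closed one. *)
Definition C1_strip T f : Prop :=
  [/\ {within strip T, continuous f},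
      (forall x t, QT T (x, t) ->
         derivable (fun y => f (y, t)) x 1 /\
         derivable (fun s => f (x, s)) t 1),
      (exists fx : R * R -> R, {within strip T, continuous fx} /\
         forall z, QT T z -> fx z = dx f z) &
      (exists ft : R * R -> R, {within strip T, continuous ft} /\
         forall z, QT T z -> ft z = dt f z)].

(* The class \hat F_T; only the values of [Psi] on the strip matter. *)
Definition FT T (Psi : R * R -> R) : Prop :=
  [/\ C1_strip T Psi,
      (forall x, Psi (x, T) = 0) &
      exists2 J : R, 0 < J &
        closure [set z | strip T z /\ Psi z != 0] `<=` `[- J, J] `*` `[0, T]].

End plane.

Section sobolev.
Context (R : realType).
Implicit Types (I : set R) (f g psi : R -> R).

Definition test_function I psi : Prop :=
  [/\ (forall n, Cn n psi),
      compact (closure [set x | psi x != 0]) &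
      closure [set x | psi x != 0] `<=` I].

Definition weak_derivative I f g : Prop :=
  forall psi, test_function I psi ->
    \int[leb R]_(x in I) (f x * derive1 psi x) =
    - \int[leb R]_(x in I) (g x * psi x).

(* [f] belongs to W^{1,2}(I) and its weak derivative is [g]. *)
Definition W12 I f g : Prop :=
  [/\ Lp_on (leb R) 2%:E I f, Lp_on (leb R) 2%:E I g & weak_derivative I f g].

(* Square of the W^{1,2}(I) norm of [f], where [g] is its weak derivative. *)
Definition W12_norm2 I f g : \bar R :=
  (('N[leb R]_2%:E[EFin \o (f \_ I)]) ^+ 2 +
   ('N[leb R]_2%:E[EFin \o (g \_ I)]) ^+ 2)%E.

(* [F] belongs to L^2(0, T; W^{1,2}(I)) and [F_x = G], meaning that [G(., t)]
   is the weak derivative of [F(., t)] for almost every [t].  As W^{1,2}(I) is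
   separable, the measurability of t |-> F(., t) in W^{1,2}(I) is that of
   [F] and [G] as functions of (x, t). *)
Definition L2_W12 (T : R) I (F G : R * R -> R) : Prop :=
  [/\ measurable_fun (I `*` `]0, T[) F,
      measurable_fun (I `*` `]0, T[) G,
      {ae leb R, forall t, t \in `]0, T[ ->
         W12 I (fun x => F (x, t)) (fun x => G (x, t))} &
      (\int[leb R]_(t in `]0%R, T[)
         W12_norm2 I (fun x => F (x, t)) (fun x => G (x, t)) < +oo)%E].

End sobolev.

(* Main.v *)
(* The system is approximated by an explicit finite difference scheme with mesh
   [h = 2^-n] and time step [lam h^2].  Under the CFL condition the grid values
   stay in [0, U0] and [0, V0], and two weighted energy estimates bound
   the space-time sums of [|D_x phi(u)|^2] and of [t |D_t phi(u)|^2]; by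
   telescoping and Cauchy-Schwarz this makes [phi(u)] asymptotically equicontinuous at
   positive times, so that a subsequence converges at every point.
   The weak derivative of the limit [w = phi(u)] is the limit of its dyadic
   difference quotients, which form a martingale bounded in L^2.  The quotients
   of the approximations are paired with test functions that are constant on
   coarse dyadic cells: by orthogonality the fine mesh can then be replaced by the
   coarse one, on which pointwise convergence is enough.  Summation by parts
   (translation invariance of Lebesgue measure) gives the weak form in the limit. *)

Require Import Defs.
From HB Require Import structures.
From mathcomp Require Import all_boot all_order all_algebra.
From mathcomp Require Import all_classical all_reals all_analysis.
From mathcomp Require Import measurable_realfun ess_sup_inf ring lra zify.
Set Implicit Arguments.
Unset Strict Implicit.
Unset Printing Implicit Defensive.
Import Order.TTheory GRing.Theory Num.Theory.
Import numFieldNormedType.Exports.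
Local Open Scope classical_set_scope.
Local Open Scope ring_scope.

(** * Energy estimates on the grid *)

(** Since [phi'] vanishes at 0, no gradient of [u] itself can be controlled. All estimates rest on
    the single inequality [(phi y - phi x) ^+ 2 <= L * ((y - x) * (phi y - phi x))], which asks for
    no lower bound on [phi'] and bounds increments of [phi(u)] only. The unknowns are recovered from
    [phi(u)] by strict monotonicity, so that the product [u v] converges pointwise as well. The data
    need not decay, and unweighted sums over [(-n, n)] grow with [n]. The sums therefore carry a
    discrete [exp(-|x|)], whose relative variation between neighbours is at most [h]: summation by
    parts then costs lower-order terms only. The factor [t] in the second estimate removes the
    gradient energy of the initial grid function, for which no bound is at hand; cutting the data
    off at [|x| = n] even creates jumps. The martingale stands in for weak compactness in [L^2]. Its
    convergence almost everywhere along one subsequence makes the flux of the weak form and the weak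
    derivative at almost every fixed time one and the same function. *)

Section zsum.
Context (R : realFieldType).
Implicit Types (f g H : int -> R) (M : nat) (i : int).

(** As [Negz j] is [- j - 1], the index runs over the integers of [[-M, M)]; the half-open range is
    what makes differences telescope to the values at [M] and [- M]. *)
Definition zsum M f : R := \sum_(j < M) (f (Posz j) + f (Negz j)).

Lemma zsumS M f : zsum M.+1 f = zsum M f + (f (Posz M) + f (Negz M)).
Proof. by rewrite /zsum big_ord_recr. Qed.

Lemma zsum0 f : zsum 0 f = 0. Proof. by rewrite /zsum big_ord0. Qed.

Lemma zsumD M f g : zsum M (fun i => f i + g i) = zsum M f + zsum M g.
Proof. by rewrite /zsum -big_split; apply: eq_bigr => j _ /=; rewrite addrACA. Qed.

Lemma zsumZ M a f : zsum M (fun i => a * f i) = a * zsum M f.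
Proof. by rewrite /zsum mulr_sumr; apply: eq_bigr => j _; rewrite mulrDr. Qed.

Lemma ler_zsum M f g : (forall i, f i <= g i) -> zsum M f <= zsum M g.
Proof. by move=> fg; apply: ler_sum => j _; apply: lerD. Qed.

Lemma zsum_ge0 M f : (forall i, 0 <= f i) -> 0 <= zsum M f.
Proof. by move=> f0; apply: sumr_ge0 => j _; apply: addr_ge0. Qed.

Lemma zsum_telescope M H :
  zsum M (fun i => H (i + 1) - H i) = H (Posz M) - H (- Posz M).
Proof.
elim: M => [|M IH]; first by rewrite zsum0 oppr0 subrr.
rewrite zsumS IH /=.
have -> : Posz M + 1 = Posz M.+1 by lia.
have -> : Negz M + 1 = - Posz M by lia.
have -> : - Posz M.+1 = Negz M by lia.
by ring.
Qed.

Lemma zsum_window M f (a : int) (r : nat) : (forall i, 0 <= f i) ->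
  - Posz M <= a -> a + Posz r <= Posz M ->
  \sum_(j < r) f (a + Posz j) <= zsum M f.
Proof.
move=> f0; have zE : zsum M f = \sum_(j < M + M) f (- Posz M + Posz j).
  elim: M => [|M IH]; first by rewrite zsum0 big_ord0.
  rewrite zsumS IH addSn addnS big_ord_recl big_ord_recr /=.
  have -> : - Posz M.+1 + 0 = Negz M by lia.
  have -> : - Posz M.+1 + bump 0 (M + M)%N = Posz M by rewrite /bump /=; lia.
  have -> : \sum_(i < M + M) f (- Posz M.+1 + bump 0 i) =
      \sum_(j < M + M) f (- Posz M + j).
    by apply: eq_bigr => j _; congr f; rewrite /bump /=; lia.
  by ring.
move=> aM arM; rewrite zE.
have [b ab] : exists b : nat, a = - Posz M + Posz b.
  by exists (absz (a + Posz M)%R); lia.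
have bM : (b + r <= M + M)%N by lia.
rewrite -(subnKC bM) big_split_ord /= big_split_ord /=.
rewrite -[leLHS]add0r -[leLHS]addr0; apply: lerD; last by apply: sumr_ge0.
apply: lerD; first exact: sumr_ge0.
rewrite le_eqVlt; apply/orP; left; apply/eqP.
by apply: eq_bigr => j _; rewrite ab; congr f; lia.
Qed.

Definition wsum2 M (rho f : int -> R) : R := zsum M (fun i => rho i * f i ^+ 2).

Lemma wsum2_ge0 M (rho : int -> R) f : (forall i, 0 < rho i) -> 0 <= wsum2 M rho f.
Proof. by move=> rho0; apply: zsum_ge0 => i; rewrite mulr_ge0 ?sqr_ge0 // ltW. Qed.

End zsum.

Lemma sqr_sum_le (R : realFieldType) (n : nat) (f : nat -> R) :
  (\sum_(i < n) f i) ^+ 2 <= n%:R * \sum_(i < n) f i ^+ 2.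
Proof.
case: n => [|n]; first by rewrite !big_ord0 expr2 !mul0r.
elim: n => [|n IH]; first by rewrite !big_ord_recl !big_ord0 !addr0 mul1r.
rewrite 2!(big_ord_recr n.+1) /=; set s := \sum_(i < n.+1) _ in IH *.
set q := \sum_(i < n.+1) _ in IH *.
rewrite -[X in X%:R * (_ + _)]addn1 natrD.
have N0 : 0 < n.+1%:R :> R by rewrite ltr0n.
set N : R := n.+1%:R in IH N0 *; set x := f _.
clearbody N s q x.
have : 2 * s * x <= q + N * x ^+ 2.
  have : 0 <= N^-1 * (s - N * x) ^+ 2 by rewrite mulr_ge0 ?invr_ge0 ?sqr_ge0 // ltW.
  have -> : N^-1 * (s - N * x) ^+ 2 = N^-1 * s ^+ 2 - 2 * s * x + N * x ^+ 2.
    by field; exact: lt0r_neq0.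
  have : N^-1 * s ^+ 2 <= q by rewrite mulrC ler_pdivrMr // mulrC.
  by lra.
move=> H; rewrite -[1%:R]/1.
by lra.
Qed.

(** * Energy inequalities for one time step at one node *)

Section pointwise_energy.
Context (R : realFieldType).
Variables (h lam D B L S : R).
Hypotheses (h0 : 0 < h) (h1 : h <= 1) (lam0 : 0 < lam) (D0 : 0 < D)
  (L0 : 0 < L) (S0 : 0 <= S) (cfl : 24 * D * L <= 1).

(* [w-, w, w+] are consecutive values of [phi a] and [s] is the reaction term;
   the two [H]-brackets telescope when summed over the grid. *)
Lemma energy_step0 (r r' a a' b wm w wp s : R) :
  0 < r -> 0 < r' -> `|r' - r| <= h * r -> 0 <= a -> 0 <= a' <= B -> 0 <= s <= S ->
  (wp - w) ^+ 2 <= L * ((a' - a) * (wp - w)) ->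
  a * (b - a) = a * (D * (wp - 2 * w + wm) - lam * h ^+ 2 * s) ->
  (b - a) ^+ 2 <= (D * (wp - 2 * w + wm) - lam * h ^+ 2 * s) ^+ 2 ->
  r * b ^+ 2 - r * a ^+ 2 + D / L * (r * (wp - w) ^+ 2) <=
    ((2 * D * (r' * a' * (wp - w)) - 4 * D ^+ 2 * (r' * (wp - w) ^+ 2)) -
     (2 * D * (r * a * (w - wm)) - 4 * D ^+ 2 * (r * (w - wm) ^+ 2))) +
    (2 * D * L * B ^+ 2 + 2 * lam ^+ 2 * S ^+ 2) * h ^+ 2 * r.
Proof.
move=> r0 r'0 rr' a0 /andP[a'0 a'B] /andP[s0 sS] wa E1 E2.
set X := wp - w in wa *; set Y := w - wm.
have XY : wp - 2 * w + wm = X - Y by rewrite /X /Y; ring.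
rewrite XY in E1 E2.
have hsq : h ^+ 2 <= 1 by rewrite expr_le1 // ltW.
have step : b ^+ 2 - a ^+ 2 <= 2 * D * (a * (X - Y)) + 4 * D ^+ 2 * (X ^+ 2 + Y ^+ 2)
    + 2 * lam ^+ 2 * S ^+ 2 * h ^+ 2.
  have -> : b ^+ 2 - a ^+ 2 = 2 * (a * (b - a)) + (b - a) ^+ 2 by ring.
  rewrite E1.
  have : 0 <= lam * h ^+ 2 * a * s.
    by rewrite !mulr_ge0 // ?sqr_ge0 // ltW.
  have : (D * (X - Y) - lam * h ^+ 2 * s) ^+ 2 <=
      4 * D ^+ 2 * (X ^+ 2 + Y ^+ 2) + 2 * (lam * h ^+ 2 * s) ^+ 2.
    have := sqr_ge0 (D * (X - Y) + lam * h ^+ 2 * s).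
    have := sqr_ge0 (D * (X + Y)).
    by nra.
  have : (lam * h ^+ 2 * s) ^+ 2 <= lam ^+ 2 * S ^+ 2 * h ^+ 2.
    have -> : (lam * h ^+ 2 * s) ^+ 2 = lam ^+ 2 * (h ^+ 2 * (h ^+ 2 * s ^+ 2)).
      by ring.
    rewrite -mulrA ler_wpM2l ?sqr_ge0 // mulrC ler_wpM2r ?sqr_ge0 //.
    have : s ^+ 2 <= S ^+ 2 by rewrite ler_sqr ?nnegrE.
    by have := sqr_ge0 s; nra.
  by lra.
have cross : `|(r' - r) * a' * X| <= r * (X ^+ 2 / (4 * L) + L * h ^+ 2 * B ^+ 2).
  rewrite !normrM (ger0_norm a'0).
  have X0 := normr_ge0 X.
  have : `|r' - r| * a' * `|X| <= h * r * B * `|X|.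
    by rewrite ler_wpM2r // ler_pM.
  move/le_trans; apply.
  have -> : h * r * B * `|X| = r * (h * B * `|X|) by ring.
  rewrite ler_pM2l // -[X ^+ 2]real_normK ?num_real //.
  have := sqr_ge0 (`|X| / (2 * L) - h * B).
  have -> : (`|X| / (2 * L) - h * B) ^+ 2 =
    (`|X| ^+ 2 / (4 * L) - h * B * `|X| + L * h ^+ 2 * B ^+ 2) / L by field; exact: lt0r_neq0.
  by rewrite ler_pdivlMr // mul0r; lra.
have main : X ^+ 2 / L <= (a' - a) * X by rewrite ler_pdivrMr // mulrC.
have key : r' <= 2 * r by have := ler_norm (r' - r); nra.
have {}step := ler_wpM2l (ltW r0) step.
move: cross; rewrite ler_norml => /andP[cross _].
have {}cross := ler_wpM2l (ltW D0) cross.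
have {}main := ler_wpM2l (ltW (mulr_gt0 D0 r0)) main.
(* The explicit step leaves a square worth [4 D^2 (r + r') X^2] after telescoping. With [r' <= 2 r],
   the factor 24 in [cfl] brings it down to [D r X^2 / (2 L)]. The term [cross] costs as much, so
   half of the available [2 D r X^2 / L] survives. *)
have P : D ^+ 2 * (r + r') * X ^+ 2 <= D / (8 * L) * r * X ^+ 2.
  rewrite ler_wpM2r ?sqr_ge0 //.
  have -> : D / (8 * L) * r = D * (r / (8 * L)) by ring.
  rewrite expr2 -mulrA ler_pM2l // ler_pdivlMr ?mulr_gt0 //.
  have DL : 0 < D * L by rewrite mulr_gt0.
  have := ler_wpM2l (ltW DL) key.
  have := ler_wpM2r (ltW r0) cfl.
  by lra.
have -> : D / L * (r * X ^+ 2) = D * r * (X ^+ 2 / L) by ring.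
have EX : X ^+ 2 / (4 * L) = X ^+ 2 / L / 4 by field; exact: lt0r_neq0.
have EP : D / (8 * L) * r * X ^+ 2 = D * r * (X ^+ 2 / L) / 8 by field; exact: lt0r_neq0.
rewrite EX in cross; rewrite EP in P.
set Q := X ^+ 2 / L in cross main P *.
clearbody Q X Y.
by lra.
Qed.

(** Discrete form of testing the equation with [phi(u)_t]. Here [X] and [Y] are the forward and
    backward space differences of [phi a], [d] and [d'] its time increments at the node and at the
    next one, and [e] is the increment of [a]. The new gradient is [X + d' - d]; summation by parts
    turns [2 r X (d' - d)] into [- 2 r d (X - Y)], the scheme replaces [D (X - Y)] by [e] plus
    reaction, and monotonicity of [phi] makes [e d] dominate [d ^+ 2 / L]. The scheme is assumed
    multiplied by [d], so that it also holds off the grid, where [d = 0]. *)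
Lemma energy_step1 (rm r r' X Y d d' e s : R) :
  0 < r -> 0 < r' -> `|r - rm| <= h * r -> `|r' - r| <= h * r -> `|r' - r| <= h * r' ->
  0 <= s <= S -> d ^+ 2 <= L * (e * d) ->
  d * (D * (X - Y)) = d * (e + lam * h ^+ 2 * s) ->
  r * (X + d' - d) ^+ 2 - r * X ^+ 2 + r * d ^+ 2 / (D * L) <=
    ((2 * r * X * d' - 4 * h ^+ 2 * D * L * (r' * X ^+ 2) + 4 * r' * d' ^+ 2) -
     (2 * rm * Y * d - 4 * h ^+ 2 * D * L * (r * Y ^+ 2) + 4 * r * d ^+ 2)) +
    8 * D * L * h ^+ 2 * (r * X ^+ 2) +
    4 * L * lam ^+ 2 * S ^+ 2 / D * h ^+ 4 * r.
Proof.
move=> r0 r'0 r1 r2 r3 /andP[s0 sS] de E.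
have DL : 0 < D * L by rewrite mulr_gt0.
have k2 : r' <= 2 * r.
  by have := ler_norm (r' - r); have := ler_wpM2r (ltW r0) h1; lra.
have k3 : r <= 2 * r' by have := ler_norm (r - r'); have := ler_wpM2r (ltW r'0) h1; rewrite distrC; lra.
set k := (D * L)^-1.
have Ek : k * (D * L) = 1 by rewrite mulVf // lt0r_neq0.
have kg : 24 <= k by rewrite -[k]mul1r ler_pdivlMr // mulrA.
have k0 : 0 < k by rewrite invr_gt0.
have main : k * d ^+ 2 <= e * d / D.
  have -> : e * d / D = k * (L * (e * d)) by rewrite /k; field; rewrite !lt0r_neq0.
  by rewrite ler_pM2l.
clearbody k.
have E' : - (d * (X - Y)) <= - (k * d ^+ 2) + lam * h ^+ 2 * S / D * `|d|.
  have -> : d * (X - Y) = e * d / D + lam * h ^+ 2 * s / D * d.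
    have -> : d * (X - Y) = d * (D * (X - Y)) / D by field; exact: lt0r_neq0.
    by rewrite E; field; exact: lt0r_neq0.
  have : - (lam * h ^+ 2 * s / D * d) <= lam * h ^+ 2 * S / D * `|d|.
    apply: le_trans (ler_norm _) _; rewrite normrN normrM ler_wpM2r //.
    rewrite ger0_norm; last by rewrite !mulr_ge0 ?invr_ge0 ?sqr_ge0 // ltW.
    by rewrite ler_wpM2r ?invr_ge0 ?(ltW D0) // ler_wpM2l // mulr_ge0 ?sqr_ge0 // ltW.
  by lra.
have young : 2 * (lam * h ^+ 2 * S / D * `|d|) <=
    k / 4 * d ^+ 2 + 4 * L * lam ^+ 2 * S ^+ 2 / D * h ^+ 4.
  have -> : 4 * L * lam ^+ 2 * S ^+ 2 / D * h ^+ 4 =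
    4 * (D * L) * (lam * h ^+ 2 * S / D) ^+ 2 by field; exact: lt0r_neq0.
  set z := lam * h ^+ 2 * S / D.
  rewrite -[d ^+ 2]real_normK ?num_real //.
  have := mulr_ge0 (ltW k0) (sqr_ge0 (`|d| / 2 - 2 * (D * L) * z)).
  have -> : k * (`|d| / 2 - 2 * (D * L) * z) ^+ 2 =
    k / 4 * `|d| ^+ 2 - 2 * (k * (D * L)) * z * `|d| + 4 * (k * (D * L)) * (D * L) * z ^+ 2.
    by field.
  by rewrite Ek; lra.
have cross : - (2 * d * (r - rm) * Y) <= r * (k / 4 * d ^+ 2 + 4 * h ^+ 2 * (D * L) * Y ^+ 2).
  apply: le_trans (ler_norm _) _; rewrite normrN !normrM.
  have : `|2| * `|d| * `|r - rm| * `|Y| <= 2 * `|d| * (h * r) * `|Y|.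
    rewrite ger0_norm // ler_wpM2r // ler_wpM2l // mulr_ge0 //.
  move/le_trans; apply.
  have -> : 2 * `|d| * (h * r) * `|Y| = r * (2 * h * `|d| * `|Y|) by ring.
  rewrite ler_pM2l // -[d ^+ 2]real_normK ?num_real // -[Y ^+ 2]real_normK ?num_real //.
  have := mulr_ge0 (ltW k0) (sqr_ge0 (`|d| / 2 - 2 * (D * L) * h * `|Y|)).
  have -> : k * (`|d| / 2 - 2 * (D * L) * h * `|Y|) ^+ 2 =
    k / 4 * `|d| ^+ 2 - 2 * (k * (D * L)) * h * `|Y| * `|d|
      + 4 * (k * (D * L)) * (D * L) * h ^+ 2 * `|Y| ^+ 2.
    by field.
  by rewrite Ek; lra.
have P1 : r * (d' - d) ^+ 2 <= 4 * r' * d' ^+ 2 + 2 * r * d ^+ 2.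
  have : (d' - d) ^+ 2 <= 2 * d' ^+ 2 + 2 * d ^+ 2 by have := sqr_ge0 (d' + d); nra.
  move/(ler_wpM2l (ltW r0)); have := ler_wpM2r (sqr_ge0 d') k3.
  by lra.
have P2 := ler_wpM2r (sqr_ge0 X) k2.
have P3 : 0 <= h ^+ 2 * (D * L) by rewrite mulr_ge0 ?sqr_ge0 ?ltW.
have {}P2 := ler_wpM2l P3 P2.
(* The square of [d' - d] costs [6 r d^2] after telescoping, hence at most a quarter of [k r d^2].
   Reaction and weight take a quarter each, so more than one of the available two multiples of
   [k r d^2] is left. *)
have P4 : 24 * (r * d ^+ 2) <= k * (r * d ^+ 2).
  by rewrite ler_wpM2r // mulr_ge0 ?sqr_ge0 ?ltW.
have P5 : 0 <= r * d ^+ 2 by rewrite mulr_ge0 ?sqr_ge0 ?ltW.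
have {}E' := ler_wpM2l (ltW r0) E'.
have {}young := ler_wpM2l (ltW r0) young.
have {}main := ler_wpM2l (ltW r0) main.
set z1 := lam * h ^+ 2 * S / D in E' young.
set z2 := 4 * L * lam ^+ 2 * S ^+ 2 / D in young *.
clearbody z1 z2.
by lra.
Qed.
End pointwise_energy.

Section grid_weight.
Context (R : realFieldType).
Implicit Types (h : R) (i : int).

(** A discrete [exp(-|x|)] at [x = i h]. The geometric form makes the increment between neighbours
    at most [h] times either value, and the total mass of order [1 / h]. *)
Definition weight h i : R := (1 + h)^-1 ^+ absz i.

Lemma weight_gt0 h i : 0 < h -> 0 < weight h i.
Proof. by move=> h0; rewrite exprn_gt0 // invr_gt0; lra. Qed.

Lemma weight_step h i : 0 < h ->
  `|weight h (i + 1) - weight h i| <= h * weight h i /\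
  `|weight h (i + 1) - weight h i| <= h * weight h (i + 1).
Proof.
move=> h0; rewrite /weight; set r := (1 + h)^-1.
have r0 : 0 < r by rewrite invr_gt0; lra.
have E : (1 + h) * r = 1 by rewrite divff //; lra.
have step n : `|r ^+ n.+1 - r ^+ n| <= h * r ^+ n /\ `|r ^+ n.+1 - r ^+ n| <= h * r ^+ n.+1.
  have -> : r ^+ n.+1 - r ^+ n = - (h * r ^+ n.+1).
    by rewrite exprS -{2}[r ^+ n]mul1r -E; ring.
  rewrite normrN ger0_norm; last by rewrite mulr_ge0 ?exprn_ge0 ?ltW.
  split=> //; rewrite ler_pM2l // exprS -[leRHS]mul1r ler_wpM2r ?exprn_ge0 ?(ltW r0) //.
  by rewrite -E; nra.
case: i => [n|n].
- by have -> : absz (Posz n + 1) = n.+1 by lia.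
- have -> : absz (Negz n + 1) = n by lia.
  by have -> : absz (Negz n) = n.+1 by []; rewrite distrC; case: (step n).
Qed.

Lemma zsum_weight h M : 0 < h -> h <= 1 -> h * zsum M (weight h) <= 4.
Proof.
move=> h0 h1; set r := (1 + h)^-1.
have r0 : 0 < r by rewrite invr_gt0; lra.
have E : (1 + h) * r = 1 by rewrite divff //; lra.
suff: h * zsum M (weight h) <= 4 - 4 * r ^+ M.
  by move=> H; apply: (le_trans H); have := exprn_ge0 M (ltW r0); lra.
elim: M => [|M IH]; first by rewrite zsum0 expr0; lra.
rewrite zsumS; have q0 := exprn_ge0 M (ltW r0).
have -> : weight h (Posz M) = r ^+ M by [].
have -> : weight h (Negz M) = r * r ^+ M by rewrite -exprS.
rewrite exprS; set q := r ^+ M in IH q0 *; clearbody q.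
have rq : h * (r * q) = q - r * q by rewrite -{2}[q]mul1r -E; ring.
have : h * (q + r * q) <= 4 * q - 4 * (r * q).
  rewrite -[4 * q - _]mulrBr -rq mulrDr.
  have z0 : 0 <= r * q by rewrite mulr_ge0 // ltW.
  have : q = r * q + h * (r * q) by rewrite rq; ring.
  move: z0; set z := r * q; move=> z0 ->.
  have := ler_wpM2r z0 (_ : h * h <= h).
  have := mulr_ge0 (ltW h0) z0.
  by have := ler_wpM2l (ltW h0) h1; rewrite mulr1 => -> ? /(_ isT); lra.
by lra.
Qed.

End grid_weight.

(** * The two weighted energy estimates *)

Section scheme_energy.
Context (R : realFieldType).
Variables (phi : R -> R) (h lam D B L S : R) (P : nat).
Hypotheses (h0 : 0 < h) (h1 : h <= 1) (lam0 : 0 < lam) (D0 : 0 < D)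
  (L0 : 0 < L) (S0 : 0 <= S) (cfl : 24 * D * L <= 1).
Hypothesis phi0 : phi 0 = 0.
Hypothesis phi_lip : forall x y : R, 0 <= x <= B -> 0 <= y <= B ->
  (phi y - phi x) ^+ 2 <= L * ((y - x) * (phi y - phi x)).
Variables (a s : nat -> int -> R).
Hypothesis aB : forall m i, 0 <= a m i <= B.
Hypothesis sS : forall m i, 0 <= s m i <= S.
Hypothesis a_out : forall m i, (P <= absz i)%N -> a m i = 0.
Hypothesis a_step : forall m i, (absz i < P)%N ->
  a m.+1 i = a m i + (D * (phi (a m (i + 1)) - 2 * phi (a m i) + phi (a m (i - 1)))
                      - lam * h ^+ 2 * s m i).

(** Two nodes beyond the support of the grid function: the brackets to be telescoped look at [i] and
    [i - 1], and vanish at both ends of this range. *)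
Let M := P.+2.
Let rho := weight h.
Let w m i := phi (a m i).
Let X m := wsum2 M rho (a m).
Let A m := wsum2 M rho (fun i => w m (i + 1) - w m i).
Let Dm m := wsum2 M rho (fun i => w m.+1 i - w m i).
Let Rs := zsum M rho.
Let C0 := 2 * D * L * B ^+ 2 + 2 * lam ^+ 2 * S ^+ 2.
Let C1 := 4 * L * lam ^+ 2 * S ^+ 2 / D.

Let w_out m i : (P <= absz i)%N -> w m i = 0.
Proof. by move=> Pi; rewrite /w a_out. Qed.

Let rho0 i : 0 < rho i. Proof. exact: weight_gt0. Qed.

Lemma scheme_energy0 m : X m.+1 + D / L * A m <= X m + C0 * h ^+ 2 * Rs.
Proof.
rewrite /X /A /Rs /wsum2 -!zsumZ -!zsumD.
pose H i := 2 * D * (rho i * a m i * (w m i - w m (i - 1))) -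
            4 * D ^+ 2 * (rho i * (w m i - w m (i - 1)) ^+ 2).
have H0 i : (P.+1 < absz i)%N -> H i = 0.
  move=> Pi; rewrite /H (w_out m (i := i)) ?(w_out m (i := i - 1)); try lia.
  by rewrite subrr; ring.
have : zsum M (fun i => H (i + 1) - H i) = 0.
  by rewrite zsum_telescope !H0 ?subrr //; rewrite /M; lia.
move=> tel; rewrite -[leRHS]addr0 -tel -zsumD; apply: ler_zsum => i.
rewrite /H addrK.
have [r1 r2] := weight_step i h0.
have [aBi0 aBi1] := (aB m i, aB m (i + 1)).
have q := @energy_step0 _ h lam D B L S h0 h1 lam0 D0 L0 S0 cfl (rho i) (rho (i + 1))
  (a m i) (a m (i + 1)) (a m.+1 i) (w m (i - 1)) (w m i) (w m (i + 1)) (s m i)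
  (rho0 _) (rho0 _) r1.
have {}q := q (proj1 (andP aBi0)) aBi1 (sS m i) (phi_lip aBi0 aBi1).
have {}q := q _ _; move: (q).
case: (ltnP (absz i) P) => Pi.
  rewrite a_step //; set e := D * _ - _; rewrite [_ + e - _]addrAC subrr add0r.
  by move=> /(_ erefl (lexx _)); rewrite /C0; lra.
(* Outside the grid the step equation fails, but its product with [a = 0] and the inequality between
   squares, which is all that [energy_step0] asks for, hold trivially. *)
rewrite (a_out m Pi) (a_out m.+1 Pi) subrr !mul0r expr0n => /(_ erefl (sqr_ge0 _)).
by rewrite /C0; lra.
Qed.

Lemma scheme_energy1 m :
  A m.+1 + (D * L)^-1 * Dm m <= (1 + 8 * D * L * h ^+ 2) * A m + C1 * h ^+ 4 * Rs.
Proof.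
rewrite /A /Dm /Rs /wsum2 -!zsumZ -!zsumD.
pose d i := w m.+1 i - w m i.
pose H i := 2 * rho (i - 1) * (w m i - w m (i - 1)) * d i -
            4 * h ^+ 2 * D * L * (rho i * (w m i - w m (i - 1)) ^+ 2) + 4 * rho i * d i ^+ 2.
have H0 i : (P.+1 < absz i)%N -> H i = 0.
  move=> Pi; rewrite /H /d (w_out m (i := i)) ?(w_out m.+1 (i := i))
    ?(w_out m (i := i - 1)); try lia.
  by rewrite !subrr; ring.
have : zsum M (fun i => H (i + 1) - H i) = 0.
  by rewrite zsum_telescope !H0 ?subrr //; rewrite /M; lia.
move=> tel; rewrite -[leRHS]addr0 -tel -zsumD; apply: ler_zsum => i.
rewrite /H addrK.
have [r1 r2] := weight_step i h0.
have [_ r3] := weight_step (i - 1) h0; rewrite subrK in r3.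
have q := @energy_step1 _ h lam D L S h0 h1 lam0 D0 L0 cfl (rho (i - 1)) (rho i) (rho (i + 1))
  (w m (i + 1) - w m i) (w m i - w m (i - 1)) (d i) (d (i + 1)) (a m.+1 i - a m i) (s m i)
  (rho0 _) (rho0 _) r3 r1 r2 (sS m i) (phi_lip (aB m i) (aB m.+1 i)).
have /q : d i * (D * (w m (i + 1) - w m i - (w m i - w m (i - 1)))) =
    d i * (a m.+1 i - a m i + lam * h ^+ 2 * s m i).
  rewrite /d; case: (ltnP (absz i) P) => Pi; first by rewrite a_step // -/(w m (i + 1)) -/(w m i) -/(w m (i - 1)); ring.
  by rewrite (w_out m Pi) (w_out m.+1 Pi) subrr !mul0r.
have -> : w m.+1 (i + 1) - w m.+1 i = w m (i + 1) - w m i + d (i + 1) - d i.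
  by rewrite /d; ring.
by rewrite -/(d i) /C1; lra.
Qed.

Let Rs_le : h * Rs <= 4. Proof. exact: zsum_weight. Qed.

Let Rs_ge0 : 0 <= Rs. Proof. by apply: zsum_ge0 => i; exact: ltW. Qed.

Let A_ge0 m : 0 <= A m.
Proof. exact: wsum2_ge0. Qed.

Definition energy_const0 Theta := L / D * ((B ^+ 2 + Theta * C0) * 4).

Definition energy_const1 Theta :=
  (1 + 8 * D * L * Theta) * energy_const0 Theta + 4 * Theta ^+ 2 * C1.

Lemma sum_energy0 N Theta : N%:R * h ^+ 2 <= Theta ->
  h * \sum_(m < N) A m <= energy_const0 Theta.
Proof.
move=> NT; have C00 : 0 <= C0.
  by rewrite addr_ge0 // mulr_ge0 ?sqr_ge0 // mulr_ge0 ?sqr_ge0 // ?mulr_ge0 // ltW // mulr_gt0.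
have tel n : X n + D / L * \sum_(m < n) A m <= (B ^+ 2 + n%:R * h ^+ 2 * C0) * Rs.
  elim: n => [|n IH].
    rewrite big_ord0 mulr0 !addr0 mul0r mul0r addr0 /X /Rs /wsum2 -zsumZ; apply: ler_zsum => i.
    rewrite mulrC ler_pM2r //; have /andP[p q] := aB 0%N i.
    by rewrite ler_sqr ?nnegrE // (le_trans p q).
  rewrite big_ord_recr /= mulrDr; have := scheme_energy0 n.
  by rewrite -[n.+1]addn1 natrD; lra.
have X0 : 0 <= X N by exact: wsum2_ge0.
have : D / L * \sum_(m < N) A m <= (B ^+ 2 + N%:R * h ^+ 2 * C0) * Rs.
  by apply: le_trans (tel N); rewrite lerDr.
have : (B ^+ 2 + N%:R * h ^+ 2 * C0) * Rs <= (B ^+ 2 + Theta * C0) * Rs.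
  by rewrite ler_wpM2r // lerD2l ler_wpM2r.
move=> /[swap] /le_trans /[apply].
have LD : 0 < L / D * h by rewrite mulr_gt0 // divr_gt0.
move/(ler_wpM2l (ltW LD)).
have -> : L / D * h * (D / L * \sum_(m < N) A m) = h * \sum_(m < N) A m.
  by field; rewrite !lt0r_neq0.
move/le_trans; apply; rewrite /energy_const0 -[L / D * h * _]mulrA ler_wpM2l //.
  by rewrite divr_ge0 // ltW.
have -> : h * ((B ^+ 2 + Theta * C0) * Rs) = (B ^+ 2 + Theta * C0) * (h * Rs) by ring.
have T0 : 0 <= Theta by apply: le_trans NT; rewrite mulr_ge0 // sqr_ge0.
by rewrite ler_wpM2l // addr_ge0 ?sqr_ge0 // mulr_ge0.
Qed.

(** The one-step inequality is multiplied by [m + 1], a discrete time. The weighted energies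
    telescope from 0, so the initial gradient never enters, and the price, one [A m] per step, is
    paid by [sum_energy0]. *)
Lemma sum_energy1 N Theta : N%:R * h ^+ 2 <= Theta ->
  h * (N%:R * A N) + (D * L)^-1 * (h * \sum_(m < N) m.+1%:R * Dm m) <=
  energy_const1 Theta.
Proof.
move=> NT; have T0 : 0 <= Theta by apply: le_trans NT; rewrite mulr_ge0 // sqr_ge0.
have C10 : 0 <= C1 by rewrite !mulr_ge0 ?sqr_ge0 ?invr_ge0 // ltW.
have DL0 : 0 < D * L by rewrite mulr_gt0.
have tel n : n%:R * h ^+ 2 <= Theta ->
    n%:R * A n + (D * L)^-1 * \sum_(m < n) m.+1%:R * Dm m <=
    (1 + 8 * D * L * Theta) * \sum_(m < n) A m + n%:R * (Theta * C1 * h ^+ 2 * Rs).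
  elim: n => [|n IH] nT; first by rewrite !big_ord0 !mul0r !mulr0 !addr0.
  rewrite !big_ord_recr /= !mulrDr.
  have {}IH : n%:R * h ^+ 2 <= Theta -> _ := IH.
  have nn : n%:R * h ^+ 2 <= Theta.
    by apply: le_trans nT; rewrite ler_wpM2r ?sqr_ge0 // ler_nat.
  have {}IH := IH nn.
  have n0 : 0 <= n.+1%:R :> R by [].
  have st := ler_wpM2l n0 (scheme_energy1 n).
  have P1 := ler_wpM2r (mulr_ge0 (mulr_ge0 (ler0n R 8) (ltW DL0)) (A_ge0 n)) nT.
  have P2 : n.+1%:R * h ^+ 2 * (C1 * h ^+ 2 * Rs) <= Theta * (C1 * h ^+ 2 * Rs).
    by rewrite ler_wpM2r // mulr_ge0 // mulr_ge0 // sqr_ge0.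
  have E : n.+1%:R = n%:R + 1 :> R by rewrite -[n.+1]addn1 natrD.
  rewrite E in st P1 P2 *.
  set k := (D * L)^-1 in st IH *.
  set s1 := \sum_(m < n) _ in IH *; set s2 := \sum_(m < n) A m in IH *.
  move: (A n) (A n.+1) (Dm n) st P1 P2 IH => An An1 Dn st P1 P2 IH.
  clearbody s1 s2 k Rs C1.
  by lra.
have q1 := sum_energy0 NT; have q2 := ler_wpM2l (ltW h0) (tel N NT).
rewrite mulrDr [h * ((D * L)^-1 * _)]mulrCA in q2; apply: (le_trans q2).
rewrite /energy_const1 mulrDr; apply: lerD.
  by rewrite mulrCA ler_wpM2l // addr_ge0 // !mulr_ge0 // ltW.
have -> : h * (N%:R * (Theta * C1 * h ^+ 2 * Rs)) =
  N%:R * h ^+ 2 * (Theta * C1) * (h * Rs) by ring.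
have -> : 4 * Theta ^+ 2 * C1 = Theta * (Theta * C1) * 4 by ring.
have TC : 0 <= Theta * C1 by rewrite mulr_ge0.
apply: ler_pM => //; first by rewrite mulr_ge0 // mulr_ge0 // sqr_ge0.
  by rewrite mulr_ge0 // ltW.
by rewrite ler_wpM2r.
Qed.
End scheme_energy.

(** * From energy sums to pointwise differences *)

Section grid_holder.
Context (R : realFieldType).
Variables (w : nat -> int -> R) (rho : int -> R) (M : nat) (c : R).
Hypotheses (c0 : 0 < c) (rho0 : forall i, 0 < rho i).
Let A m := wsum2 M rho (fun i => w m (i + 1) - w m i).
Let Dm m := wsum2 M rho (fun i => w m.+1 i - w m i).

Lemma zsum_window_weight (f : int -> R) (i : int) r : (forall j, 0 <= f j) ->
  - Posz M <= i -> i + Posz r <= Posz M ->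
  (forall j : nat, (j < r)%N -> c <= rho (i + Posz j)) ->
  c * \sum_(j < r) f (i + Posz j) <= zsum M (fun j => rho j * f j).
Proof.
move=> f0 iM irM cr; apply: le_trans (zsum_window _ iM irM); last first.
  by move=> j; rewrite mulr_ge0 // ltW.
by rewrite mulr_sumr; apply: ler_sum => j _; rewrite ler_wpM2r // cr.
Qed.

Lemma grid_holder_space m (i : int) r : - Posz M <= i -> i + Posz r <= Posz M ->
  (forall j : nat, (j < r)%N -> c <= rho (i + Posz j)) ->
  c * (w m (i + Posz r) - w m i) ^+ 2 <= r%:R * A m.
Proof.
move=> iM irM cr.
have -> : w m (i + Posz r) - w m i =
    \sum_(j < r) (w m (i + Posz j + 1) - w m (i + Posz j)).
  elim: r {irM cr} => [|r IH]; first by rewrite big_ord0 addr0 subrr.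
  rewrite big_ord_recr /= -IH; have -> : i + Posz r.+1 = i + Posz r + 1 by lia.
  by ring.
have q := sqr_sum_le r (fun j => w m (i + Posz j + 1) - w m (i + Posz j)).
have {}q := ler_wpM2l (ltW c0) q; apply: (le_trans q).
rewrite mulrCA ler_wpM2l //.
by apply: (zsum_window_weight (f := fun j => (w m (j + 1) - w m j) ^+ 2)) => // j; exact: sqr_ge0.
Qed.

(** Time increments are controlled only in the mean over space. The path from [(i, m1)] to [(i, m2)]
    therefore makes a detour through [i + j], and the three squared increments are averaged over
    [j < r]. A large [r] helps the time part and harms the space part; it stays free to be
    optimised. *)
Lemma grid_holder_time m1 m2 (i : int) r : (m1 <= m2)%N ->
  - Posz M <= i -> i + Posz r <= Posz M ->
  (forall j : nat, (j < r)%N -> c <= rho (i + Posz j)) ->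
  c * r%:R * (w m2 i - w m1 i) ^+ 2 <=
    3 * ((m2 - m1)%:R * \sum_(m1 <= m < m2) Dm m + r%:R ^+ 2 * (A m1 + A m2)).
Proof.
move=> m12 iM irM cr.
have A0 m : 0 <= A m.
  exact: wsum2_ge0.
have tri j : (j < r)%N -> c * (w m2 i - w m1 i) ^+ 2 <=
  3 * (c * (w m2 (i + Posz j) - w m1 (i + Posz j)) ^+ 2 + r%:R * (A m1 + A m2)).
  move=> jr; have H m : c * (w m (i + Posz j) - w m i) ^+ 2 <= r%:R * A m.
    apply: le_trans (_ : j%:R * A m <= _).
      apply: grid_holder_space => //; first by lia.
      by move=> l lj; apply: cr; lia.
    by rewrite ler_wpM2r // ler_nat ltnW.
  have := H m1; have := H m2; set p := w m2 (i + _); set q := w m1 (i + _).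
  move=> H2 H1; have : (w m2 i - w m1 i) ^+ 2 <=
      3 * ((p - q) ^+ 2 + (q - w m1 i) ^+ 2 + (p - w m2 i) ^+ 2).
    set x := p - q; set y := q - w m1 i; set z := p - w m2 i.
    have -> : w m2 i - w m1 i = x + y - z by rewrite /x /y /z; ring.
    have := sqr_ge0 (x - y); have := sqr_ge0 (x + z); have := sqr_ge0 (y + z).
    by lra.
  by move=> /(ler_wpM2l (ltW c0)); lra.
have : \sum_(j < r) (c * (w m2 i - w m1 i) ^+ 2) <=
   \sum_(j < r) (3 * (c * (w m2 (i + Posz j) - w m1 (i + Posz j)) ^+ 2 + r%:R * (A m1 + A m2))).
  by apply: ler_sum => j _; exact: tri.
have mn (x : R) : \sum_(j < r) x = r%:R * x by rewrite sumr_const card_ord mulr_natl.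
rewrite mn mulrCA mulrA => /le_trans; apply.
rewrite -mulr_sumr ler_pM2l // big_split /= mn.
rewrite [X in _ + X <= _]mulrA -expr2 lerD2r -mulr_sumr.
have st (j : nat) : (w m2 (i + Posz j) - w m1 (i + Posz j)) ^+ 2 <=
    (m2 - m1)%:R * \sum_(m1 <= m < m2) (w m.+1 (i + Posz j) - w m (i + Posz j)) ^+ 2.
  rewrite -(@telescope_sumr _ m1 m2 (fun m => w m (i + Posz j))) //.
  rewrite -{1 3}[m1]add0n !big_addn !big_mkord.
  exact: (sqr_sum_le _ (fun m => w (m + m1).+1 (i + Posz j) - w (m + m1)%N (i + Posz j))).
have : \sum_(j < r) (w m2 (i + Posz j) - w m1 (i + Posz j)) ^+ 2 <=
    (m2 - m1)%:R * \sum_(m1 <= m < m2) \sum_(j < r) (w m.+1 (i + Posz j) - w m (i + Posz j)) ^+ 2.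
  by rewrite exchange_big /= mulr_sumr; apply: ler_sum => j _; exact: st.
move/(ler_wpM2l (ltW c0)) => /le_trans; apply.
rewrite mulrCA ler_wpM2l // mulr_sumr; apply: ler_sum => m _.
apply: (zsum_window_weight (f := fun j => (w m.+1 j - w m j) ^+ 2)) => // j.
exact: sqr_ge0.
Qed.

End grid_holder.

(** * The explicit scheme *)

Section grid.
Context (R : realType).
Implicit Types (h tau x t : R).

Definition mesh n : R := 2^-1 ^+ n.

Definition cell h x : int := Num.floor (x / h).

Definition slot tau t : nat := Num.truncn (t / tau).

Definition interp h tau (f : nat -> int -> R) (z : R * R) : R :=
  f (slot tau z.2) (cell h z.1).

Lemma mesh_gt0 n : 0 < mesh n. Proof. by rewrite exprn_gt0 ?invr_gt0. Qed.

Lemma mesh_le1 n : mesh n <= 1.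
Proof. by rewrite /mesh exprn_ile1 ?invr_ge0 ?invf_le1 ?ler1n. Qed.

Lemma mesh_pow2 n : (2 ^ n)%:R * mesh n = 1.
Proof. by rewrite /mesh natrX exprVn divff // expf_neq0 // pnatr_eq0. Qed.

Lemma mesh_le n : mesh n <= n.+1%:R^-1.
Proof.
rewrite /mesh exprVn -natrX lef_pV2 ?posrE ?ltr0n ?expn_gt0 // ler_nat.
exact: ltn_expl.
Qed.

Lemma cell_itv h x : 0 < h -> (cell h x)%:~R * h <= x < ((cell h x)%:~R + 1) * h.
Proof.
move=> h0; have := floor_itv (x / h); rewrite intrD.
by rewrite ler_pdivlMr // ltr_pdivrMr.
Qed.

Lemma slot_itv tau t : 0 < tau -> 0 <= t ->
  (slot tau t)%:R * tau <= t < ((slot tau t)%:R + 1) * tau.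
Proof.
move=> tau0 t0; have /truncn_itv : 0 <= t / tau by rewrite divr_ge0 // ltW.
by rewrite -[_.+1]addn1 natrD ler_pdivlMr // ltr_pdivrMr.
Qed.

Lemma weight_ge J h i : 0 < h -> h * (absz i)%:R <= J -> expR (- J) <= weight h i.
Proof.
move=> h0 hJ; rewrite /weight exprVn expRN lef_pV2 ?posrE ?expR_gt0 ?exprn_gt0 //; last by lra.
apply: le_trans (_ : expR h ^+ absz i <= _).
  by rewrite lerXn2r ?nnegrE ?expR_ge0 ?expR_ge1Dx //; lra.
by rewrite -expRM_natl ler_expR mulrC.
Qed.

End grid.

(* Explicit finite differences with mesh [2^-n] and time step [lam * 4^-n] for
   [u_t = d phi(u)_xx - s] on [(-n, n)] with zero boundary values; [D = lam d]. *)
Record scheme (R : realType) (phi : R -> R) (lam D B L S : R) (a0 : R -> R)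
    (a s : nat -> nat -> int -> R) : Prop := Scheme {
  scheme_lam : 0 < lam <= 1;
  scheme_D : 0 < D;
  scheme_L : 0 < L;
  scheme_S : 0 <= S;
  scheme_cfl : 24 * D * L <= 1;
  scheme_phi0 : phi 0 = 0;
  scheme_phi_lip : forall x y : R, 0 <= x <= B -> 0 <= y <= B ->
    (phi y - phi x) ^+ 2 <= L * ((y - x) * (phi y - phi x));
  scheme_bnd : forall n m i, 0 <= a n m i <= B;
  scheme_reaction_bnd : forall n m i, 0 <= s n m i <= S;
  scheme_out : forall n m i, (n * 2 ^ n <= absz i)%N -> a n m i = 0;
  scheme_init : forall n i, (absz i < n * 2 ^ n)%N -> a n 0%N i = a0 (i%:~R * mesh R n);
  scheme_step : forall n m i, (absz i < n * 2 ^ n)%N ->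
    a n m.+1 i = a n m i +
      (D * (phi (a n m (i + 1)) - 2 * phi (a n m i) + phi (a n m (i - 1)))
       - lam * mesh R n ^+ 2 * s n m i) }.

Section modulus.
Context (R : realType) (phi : R -> R) (lam D B L S : R) (a0 : R -> R)
  (a s : nat -> nat -> int -> R).
Hypothesis sc : scheme phi lam D B L S a0 a s.
Notation h := (mesh R).
Notation tau n := (lam * mesh R n ^+ 2).

Definition grid_state n z : R := interp (h n) (tau n) (a n) z.

Let w n m i := phi (a n m i).
Let M n := (n * 2 ^ n).+2.
Let An n m := wsum2 (M n) (weight (h n)) (fun i => w n m (i + 1) - w n m i).
Let Dn n m := wsum2 (M n) (weight (h n)) (fun i => w n m.+1 i - w n m i).

Lemma tau_gt0 n : 0 < tau n.
Proof.
by have /andP[l0 _] := scheme_lam sc; rewrite mulr_gt0 // exprn_gt0 // mesh_gt0.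
Qed.

Lemma tau_le n : tau n <= h n.
Proof.
have /andP[l0 l1] := scheme_lam sc.
have h0 := mesh_gt0 R n; have h1 := mesh_le1 R n.
apply: le_trans (_ : 1 * h n ^+ 2 <= _).
  by rewrite ler_wpM2r ?sqr_ge0.
by rewrite mul1r expr2 -[leRHS]mulr1 ler_wpM2l // ltW.
Qed.

Section bounds.
Variables (T : R) (n N : nat).
Hypothesis NT : N%:R * tau n <= T.
Let Theta := T / lam.
Let K := energy_const1 lam D B L S Theta.

Let NTh : N%:R * h n ^+ 2 <= Theta.
Proof.
have /andP[l0 _] := scheme_lam sc.
by rewrite /Theta ler_pdivlMr // -mulrA [_ ^+ 2 * lam]mulrC.
Qed.

Let An0 m : 0 <= An n m.
Proof. by apply: wsum2_ge0 => i; apply/weight_gt0/mesh_gt0. Qed.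

Let Dn0 m : 0 <= Dn n m.
Proof. by apply: wsum2_ge0 => i; apply/weight_gt0/mesh_gt0. Qed.

Let E1 : h n * (N%:R * An n N) + (D * L)^-1 * (h n * \sum_(m < N) m.+1%:R * Dn n m) <= K.
Proof.
have /andP[l0 _] := scheme_lam sc.
exact: (sum_energy1 (mesh_gt0 R n) (mesh_le1 R n) l0 (scheme_D sc) (scheme_L sc)
 (scheme_S sc) (scheme_cfl sc) (scheme_phi0 sc) (scheme_phi_lip sc) (scheme_bnd sc n)
  (scheme_reaction_bnd sc n) (scheme_out sc (n := n)) (scheme_step sc (n := n)) NTh).
Qed.

Lemma scheme_sum_energy0 : h n * \sum_(m < N) An n m <= energy_const0 lam D B L S Theta.
Proof.
have /andP[l0 _] := scheme_lam sc.
exact: (sum_energy0 (mesh_gt0 R n) (mesh_le1 R n) l0 (scheme_D sc) (scheme_L sc)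
 (scheme_S sc) (scheme_cfl sc) (scheme_phi0 sc) (scheme_phi_lip sc) (scheme_bnd sc n)
  (scheme_reaction_bnd sc n) (scheme_out sc (n := n)) (scheme_step sc (n := n)) NTh).
Qed.

Lemma scheme_energy_space : h n * (N%:R * An n N) <= K.
Proof.
apply: le_trans E1; rewrite lerDl mulr_ge0 ?invr_ge0 //.
  by rewrite mulr_ge0 // ltW ?(scheme_D sc) ?(scheme_L sc).
by rewrite mulr_ge0 ?(ltW (mesh_gt0 R n)) // sumr_ge0 // => m _; rewrite mulr_ge0.
Qed.

Lemma scheme_energy_time : h n * \sum_(m < N) m.+1%:R * Dn n m <= D * L * K.
Proof.
have DL : 0 < D * L by rewrite mulr_gt0 // ?(scheme_D sc) ?(scheme_L sc).
rewrite -ler_pdivrMl //; apply: le_trans E1; rewrite lerDr.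
by rewrite mulr_ge0 ?(ltW (mesh_gt0 R n)) // mulr_ge0.
Qed.

Lemma scheme_const_ge0 : 0 <= K.
Proof. by apply: le_trans scheme_energy_space; rewrite !mulr_ge0 // ltW // mesh_gt0. Qed.

End bounds.

Lemma cell_diff x y n : cell (h n) x <= cell (h n) y ->
  exists2 r : nat, cell (h n) y = cell (h n) x + Posz r & r%:R * h n <= `|x - y| + h n.
Proof.
have h0 := mesh_gt0 R n.
move=> xy; exists (absz (cell (h n) y - cell (h n) x)); first by lia.
have /andP[x1 x2] := cell_itv x h0; have /andP[y1 y2] := cell_itv y h0.
rewrite natr_absz ger0_norm ?subr_ge0 // intrD mulrDl rmorphN mulNr.
by have := ler_norm (y - x); rewrite distrC; lra.
Qed.

Lemma scheme_window J n x r : J + 4 <= n%:R -> `|x| <= J ->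
  ((cell (h n) x)%:~R + r%:R) * h n <= J + 2 ->
  [/\ - Posz (M n) <= cell (h n) x, cell (h n) x + Posz r <= Posz (M n) &
      forall j : nat, (j < r)%N -> expR (- (J + 3)) <= weight (h n) (cell (h n) x + Posz j)].
Proof.
move=> nJ; have h0 := mesh_gt0 R n; have h1 := mesh_le1 R n.
have Pn : (n * 2 ^ n)%:R * h n = n%:R by rewrite natrM -mulrA mesh_pow2 mulr1.
rewrite ler_norml => /andP[xJ1 xJ2] r2; have /andP[x1 x2] := cell_itv x h0.
have B1 : - (n * 2 ^ n)%:R * h n <= (cell (h n) x)%:~R * h n by rewrite mulNr Pn; lra.
have B2 : ((cell (h n) x)%:~R + r%:R) * h n <= (n * 2 ^ n)%:R * h n by rewrite Pn; lra.
move: B1 B2; rewrite !ler_pM2r // !pmulrn -mulrNz -intrD !ler_int => B1 B2.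
split.
- by rewrite /M; move: (n * 2 ^ n)%N (cell _ _) B1 => p q; clear; lia.
- by rewrite /M; move: (n * 2 ^ n)%N (cell _ _) B2 => p q; clear; lia.
move=> j jr; apply: weight_ge => //.
rewrite mulrC natr_absz; have -> : `|cell (h n) x + Posz j|%:~R * h n =
  `|((cell (h n) x)%:~R + j%:R) * h n|.
  by rewrite normrM (gtr0_norm h0) pmulrn -intrD -intr_norm.
have jr' : j%:R * h n <= r%:R * h n by rewrite ler_pM2r // ler_nat ltnW.
have j0 : 0 <= j%:R * h n by rewrite mulr_ge0 // ltW.
by move: r2; rewrite ler_norml !mulrDl => r2; apply/andP; split; lra.
Qed.

(** At times at least [s0] the time-weighted estimate bounds each single gradient sum [A m] by a
    multiple of [h], whence a modulus of order 1/2 in space. In time, [eta] is the width of the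
    averaging interval of [grid_holder_time]. The terms [h n] account for the rounding of points to
    cells and slots, the approximations being step functions. *)
Lemma scheme_modulus (J s0 T : R) : 0 < s0 -> exists C, 0 <= C /\ exists n0 : nat,
  forall n, (n0 <= n)%N ->
  (forall x y t, `|x| <= J -> `|y| <= J -> s0 <= t <= T ->
    (phi (grid_state n (x, t)) - phi (grid_state n (y, t))) ^+ 2 <= C * (`|x - y| + h n)) /\
  (forall x t t' eta, `|x| <= J -> s0 <= t <= T -> s0 <= t' <= T -> 0 < eta <= 1 ->
    (phi (grid_state n (x, t)) - phi (grid_state n (x, t'))) ^+ 2 <=
      C * ((`|t - t'| + h n) / eta + eta + h n)).
Proof.
move=> s00; have /andP[lam0 lam1] := scheme_lam sc.
pose K := energy_const1 lam D B L S (T / lam).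
pose c := expR (- (J + 3)).
pose K' := D * L * K.
pose C1 := 2 * K * lam / (s0 * c); pose C2 := 3 / c * (K' / s0 + 4 * K * lam / s0).
have [T0|T0] := ltP T 0.
  exists 0; split=> //; exists 0%N => n _; split.
    by move=> x y t _ _ /andP[]; lra.
  by move=> x t t' eta _ /andP[]; lra.
have c0 : 0 < c by exact: expR_gt0.
have DL : 0 < D * L by rewrite mulr_gt0 // ?(scheme_D sc) ?(scheme_L sc).
have K0 : 0 <= K by apply: (@scheme_const_ge0 T 0 0); rewrite mul0r.
have K'0 : 0 <= K' by rewrite mulr_ge0 // ltW.
have C10 : 0 <= C1 by rewrite !mulr_ge0 ?invr_ge0 ?mulr_ge0 // ltW.
have C20 : 0 <= C2.
  apply: mulr_ge0; first by rewrite divr_ge0 // ltW.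
  apply: addr_ge0; first by rewrite divr_ge0 // ltW.
  by apply: divr_ge0; rewrite ?(ltW s00) // mulr_ge0 ?mulr_ge0 // ltW.
exists (C1 + C2); split; first exact: addr_ge0.
(* The first summand lets the grid reach beyond [J + 4]; the second gives [h n <= s0 / 2], so that
   the slot of a time [t >= s0] starts no earlier than [s0 / 2]. *)
pose n0 := (Num.truncn (J + 4) + Num.truncn (2 / s0)).+1; exists n0 => n n0n.
have h0 := mesh_gt0 R n; have h1 := mesh_le1 R n.
have tau0 := tau_gt0 n; have tauh := tau_le n.
have nJ : J + 4 <= n%:R.
  apply/ltW; apply: lt_le_trans (truncnS_gt _) _; rewrite ler_nat.
  by apply: leq_trans n0n; rewrite ltnS leq_addr.
have hs : h n <= s0 / 2.
  apply: le_trans (mesh_le R n) _; rewrite -[s0 / 2]invrK lef_pV2 ?posrE ?invr_gt0 ?divr_gt0 //.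
  rewrite invf_div; apply/ltW; apply: lt_le_trans (truncnS_gt _) _; rewrite ler_nat.
  by rewrite ltnS; apply: leq_trans (ltnW n0n); exact: leq_addl.
have tau2 : 2 * tau n <= s0 by lra.
have rho0 i : 0 < weight (h n) i by exact: weight_gt0.
have win x r := @scheme_window J n x r nJ.
have slotT t : s0 <= t <= T -> (slot (tau n) t)%:R * tau n <= T /\
    s0 <= 2 * ((slot (tau n) t)%:R * tau n).
  move=> /andP[t1 t2]; have /andP[] := slot_itv tau0 (le_trans (ltW s00) t1).
  by rewrite mulrDl mul1r => p q; split; lra.
have AK t : s0 <= t <= T -> An n (slot (tau n) t) <= h n * (2 * K * lam / s0).
  move=> /slotT[mT ms]; have := scheme_energy_space mT; rewrite -/K.
  set m := slot _ _ in mT ms *; set An1 := An n m => HK.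
  have An0 : 0 <= An1 by apply: wsum2_ge0.
  have {}HK : m%:R * tau n * An1 <= h n * K * lam.
    have := ler_wpM2l (ltW (mulr_gt0 h0 lam0)) HK; lra.
  have -> : h n * (2 * K * lam / s0) = 2 * (h n * K * lam) / s0 by ring.
  by rewrite ler_pdivlMr //; have := ler_wpM2l An0 ms; lra.
split.
- move=> x y t xJ yJ tT; wlog xy : x y xJ yJ / cell (h n) x <= cell (h n) y.
    move=> H; have [/H|/ltW/H] := leP (cell (h n) x) (cell (h n) y); first exact.
    by rewrite distrC -sqrrN opprB; exact.
  have [r ry rh] := cell_diff xy.
  have [|w1 w2 w3] := win x r xJ.
    have -> : (cell (h n) x)%:~R + r%:R = (cell (h n) y)%:~R :> R by rewrite ry intrD.
    have /andP[+ _] := cell_itv y h0.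
    by move: yJ; rewrite ler_norml => /andP[_]; lra.
  have := grid_holder_space (w n) c0 rho0 (slot (tau n) t) w1 w2 w3.
  rewrite -ry -/(An n (slot (tau n) t)) => H.
  have {}H := le_trans H (ler_wpM2l (ler0n R r) (AK t tT)).
  have -> : phi (grid_state n (x, t)) - phi (grid_state n (y, t)) =
     - (w n (slot (tau n) t) (cell (h n) y) - w n (slot (tau n) t) (cell (h n) x)).
    by rewrite opprB.
  rewrite sqrrN; apply: le_trans (_ : C1 * (`|x - y| + h n) <= _); last first.
    by rewrite ler_wpM2r ?addr_ge0 ?(ltW h0) // lerDl.
  rewrite -(ler_pM2l c0); apply: (le_trans H).
  have -> : c * (C1 * (`|x - y| + h n)) = (2 * K * lam / s0) * (`|x - y| + h n).
    by rewrite /C1; field; rewrite !lt0r_neq0.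
  rewrite mulrA mulrC ler_wpM2l // !mulr_ge0 ?invr_ge0 // ltW //.
- move=> x t t' eta xJ tT t'T /andP[eta0 eta1].
  wlog tt' : t t' tT t'T / t <= t'.
    move=> H; have [/H|/ltW/H] := leP t t'; first exact.
    by rewrite [`|t - _|]distrC -[in X in _ -> X]sqrrN opprB; exact.
  (* These cells have total length between [eta] and [eta + h n]; as [eta <= 1], they stay to the
     left of [J + 2], where the weight is at least [c]. *)
  pose r := (Num.truncn (eta / h n)).+1.
  have r1 : eta <= r%:R * h n.
    by rewrite -ler_pdivrMr //; apply/ltW/truncnS_gt.
  have r2 : r%:R * h n <= eta + h n.
    rewrite /r -[_.+1]addn1 natrD mulrDl mul1r lerD2r -ler_pdivlMr //.
    by rewrite truncn_le divr_ge0 // ltW.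
  have [|w1 w2 w3] := win x r xJ.
    have /andP[+ _] := cell_itv x h0.
    by move: xJ; rewrite ler_norml mulrDl => /andP[_]; lra.
  have m12 : (slot (tau n) t <= slot (tau n) t')%N.
    by apply: le_truncn; rewrite ler_pM2r ?invr_gt0.
  have := grid_holder_time (w n) c0 rho0 m12 w1 w2 w3.
  have := AK t tT; have := AK t' t'T.
  have [mT ms] := slotT t tT; have [m'T _] := slotT t' t'T.
  have /andP[p1 p2] := slot_itv tau0 (le_trans (ltW s00) (proj1 (andP tT))).
  have /andP[p3 p4] := slot_itv tau0 (le_trans (ltW s00) (proj1 (andP t'T))).
  have := scheme_energy_time m'T; rewrite -/K -/K'.
  rewrite -[phi (grid_state n (x, t))]/(w n (slot (tau n) t) (cell (h n) x)).
  rewrite -[phi (grid_state n (x, t'))]/(w n (slot (tau n) t') (cell (h n) x)).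
  set m1 := slot (tau n) t in m12 mT ms p1 p2 *.
  set m2 := slot (tau n) t' in m12 m'T p3 p4 *.
  rewrite -/(An n m1) -/(An n m2) => HK' HA2 HA1 H.
  (* The least time weight of the range is taken out of the sum bounded by [scheme_energy_time]. *)
  have HD : m1.+1%:R * \sum_(m1 <= m < m2) Dn n m <= K' / h n.
    rewrite ler_pdivlMr // mulrC; apply: le_trans HK'.
    rewrite ler_pM2l // mulr_sumr -[leRHS](big_mkord xpredT (fun m => m.+1%:R * Dn n m)).
    have Dn0 m : 0 <= Dn n m by exact: wsum2_ge0.
    rewrite (big_cat_nat (leq0n m1) m12) /= ler_wpDl //.
      by apply: sumr_ge0 => m _; rewrite mulr_ge0.
    rewrite !big_nat; apply: ler_sum => m /andP[m1m _].
    by rewrite ler_wpM2r // ler_nat.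
  set SD := \sum_(m1 <= m < m2) Dn n m in HD H.
  have SD0 : 0 <= SD by apply: sumr_ge0 => m _; exact: wsum2_ge0.
  rewrite -[leLHS]sqrrN opprB.
  set Y := (_ - _) ^+ 2 in H *.
  have B1 : (m2 - m1)%:R * tau n <= `|t - t'| + h n.
    rewrite natrB // mulrBl ler0_norm ?subr_le0 // opprB.
    by move: p2; rewrite mulrDl mul1r; lra.
  have B2 : SD * s0 <= tau n * (K' / h n).
    have := ler_wpM2l (ltW tau0) HD; apply: le_trans.
    have : t <= m1.+1%:R * tau n by rewrite -[m1.+1]addn1 natrD ltW.
    have /andP[s0t _] := tT; move=> q; have := ler_wpM2r SD0 (le_trans s0t q).
    by lra.
  have B3 : (m2 - m1)%:R * SD * h n <= (`|t - t'| + h n) * (K' / s0).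
    have : (m2 - m1)%:R * (SD * s0) <= (`|t - t'| + h n) * (K' / h n).
      apply: le_trans (ler_wpM2l (ler0n R _) B2) _.
      by rewrite [leLHS]mulrA ler_wpM2r // divr_ge0 // ltW.
    move/(ler_wpM2r (ltW (divr_gt0 h0 s00))).
    have -> : (m2 - m1)%:R * (SD * s0) * (h n / s0) = (m2 - m1)%:R * SD * h n.
      by field; exact: lt0r_neq0.
    move/le_trans; apply; rewrite le_eqVlt; apply/orP; left; apply/eqP.
    by field; rewrite !lt0r_neq0.
  have B4 : An n m1 + An n m2 <= h n * (4 * K * lam / s0).
    have -> : 4 * K * lam / s0 = 2 * K * lam / s0 + 2 * K * lam / s0 by ring.
    by rewrite mulrDr lerD.
  have rh0 : 0 < r%:R * h n by rewrite mulr_gt0.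
  have kl : 0 <= 4 * K * lam / s0 by rewrite !mulr_ge0 ?invr_ge0 // ltW.
  have H2 : c * (r%:R * h n) * Y <= 3 * ((`|t - t'| + h n) * (K' / s0) +
      (r%:R * h n) ^+ 2 * (4 * K * lam / s0)).
    have := ler_wpM2r (ltW h0) H; have := ler_wpM2l (mulr_ge0 (sqr_ge0 r%:R) (ltW h0)) B4.
    by lra.
  rewrite -(ler_pM2l (mulr_gt0 c0 rh0)); apply: (le_trans H2).
  have dt0 : 0 <= `|t - t'| + h n by rewrite addr_ge0 // ltW.
  have T1 : (`|t - t'| + h n) * (K' / s0) <=
      (r%:R * h n) * ((`|t - t'| + h n) / eta * (K' / s0)).
    rewrite [leRHS](_ : _ = (r%:R * h n * ((`|t - t'| + h n) / eta)) * (K' / s0)); last by ring.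
    apply: ler_wpM2r; first by rewrite divr_ge0 // ltW.
    by rewrite mulrCA -[leLHS]mulr1 ler_wpM2l // ler_pdivlMr // mul1r.
  have T2 : (r%:R * h n) ^+ 2 * (4 * K * lam / s0) <=
      (r%:R * h n) * ((eta + h n) * (4 * K * lam / s0)).
    by rewrite expr2 -mulrA ler_pM2l // ler_wpM2r.
  apply: (le_trans (ler_wpM2l (ler0n R 3) (lerD T1 T2))).
  have -> : 3 * (r%:R * h n * ((`|t - t'| + h n) / eta * (K' / s0)) +
     r%:R * h n * ((eta + h n) * (4 * K * lam / s0))) =
    c * (r%:R * h n) * (3 / c * ((`|t - t'| + h n) / eta * (K' / s0) +
      (eta + h n) * (4 * K * lam / s0))) by field; rewrite !lt0r_neq0.
  rewrite ler_pM2l ?mulr_gt0 //.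
  have e0 : 0 <= (`|t - t'| + h n) / eta by rewrite divr_ge0 // ltW.
  have eh : 0 <= eta + h n by rewrite addr_ge0 // ltW.
  apply: le_trans (_ : C2 * ((`|t - t'| + h n) / eta + eta + h n) <= _); last first.
    by apply: ler_wpM2r; [rewrite -addrA addr_ge0|rewrite lerDr].
  rewrite /C2 -[3 / c * _ * _]mulrA; apply: ler_wpM2l; first by rewrite divr_ge0 // ltW.
  have K's : 0 <= K' / s0 by rewrite divr_ge0 // ltW.
  move: kl K's e0 eh; clear; set k1 := 4 * K * _ / _; set k2 := K' / _.
  move: ((`|t - t'| + h n) / eta) (h n) k1 k2 => z y k1 k2 p1 p2 p3 p4.
  by have := mulr_ge0 p3 p1; have := mulr_ge0 p4 p2; lra.
Qed.

End modulus.

(** * Extraction of a limit *)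

Lemma ultra_image (T U : Type) (F : set_system T) (f : T -> U) :
  UltraFilter F -> UltraFilter (f @ F).
Proof.
move=> UF; split=> [|G GF FG]; first exact: fmap_proper_filter.
apply/seteqP; split=> A; last exact: FG.
move=> GA; have [//|FA] := in_ultra_setVsetC (f @^-1` A) UF.
have : G (A `&` ~` A) by apply: filterI => //; exact: FG.
by rewrite setICr => /filter_not_empty.
Qed.

Section extraction.
Context (R : realType).

Lemma ultra_bounded_cvg (F : set_system nat) (f : nat -> R) (b : R) : UltraFilter F ->
  (forall n, `|f n| <= b) -> exists l : R, f @ F --> l.
Proof.
move=> UF fb; have := @segment_compact R (- b) b; rewrite compact_ultra.
move=> /(_ (f @ F) (ultra_image f UF))[]; last by move=> l [_ ?]; exists l.
by apply: (@filterE _ F) => n /=; rewrite in_itv /= -ler_norml.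
Qed.

(** Step functions cannot be equicontinuous in the strict sense. Here their jumps only have to
    become small, so the index [N] depends on [e]. *)
Definition asymp_equicont (f : nat -> R * R -> R) (z : R * R) : Prop :=
  forall e, 0 < e -> exists2 d, 0 < d & exists N : nat, forall n z', (N <= n)%N ->
    `|z'.1 - z.1| <= d -> `|z'.2 - z.2| <= d -> `|f n z' - f n z| <= e.

Lemma asymp_equicont_lim (F : set_system nat) f g z : ProperFilter F -> \oo `<=` F ->
  (forall z, f ^~ z @ F --> g z) -> asymp_equicont f z ->
  forall e, 0 < e -> exists2 d, 0 < d & forall z',
    `|z'.1 - z.1| <= d -> `|z'.2 - z.2| <= d -> `|g z' - g z| <= e.
Proof.
move=> PF ooF fg fz e e0; have [d d0 [N H]] := fz e e0.
exists d => // z' z1 z2.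
have fzz' : (fun n => `|f n z' - f n z|) @ F --> `|g z' - g z|.
  by apply: cvg_norm; apply: cvgB; exact: fg.
rewrite -(cvg_lim (@Rhausdorff R) fzz'); apply: limr_le; first by apply/cvg_ex; eexists; exact: fzz'.
by apply: ooF; exists N => // n Nn; exact: H.
Qed.

Lemma asymp_equicont_cvg (sigma : nat -> nat) f g z : (forall j, (j <= sigma j)%N) ->
  asymp_equicont f z ->
  (forall e, 0 < e -> exists2 d, 0 < d & forall z',
    `|z'.1 - z.1| <= d -> `|z'.2 - z.2| <= d -> `|g z' - g z| <= e) ->
  (forall p q : rat, f (sigma j) (ratr p, ratr q) @[j --> \oo] --> g (ratr p, ratr q)) ->
  f (sigma j) z @[j --> \oo] --> g z.
Proof.
move=> sj fz gz fq; apply/cvgrPdist_le => e e0.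
have e30 : 0 < e / 3 by rewrite divr_gt0.
have [d1 d10 [N H]] := fz _ e30; have [d2 d20 G] := gz _ e30.
pose d := Num.min d1 d2; have d0 : 0 < d by rewrite lt_min d10.
have near_rat (y : R) : exists q : rat, `|ratr q - y| <= d.
  have [|q] := @rat_in_itvoo R (y - d) (y + d); first by lra.
  rewrite in_itv /= => /andP[q1 q2]; exists q.
  by rewrite ler_norml; apply/andP; split; lra.
have [[p pz] [q qz]] := (near_rat z.1, near_rat z.2).
move: pz qz; rewrite /d !le_min => /andP[p1 p2] /andP[q1 q2].
have /cvgrPdist_le/(_ _ e30) fpq := fq p q.
near=> j.
have A1 : `|f (sigma j) (ratr p, ratr q) - f (sigma j) z| <= e / 3.
  by apply: H => //; apply: leq_trans (sj j); near: j; exact: nbhs_infty_ge.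
have A2 : `|g (ratr p, ratr q) - f (sigma j) (ratr p, ratr q)| <= e / 3 by near: j.
have A3 := G (ratr p, ratr q) p2 q2.
have -> : g z - f (sigma j) z = (f (sigma j) (ratr p, ratr q) - f (sigma j) z) +
   (g (ratr p, ratr q) - f (sigma j) (ratr p, ratr q)) - (g (ratr p, ratr q) - g z) by ring.
apply: le_trans (ler_normB _ _) _; have := ler_normD (f (sigma j) (ratr p, ratr q) - f (sigma j) z)
  (g (ratr p, ratr q) - f (sigma j) (ratr p, ratr q)).
by lra.
Unshelve. all: by end_near. Qed.

(** Dominated convergence wants a sequence, not an ultrafilter. The [j]-th index is chosen so that
    the first [j] coordinates are within [1 / (j + 1)] of their limits; such indices form a member
    of [F], hence exist. The choice need not be monotone: [j <= sigma j] is enough to tend to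
    infinity. *)
Lemma ultra_subsequence (F : set_system nat) (I : countType) (f : nat -> I -> R) (g : I -> R) :
  ProperFilter F -> \oo `<=` F -> (forall i, f ^~ i @ F --> g i) ->
  exists2 sigma : nat -> nat, (forall j, (j <= sigma j)%N) &
    forall i, f (sigma j) i @[j --> \oo] --> g i.
Proof.
move=> PF ooF fg.
have step (j : nat) : exists n : nat, (j <= n)%N /\
    forall i : I, (pickle i < j)%N -> `|g i - f n i| <= j.+1%:R^-1.
  have : F [set n | (j <= n)%N /\
      forall i : I, (pickle i < j)%N -> `|g i - f n i| <= j.+1%:R^-1].
    apply: filterI; first by apply: ooF; exists j.
    have : \forall n \near F, forall k : 'I_j, forall i : I, pickle i = k ->
        `|g i - f n i| <= j.+1%:R^-1.
      apply: filter_forall => k.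
      have [[i ik]|no] := pselect (exists i : I, pickle i = k).
        have /cvgrPdist_le/(_ j.+1%:R^-1) := fg i; rewrite invr_gt0 ltr0n => /(_ isT).
        apply: filterS => n Hn i'; rewrite -ik => /(congr1 (@unpickle I)).
        by rewrite !pickleK => -[->].
      by apply: filterE => n i ik; exfalso; apply: no; exists i.
    by apply: filterS => n H i ij; exact: (H (Ordinal ij)).
  by move/filter_ex => [n ?]; exists n.
have /choice[sigma sig] := step.
exists sigma; first by move=> j; have [] := sig j.
move=> i; apply/cvgrPdist_le => e e0; near=> j.
have [_ /(_ i)] := sig j; move/(_ _)/le_trans; apply.
  by near: j; exact: nbhs_infty_gt.
by apply: ltW; near: j; exact: (near_infty_natSinv_lt (PosNum e0)).
Unshelve. all: by end_near. Qed.

End extraction.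

Lemma mesh_small (R : realType) (e : R) : 0 < e ->
  exists N : nat, forall n, (N <= n)%N -> mesh R n <= e.
Proof.
move=> e0; exists (Num.truncn e^-1) => n Nn; apply: le_trans (mesh_le R n) _.
rewrite -[e]invrK lef_pV2 ?posrE ?invr_gt0 //; apply/ltW.
by apply: lt_le_trans (truncnS_gt _) _; rewrite ler_nat ltnS.
Qed.

Section scheme_compactness.
Context (R : realType) (phi : R -> R).
Hypotheses (phi_cont : continuous phi) (phi_incr : {homo phi : x y / x < y}).

Lemma scheme_equicont lam D B L S a0 a s (T : R) (z : R * R) :
  scheme phi lam D B L S a0 a s -> 0 < z.2 < T ->
  asymp_equicont (fun n z => phi (grid_state lam a n z)) z.
Proof.
move=> sc /andP[z0 zT] e e0.
have s00 : 0 < z.2 / 2 by rewrite divr_gt0.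
have [C [C0 [n0 H]]] := scheme_modulus sc (`|z.1| + 1) T s00.
have C10 : 0 < 12 * (C + 1) by lra.
(* With distances and mesh below [eta ^+ 2], the squared space increment is at most [2 C eta] and
   the squared time increment at most [4 C eta]; doubling both for the square of the sum gives
   [12 C eta]. *)
pose eta := Num.min 1 (e ^+ 2 / (12 * (C + 1))).
have eta0 : 0 < eta by rewrite lt_min ltr01 divr_gt0 // exprn_gt0.
have eta1 : eta <= 1 by rewrite ge_min lexx.
have etae : 12 * C * eta <= e ^+ 2.
  have : eta <= e ^+ 2 / (12 * (C + 1)) by rewrite ge_min lexx orbT.
  rewrite ler_pdivlMr // => q; apply: le_trans q; nra.
pose d := Num.min (eta ^+ 2) (Num.min (z.2 / 2) (T - z.2)).
have e20 : 0 < eta ^+ 2 by rewrite exprn_gt0.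
have [N hN] := mesh_small e20.
exists d; first by rewrite !lt_min e20 s00 subr_gt0.
exists (maxn n0 N) => n [y t']; rewrite geq_max => /andP[n0n Nn] /=.
rewrite /d !le_min => /andP[d1 _] /and3P[d2 d3 d4].
have he := hN n Nn; have h0 := mesh_gt0 R n.
have [H1 H2] := H n n0n.
case: z z0 zT s00 H H1 H2 d d1 d2 d3 d4 => x t /= t0 tT s00 H H1 H2 d d1 d2 d3 d4.
have yJ : `|y| <= `|x| + 1.
  have := ler_normD (y - x) x; rewrite subrK => /le_trans; apply.
  have : eta ^+ 2 <= 1 by rewrite expr_le1 // ltW.
  by lra.
have t'T : t / 2 <= t' <= T by move: d3 d4; rewrite !ler_norml; move=> /andP[? ?] /andP[? ?]; lra.
have tT' : t / 2 <= t <= T by lra.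
have xJ : `|x| <= `|x| + 1 by lra.
have q1 := H1 y x t yJ xJ tT'.
have eta01 : 0 < eta <= 1 by rewrite eta0.
have q2 := H2 y t' t eta yJ t'T tT' eta01.
set p := phi _ - phi _ in q1; set q := phi _ - phi _ in q2.
have -> : phi (grid_state lam a n (y, t')) - phi (grid_state lam a n (x, t)) = p + q.
  by rewrite /p /q; ring.
rewrite -ler_sqr ?nnegrE ?(ltW e0) // real_normK ?num_real //.
apply: le_trans etae.
have q3 : p ^+ 2 <= C * (2 * eta ^+ 2).
  by apply: le_trans q1 _; rewrite ler_wpM2l //; lra.
have q4 : q ^+ 2 <= C * (2 * eta + eta + eta ^+ 2).
  apply: le_trans q2 _; rewrite ler_wpM2l // lerD // lerD2r ler_pdivrMr //.
  by lra.
have q5 : eta ^+ 2 <= eta by rewrite expr2 -[leRHS]mulr1 ler_pM2l.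
have q6 := ler_wpM2l C0 q5.
have := sqr_ge0 (p - q).
by lra.
Qed.

(** Strict monotonicity confines [f n] to [(l - e, l + e)] as soon as [phi (f n)] lies between the
    images of the end points; a vanishing derivative of [phi] does no harm. *)
Lemma incr_cvg (f : nat -> R) (l : R) :
  phi (f n) @[n --> \oo] --> phi l -> f n @[n --> \oo] --> l.
Proof.
move=> pl; apply/cvgrPdist_lt => e e0.
have le_e : l < l + e by lra.
have ge_e : l - e < l by lra.
have r1 := cvgr_lt _ pl _ (phi_incr le_e).
have r2 := cvgr_gt _ pl _ (phi_incr ge_e).
near=> n; rewrite distrC ltr_norml; apply/andP; split.
  rewrite ltNge; apply/negP => fn.
  have : phi (l - e) < phi (f n) by near: n; exact: r2.
  have : f n <= l - e by lra.
  by rewrite le_eqVlt => /orP[/eqP ->|/phi_incr]; lra.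
rewrite ltNge; apply/negP => fn.
have : phi (f n) < phi (l + e) by near: n; exact: r1.
have : l + e <= f n by lra.
by rewrite le_eqVlt => /orP[/eqP ->|/phi_incr]; lra.
Unshelve. all: by end_near. Qed.

(** The ultrafilter defines a limit at every point at once, and the limit of the fluxes inherits
    their asymptotic modulus. A sequence converging at rational points then converges at all points
    of the open strip. Continuity in [x] at each fixed time is recorded for the weak derivative on
    time slices. *)
Lemma scheme_extraction lam D1 D2 B L S a0 b0 a b s1 s2 (T : R) :
  scheme phi lam D1 B L S a0 a s1 -> scheme phi lam D2 B L S b0 b s2 ->
  exists (sigma : nat -> nat) (u v : R * R -> R), [/\ forall j, (j <= sigma j)%N,
    forall z, 0 < z.2 < T -> grid_state lam a (sigma j) z @[j --> \oo] --> u z,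
    forall z, 0 < z.2 < T -> grid_state lam b (sigma j) z @[j --> \oo] --> v z &
    forall x t, 0 < t < T -> {for x, continuous (fun x => phi (u (x, t)))} /\
      {for x, continuous (fun x => phi (v (x, t)))}].
Proof.
move=> sca scb.
have [F [UF ooF]] := ultraFilterLemma eventually_filter.
have PF : ProperFilter F by exact: ultra_proper.
have bnd D c0 c s : scheme phi lam D B L S c0 c s -> forall z n, `|grid_state lam c n z| <= B.
  by move=> sc z n; rewrite ger0_norm; have /andP[] := scheme_bnd sc n (slot (lam * mesh R n ^+ 2) z.2) (cell (mesh R n) z.1).
have /choice[u uF] : forall z, exists l : R, grid_state lam a ^~ z @ F --> l.
  by move=> z; exact: ultra_bounded_cvg UF (bnd _ _ _ _ sca z).
have /choice[v vF] : forall z, exists l : R, grid_state lam b ^~ z @ F --> l.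
  by move=> z; exact: ultra_bounded_cvg UF (bnd _ _ _ _ scb z).
(* The Boolean selects the species, so that a single [sigma] serves both. *)
have [sigma sj sg] : exists2 sigma : nat -> nat, (forall j, (j <= sigma j)%N) &
    forall i : bool * (rat * rat), (if i.1 then grid_state lam a (sigma j) else grid_state lam b (sigma j)) (ratr i.2.1, ratr i.2.2) @[j --> \oo] --> (if i.1 then u else v) (ratr i.2.1, ratr i.2.2).
  apply: (@ultra_subsequence _ F _ (fun n (i : bool * (rat * rat)) => (if i.1 then grid_state lam a n else grid_state lam b n) (ratr i.2.1, ratr i.2.2)) (fun i => (if i.1 then u else v) (ratr i.2.1, ratr i.2.2))) => //.
  by move=> [[] [p q]] /=; [exact: uF|exact: vF].
have phiF c w : (forall z, grid_state lam c ^~ z @ F --> w z) ->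
    forall z, phi (grid_state lam c n z) @[n --> F] --> phi (w z).
  by move=> H z; apply: continuous_cvg; [exact: phi_cont|exact: H].
have key D c0 c s w : scheme phi lam D B L S c0 c s ->
    (forall z, grid_state lam c ^~ z @ F --> w z) ->
    (forall p q : rat, grid_state lam c (sigma j) (ratr p, ratr q) @[j --> \oo] --> w (ratr p, ratr q)) ->
    (forall z, 0 < z.2 < T -> grid_state lam c (sigma j) z @[j --> \oo] --> w z) /\
    (forall x t, 0 < t < T -> {for x, continuous (fun x => phi (w (x, t)))}).
  move=> sc wF wq; have ml z zT := asymp_equicont_lim PF ooF (phiF c w wF) (scheme_equicont sc zT (T := T) (z := z)).
  split.
    move=> z zT; apply: incr_cvg.
    apply: (@asymp_equicont_cvg _ sigma (fun n z => phi (grid_state lam c n z)) (phi \o w)) => //.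
    - exact: scheme_equicont sc zT.
    - exact: ml z zT.
    - by move=> p q; apply: continuous_cvg; [exact: phi_cont|exact: wq].
  move=> x t tT; apply/cvgrPdist_le => e e0.
  have [d d0 dd] := ml (x, t) tT e e0.
  near=> y; rewrite distrC; apply: dd => /=; last by rewrite subrr normr0 ltW.
  rewrite distrC; near: y; exact: (@cvgr_dist_le _ _ _ _ (nbhs_filter x) id x cvg_id).
have [au ac] := key _ _ _ _ _ sca uF (fun p q => sg (true, (p, q))).
have [bv bc] := key _ _ _ _ _ scb vF (fun p q => sg (false, (p, q))).
by exists sigma, u, v; split=> // x t tT; split; [exact: ac|exact: bc].
Unshelve. all: by end_near. Qed.

End scheme_compactness.

(** * The competition system *)

(** The mean value theorem, with [phi'] largest at [B]. Keeping one factor [phi y - phi x] on each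
    side merges the Lipschitz bound with monotonicity, the combination that the energy estimates
    use. *)
Lemma diffusion_lip (R : realType) (phi : R -> R) (B : R) : 0 < B -> Cn 2 phi ->
  {homo phi : x y / x < y} ->
  {in `[0, +oo[ &, {homo derive1 phi : x y / x < y}} ->
  forall x y : R, 0 <= x <= B -> 0 <= y <= B ->
    (phi y - phi x) ^+ 2 <= derive1 phi B * ((y - x) * (phi y - phi x)).
Proof.
move=> B0 [dphi _] incr dincr x y; wlog xy : x y / x <= y.
  move=> H xB yB; have [xy|/ltW yx] := leP x y; first exact: H.
  by have := H y x yx yB xB; rewrite -sqrrN opprB -[(x - y) * _]mulrNN !opprB.
move=> /andP[x0 xB] /andP[y0 yB].
have dx (z : R) : is_derive z 1 phi (derive1 phi z).
  by rewrite derive1E; apply: derivableP; exact: (dphi 0%N z).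
have cont : {within `[x, y], continuous phi}.
  apply: continuous_subspaceT => z; apply: differentiable_continuous.
  by apply/derivable1_diffP; exact: (dphi 0%N z).
have [c] := MVT_segment xy (fun z _ => dx z) cont.
rewrite in_itv /= => /andP[xc cy] E.
have L : derive1 phi c <= derive1 phi B.
  have := le_trans cy yB; rewrite le_eqVlt => /orP[/eqP->//|cB].
  by apply/ltW/dincr => //; rewrite in_itv /= andbT; [exact: le_trans x0 xc|exact: ltW].
have P : 0 <= phi y - phi x.
  by rewrite subr_ge0; move: xy; rewrite le_eqVlt => /orP[/eqP->//|/incr/ltW].
by rewrite expr2 mulrA ler_wpM2r // E ler_wpM2r // subr_ge0.
Qed.

Section system.
Context (R : realType) (phi : R -> R) (lam eps k U0 V0 : R) (u0 v0 : R -> R).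

Definition system_step n (D : R) (f g : int -> R) (i : int) : R :=
  if (absz i < n * 2 ^ n)%N then
    f i + (D * (phi (f (i + 1)) - 2 * phi (f i) + phi (f (i - 1)))
      - lam * mesh R n ^+ 2 * (k * (f i * g i)))
  else 0.

Definition system_init n (f : R -> R) (i : int) : R :=
  if (absz i < n * 2 ^ n)%N then f (i%:~R * mesh R n) else 0.

Fixpoint system n m : (int -> R) * (int -> R) :=
  if m is m'.+1 then
    (system_step n lam (system n m').1 (system n m').2,
     system_step n (lam * eps) (system n m').2 (system n m').1)
  else (system_init n u0, system_init n v0).

Let B := Num.max U0 V0.
Let L := derive1 phi B.
Hypotheses (lam0 : 0 < lam) (eps0 : 0 < eps) (k0 : 0 < k) (U00 : 0 < U0) (V00 : 0 < V0).
Hypothesis L0 : 0 < L.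
Hypothesis cfl : lam * (1 + 24 * (1 + eps) * L + k * B) = 1.
Hypotheses (u0B : forall x, 0 <= u0 x <= U0) (v0B : forall x, 0 <= v0 x <= V0).
Hypotheses (phi0 : phi 0 = 0) (phi_incr : {homo phi : x y / x < y}).
Hypothesis phi_lip : forall x y : R, 0 <= x <= B -> 0 <= y <= B ->
    (phi y - phi x) ^+ 2 <= L * ((y - x) * (phi y - phi x)).

Let B0 : 0 < B. Proof. by rewrite lt_max U00. Qed.

Let phi_mono (x y : R) : x <= y -> phi x <= phi y.
Proof. by rewrite le_eqVlt => /orP[/eqP->//|/phi_incr/ltW]. Qed.

Let phi_diff (x y : R) : 0 <= x -> x <= y -> y <= B -> phi y - phi x <= L * (y - x).
Proof.
move=> x0 xy yB; have xB := le_trans xy yB; have y0 := le_trans x0 xy.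
have := phi_lip (x := x) (y := y); rewrite x0 xB y0 yB => /(_ isT isT).
have : phi x <= phi y by exact: phi_mono.
rewrite -subr_ge0 le_eqVlt => /orP[/eqP<- _|p].
  by rewrite mulr_ge0 ?subr_ge0 // ltW.
by rewrite expr2 mulrA ler_pM2r.
Qed.

(** Discrete maximum principle. From below, diffusion and reaction remove at most
    [(2 D L + lam k B) f i], which is at most [f i]. From above, the reaction has the right sign and
    diffusion closes at most the fraction [2 D L] of the gap [W - f i]. [W] is separate from [B], as
    each species keeps its own bound. *)
Let step_bnd n D W f g i : 0 < D -> D <= lam * (1 + eps) -> W <= B ->
  (forall i, 0 <= f i <= W) -> (forall i, 0 <= g i <= B) ->
  0 <= system_step n D f g i <= W.
Proof.
move=> D0 De WB fW gB; rewrite /system_step; case: ifP => _; last first.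
  by have /andP[a b] := fW 0; rewrite lexx (le_trans a b).
have /andP[f0 f1] := fW i; have /andP[g0 g1] := gB i.
have /andP[fp0 fp1] := fW (i + 1); have /andP[fm0 fm1] := fW (i - 1).
have h0 := mesh_gt0 R n; have h1 := mesh_le1 R n.
have h2 : mesh R n ^+ 2 <= 1 by rewrite expr_le1 // ltW.
have pp : 0 <= phi (f (i + 1)) by rewrite -phi0 phi_mono.
have pm : 0 <= phi (f (i - 1)) by rewrite -phi0 phi_mono.
have r0 : 0 <= lam * mesh R n ^+ 2 * (k * (f i * g i)).
  by rewrite !mulr_ge0 ?sqr_ge0 // ltW.
have DL : 2 * D * L + lam * k * B <= 1.
  have := ler_wpM2r (ltW L0) De; have := cfl.
  have : 0 <= lam * (1 + eps) * L by rewrite !mulr_ge0 // ltW // addr_gt0.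
  have := ltW lam0.
  by lra.
apply/andP; split.
- have : phi (f i) <= L * f i.
    by have := phi_diff (lexx 0) f0 (le_trans f1 WB); rewrite phi0 !subr0.
  move/(ler_wpM2l (ltW D0)) => q1.
  have q2 : lam * mesh R n ^+ 2 * (k * (f i * g i)) <= lam * k * B * f i.
    have -> : lam * mesh R n ^+ 2 * (k * (f i * g i)) = (mesh R n ^+ 2 * g i) * (lam * k * f i) by ring.
    have -> : lam * k * B * f i = B * (lam * k * f i) by ring.
    rewrite ler_wpM2r //; first by rewrite !mulr_ge0 // ltW.
    by rewrite -[leRHS]mul1r ler_pM // sqr_ge0.
  have q3 := ler_wpM2r f0 DL.
  have := mulr_ge0 (ltW D0) pp; have := mulr_ge0 (ltW D0) pm.
  by lra.
- have q1 := phi_diff f0 f1 WB.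
  have q2 : phi (f (i + 1)) <= phi W by exact: phi_mono.
  have q3 : phi (f (i - 1)) <= phi W by exact: phi_mono.
  have q4 : D * (phi (f (i + 1)) - 2 * phi (f i) + phi (f (i - 1))) <= D * (2 * (L * (W - f i))).
    by rewrite ler_pM2l //; lra.
  have W0 : 0 <= W - f i by rewrite subr_ge0.
  have lkB : 0 <= lam * k * B by rewrite !mulr_ge0 // ltW.
  have := ler_wpM2r W0 (_ : 2 * D * L <= 1); rewrite mul1r => /(_ _) q5.
  have : 2 * D * L * (W - f i) <= W - f i by apply: q5; lra.
  by lra.
Qed.

Let init_bnd n f W i : (forall x, 0 <= f x <= W) -> 0 <= system_init n f i <= W.
Proof.
move=> fW; rewrite /system_init; case: ifP => // _.
by have /andP[a b] := fW 0; rewrite lexx (le_trans a b).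
Qed.

Lemma system_bnd n m : (forall i, 0 <= (system n m).1 i <= U0) /\
  (forall i, 0 <= (system n m).2 i <= V0).
Proof.
have UB : U0 <= B by rewrite le_max lexx.
have VB : V0 <= B by rewrite le_max lexx orbT.
elim: m => [|m [IH1 IH2]]; first by split=> i; exact: init_bnd.
split=> i; apply: step_bnd => //; rewrite ?mulr_gt0 ?ler_pM2l //.
- by rewrite -[leLHS]mulr1 ler_pM2l // lerDl ltW.
- by move=> j; have /andP[-> /le_trans ->] := IH2 j.
- by rewrite lerDr.
- by move=> j; have /andP[-> /le_trans ->] := IH1 j.
Qed.

Let uB n m i : 0 <= (system n m).1 i <= B.
Proof.
by have [/(_ i)/andP[-> /le_trans ->]] := system_bnd n m; rewrite ?le_max ?lexx.
Qed.

Let vB n m i : 0 <= (system n m).2 i <= B.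
Proof.
by have [_ /(_ i)/andP[-> /le_trans ->]] := system_bnd n m; rewrite ?le_max ?lexx ?orbT.
Qed.

Let reaction_bnd (f g : R) : 0 <= f <= B -> 0 <= g <= B -> 0 <= k * (f * g) <= k * B ^+ 2.
Proof.
move=> /andP[f0 f1] /andP[g0 g1]; rewrite !mulr_ge0 ?(ltW k0) //= ler_pM2l //.
by rewrite expr2 ler_pM.
Qed.

Let lam1 : 0 < lam <= 1.
Proof.
rewrite lam0 /=; have := cfl.
have : 0 <= lam * (1 + eps) * L by rewrite !mulr_ge0 // ltW // addr_gt0.
by have : 0 <= lam * k * B; [rewrite !mulr_ge0 // ltW|lra].
Qed.

Lemma system_scheme_u : scheme phi lam lam B L (k * B ^+ 2) u0
  (fun n m => (system n m).1) (fun n m i => k * ((system n m).1 i * (system n m).2 i)).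
Proof.
split=> //.
- by rewrite mulr_ge0 ?sqr_ge0 // ltW.
- have := cfl; have : 0 <= lam * eps * L by rewrite !mulr_ge0 // ltW.
  have : 0 <= lam * k * B by rewrite !mulr_ge0 // ltW.
  by have := ltW lam0; lra.
- by move=> n m i; exact: reaction_bnd.
- by move=> n [|m] i Pi /=; rewrite /system_init /system_step ltnNge Pi.
- by move=> n i Pi /=; rewrite /system_init Pi.
- by move=> n m i Pi /=; rewrite /system_step Pi.
Qed.

Lemma system_scheme_v : scheme phi lam (lam * eps) B L (k * B ^+ 2) v0
  (fun n m => (system n m).2) (fun n m i => k * ((system n m).1 i * (system n m).2 i)).
Proof.
split=> //.
- by rewrite mulr_gt0.
- by rewrite mulr_ge0 ?sqr_ge0 // ltW.
- have := cfl; have : 0 <= lam * L by rewrite !mulr_ge0 // ltW.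
  have : 0 <= lam * k * B by rewrite !mulr_ge0 // ltW.
  by have := ltW lam0; lra.
- by move=> n m i; exact: reaction_bnd.
- by move=> n [|m] i Pi /=; rewrite /system_init /system_step ltnNge Pi.
- by move=> n i Pi /=; rewrite /system_init Pi.
- by move=> n m i Pi /=; rewrite /system_step Pi [(system n m).2 i * _]mulrC.
Qed.

End system.

(** * Bounded functions with support of finite measure *)

Section bounded_finite_support.
Context d (T : measurableType d) (R : realType) (mu : {measure set T -> \bar R}).
Implicit Types (f g : T -> R) (s : T -> T).

Definition bounded_measurable f :=
  measurable_fun setT f /\ exists K, forall z, `|f z| <= K.

(** The integrands of the discrete identities live in this class. It is stable under bounded factors
    and translations and consists of integrable functions, so that linearity and shifts of integrals
    need no further estimate. *)
Definition bfs f := bounded_measurable f /\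
  exists D, [/\ measurable D, (mu D < +oo)%E & forall z, ~ D z -> f z = 0].

Lemma bmM f g : bounded_measurable f -> bounded_measurable g ->
  bounded_measurable (fun z => f z * g z).
Proof.
move=> [mf [K fK]] [mg [L gL]]; split; first exact: measurable_funM.
by exists (K * L) => z; rewrite normrM ler_pM.
Qed.

Lemma bmD f g : bounded_measurable f -> bounded_measurable g ->
  bounded_measurable (fun z => f z + g z).
Proof.
move=> [mf [K fK]] [mg [L gL]]; split; first exact: measurable_funD.
by exists (K + L) => z; rewrite (le_trans (ler_normD _ _)) // lerD.
Qed.

Lemma bm_cst (c : R) : bounded_measurable (fun _ => c).
Proof. by split; [exact: measurable_cst|exists `|c|]. Qed.

Lemma bmZ f c : bounded_measurable f -> bounded_measurable (fun z => c * f z).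
Proof. by apply: bmM; exact: bm_cst. Qed.

Lemma bmB f g : bounded_measurable f -> bounded_measurable g ->
  bounded_measurable (fun z => f z - g z).
Proof.
move=> bf bg; have := bmD bf (bmZ (-1) bg).
by under eq_fun do rewrite mulN1r.
Qed.

Lemma bm_indic (A : set T) : measurable A -> bounded_measurable (\1_A : T -> R).
Proof.
move=> mA; split; first exact: measurable_indic.
by exists 1 => z; rewrite indicE ger0_norm // lern1 leq_b1.
Qed.

Lemma bm_comp (U : T -> T) f : measurable_fun setT U -> bounded_measurable f ->
  bounded_measurable (fun z => f (U z)).
Proof.
by move=> mU [mf [K fK]]; split; [exact: measurableT_comp|exists K => z; exact: fK].
Qed.

Lemma bfs_bm f : bfs f -> bounded_measurable f. Proof. by case. Qed.

Lemma bfsMl f g : bounded_measurable f -> bfs g -> bfs (fun z => f z * g z).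
Proof.
move=> bf [bg [D [mD fD gD]]]; split; first exact: bmM.
by exists D; split=> // z Dz; rewrite gD // mulr0.
Qed.

Lemma bfsMr f g : bfs f -> bounded_measurable g -> bfs (fun z => f z * g z).
Proof. by move=> bf bg; under eq_fun do rewrite mulrC; exact: bfsMl. Qed.

Lemma bfsZ f c : bfs f -> bfs (fun z => c * f z).
Proof. by apply: bfsMl; exact: bm_cst. Qed.

Lemma bfsD f g : bfs f -> bfs g -> bfs (fun z => f z + g z).
Proof.
move=> [bf [D [mD fD f0]]] [bg [E [mE fE g0]]]; split; first exact: bmD.
exists (D `|` E); split; first exact: measurableU.
  by apply: le_lt_trans (measureU2 _ _ _) _ => //; exact: lte_add_pinfty.
by move=> z /not_orP[Dz Ez]; rewrite f0 // g0 // addr0.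
Qed.

Lemma bfsB f g : bfs f -> bfs g -> bfs (fun z => f z - g z).
Proof.
move=> bf bg; have := bfsD bf (bfsZ (-1) bg).
by under eq_fun do rewrite mulN1r.
Qed.

Lemma bfs_indic (A : set T) : measurable A -> (mu A < +oo)%E -> bfs (\1_A : T -> R).
Proof.
move=> mA fA; split; first exact: bm_indic.
by exists A; split => // z Az; rewrite indicE memNset.
Qed.

Lemma bfs_integrable f : bfs f -> mu.-integrable setT (EFin \o f).
Proof.
move=> [[mf [K fK]] [D [mD fD f0]]].
have -> : EFin \o f = (EFin \o f) \_ D.
  apply/funext => z; rewrite patchE; case: ifPn => //.
  by rewrite notin_setE => /f0 /= ->.
apply/(integrable_mkcond _ mD); apply: measurable_bounded_integrable => //.
  exact: measurable_funTS.
by exists K; split; [exact: num_real|move=> M KM z _; exact: le_trans (fK z) (ltW KM)].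
Qed.

Lemma bfs_dct (f_ : nat -> T -> R) f K (D : set T) :
  measurable D -> (mu D < +oo)%E -> (forall n, measurable_fun setT (f_ n)) ->
  (forall n z, `|f_ n z| <= K) -> (forall n z, ~ D z -> f_ n z = 0) ->
  measurable_fun setT f -> {ae mu, forall z, f_ n z @[n --> \oo] --> f z} ->
  \int[mu]_z f_ n z @[n --> \oo] --> \int[mu]_z f z.
Proof.
move=> mD fD mf_ fK f0 mf ff.
have intK : mu.-integrable setT (EFin \o (fun z => K * \1_D z)).
  by apply: bfs_integrable; apply: bfsZ; exact: bfs_indic.
have [||||i _ c] := @dominated_convergence _ _ _ mu setT measurableT
  (fun n => EFin \o f_ n) (EFin \o f) (EFin \o (fun z => K * \1_D z)) _ _ _ intK.
- by move=> n; exact/measurable_EFinP.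
- exact/measurable_EFinP.
- by apply: filterS ff => z H _; apply: cvg_EFin; [exact: nearW|exact: H].
- apply: aeW => z n _; rewrite /= lee_fin indicE.
  have [Dz|Dz] := pselect (D z); first by rewrite mem_set // mulr1.
  by rewrite f0 // normr0 memNset // mulr0.
rewrite /Rintegral; apply: fine_cvg; rewrite fineK; first exact: c.
exact: integrable_fin_num.
Qed.

Section preserving.
Variable s : T -> T.
Hypotheses (ms : measurable_fun setT s)
  (mus : forall A, measurable A -> mu (s @^-1` A) = mu A).

Lemma bfs_comp f : bfs f -> bfs (fun z => f (s z)).
Proof.
move=> [bf [D [mD fD f0]]]; split; first exact: bm_comp.
exists (s @^-1` D); split=> [||z /f0//]; last by rewrite mus.
by rewrite -[X in measurable X]setTI; exact: ms.
Qed.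

Lemma bfs_integral_comp f : bfs f -> \int[mu]_z f (s z) = \int[mu]_z f z.
Proof.
move=> bf; rewrite /Rintegral; congr fine.
have [[mf _] _] := bf.
have mE : measurable_fun setT (EFin \o f) by exact/measurable_EFinP.
have := @integral_pushforward _ _ T T R s ms mu setT (EFin \o f) mE.
rewrite preimage_setT => /(_ (bfs_integrable (bfs_comp bf)) measurableT) <-.
by apply: eq_measure_integral => A mA _; rewrite /= /pushforward mus.
Qed.

End preserving.

End bounded_finite_support.

(** * Translation invariance of Lebesgue measure *)

Section translation.
Context (R : realType).

Lemma measurable_translation (a : R) : measurable_fun [set: R] (fun x => x + a).
Proof. by apply: measurable_funD. Qed.

Lemma lebesgue_translation (a : R) (A : set R) : measurable A ->
  leb R ((fun x => x + a) @^-1` A) = leb R A.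
Proof.
move=> mA; apply/esym.
have m : @measurable_fun _ _ (measurableTypeR R) (measurableTypeR R) [set: R] (fun x : R => x + a).
  exact: measurable_translation.
apply: (@lebesgue_measure_unique R
  (measure_function_pushforward__canonical__measure_function_Measure (leb R) m)) => //.
move=> _ [[x y] _ <-] /=; rewrite /pushforward.
have -> : (fun z : R => z + a) @^-1` `]x, y] = `]x - a, y - a]%classic.
  by apply/seteqP; split=> z /=; rewrite !in_itv /=; lra.
rewrite !lebesgue_measure_itv /= !lte_fin ltrD2r; case: ifP => // _.
by rewrite -!EFinB; congr EFin; ring.
Qed.

Lemma lebesgue2_translation (a b : R) (A : set (R * R)) : measurable A ->
  leb2 R ((fun z => (z.1 + a, z.2 + b)) @^-1` A) = leb2 R A.
Proof.
move=> mA; apply/esym.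
have m : @measurable_fun _ _ (measurableTypeR R * measurableTypeR R)%type
    (measurableTypeR R * measurableTypeR R)%type setT (fun z : R * R => (z.1 + a, z.2 + b)).
  apply: measurable_fun_pair.
    by apply: measurable_funD => //; exact: measurable_fst.
  by apply: measurable_funD => //; exact: measurable_snd.
have := @product_measure_unique _ _ _ _ R (leb R) (leb R)
  (measure_function_pushforward__canonical__measure_function_Measure (leb2 R) m) _ _ mA.
apply; move=> B C mB mC; rewrite /= /pushforward.
have -> : (fun z : R * R => (z.1 + a, z.2 + b)) @^-1` (B `*` C) =
  ((fun x => x + a) @^-1` B) `*` ((fun x => x + b) @^-1` C) by [].
have pre (c : R) (D : set R) : measurable D -> measurable ((fun x => x + c) @^-1` D).
  move=> mD; rewrite -[X in measurable X]setTI.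
  exact: measurable_translation.
rewrite product_measure1E; [|exact: pre|exact: pre].
by congr (_ * _)%E; exact: lebesgue_translation.
Qed.

End translation.

(** * Dyadic difference quotients *)

Lemma measurable_countable_factor d (T : measurableType d) (R : realType) (I : countType)
    (c : T -> I) (F : I -> R) : (forall i, measurable (c @^-1` [set i])) ->
  measurable_fun setT (fun z => F (c z)).
Proof.
move=> mc _ Y mY; rewrite setTI.
have -> : (fun z => F (c z)) @^-1` Y =
    \bigcup_(n in [set: nat]) (if unpickle n is Some i then
      (if `[< Y (F i) >] then c @^-1` [set i] else set0) else set0).
  apply/seteqP; split=> z /=.
    by move=> Yz; exists (pickle (c z)) => //; rewrite pickleK; case: asboolP.
  by case=> n _; case: unpickle => // i; case: asboolP => // Yi /= ->.
apply: bigcup_measurable => n _; case: unpickle => [i|]; last exact: measurable0.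
by case: ifP => _; [exact: mc|exact: measurable0].
Qed.

Section cells.
Context (R : realType).
Implicit Types (h x : R).

Lemma cell_eq h x i : 0 < h -> i%:~R * h <= x < (i%:~R + 1) * h -> cell h x = i.
Proof.
move=> h0 /andP[x1 x2]; apply/eqP; rewrite /cell floor_eq.
by rewrite ler_pdivlMr // x1 ltr_pdivrMr // intrD.
Qed.

Lemma cellD h x : 0 < h -> cell h (x + h) = cell h x + 1.
Proof.
move=> h0; apply: cell_eq => //; have /andP[x1 x2] := cell_itv x h0.
by rewrite intrD !mulrDl mul1r lerD2r x1 /=; move: x2; rewrite mulrDl mul1r; lra.
Qed.

Lemma cell_preimage h i : 0 < h ->
  cell h @^-1` [set i] = `[i%:~R * h, (i%:~R + 1) * h[%classic.
Proof.
move=> h0; apply/seteqP; split=> x /=; rewrite in_itv /=; last exact: cell_eq.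
by move=> <-; exact: cell_itv.
Qed.

Lemma slot_preimage tau m : 0 < tau -> measurable (slot tau @^-1` [set m] : set R).
Proof.
move=> tau0; have [->|m0] := eqVneq m 0%N.
  have -> : slot tau @^-1` [set 0%N] = `]-oo, tau[%classic.
    apply/seteqP; split=> t /=; rewrite in_itv /=.
      move=> st; have := truncnS_gt (t / tau); rewrite -/(slot tau t) st.
      by rewrite ltr_pdivrMr // mul1r.
    move=> tt; apply/eqP; rewrite -leqn0 /slot truncn_le_nat.
    by rewrite ltr_pdivrMr // mul1r.
  exact: measurable_itv.
have -> : slot tau @^-1` [set m] = `[m%:R * tau, m.+1%:R * tau[%classic.
  apply/seteqP; split=> t /=; rewrite in_itv /=.
    move=> tm; rewrite -tm in m0 *; have t0 : 0 <= t.
      rewrite leNgt; apply/negP => t0; move: m0; rewrite /slot truncn_floor.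
      by rewrite ler_pdivlMr // mul0r leNgt t0.
    by have := slot_itv tau0 t0; rewrite -[(slot tau t).+1]addn1 natrD.
  move=> tm; apply: truncn_def.
  by rewrite ler_pdivlMr // ltr_pdivrMr.
exact: measurable_itv.
Qed.

Lemma measurable_cell_fun h (F : int -> R) : 0 < h -> measurable_fun setT (fun x => F (cell h x)).
Proof.
move=> h0; apply: measurable_countable_factor => i.
by rewrite cell_preimage //; exact: measurable_itv.
Qed.

Lemma measurable_interp h tau (f : nat -> int -> R) : 0 < h -> 0 < tau ->
  measurable_fun setT (interp h tau f).
Proof.
move=> h0 tau0.
apply: (measurable_countable_factor (c := fun z : R * R => (slot tau z.2, cell h z.1))
  (fun i => f i.1 i.2)) => -[m i].
have -> : (fun z : R * R => (slot tau z.2, cell h z.1)) @^-1` [set (m, i)] =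
    (cell h @^-1` [set i]) `*` (slot tau @^-1` [set m]).
  by apply/seteqP; split=> z /= [-> ->].
apply: measurableX; last exact: slot_preimage.
by rewrite cell_preimage //; exact: measurable_itv.
Qed.

End cells.

(* The Lebesgue measure of the library lives on [measurableTypeR R], an alias of
   [R] with a different display. *)
Notation bm1 R := (@bounded_measurable _ (measurableTypeR R) R).
Notation bm2 R := (@bounded_measurable _ (measurableTypeR R * measurableTypeR R)%type R).
Notation mfun2 f := (@measurable_fun _ _ (measurableTypeR _ * measurableTypeR _)%type _ setT f).

Section martingale.
Context (R : realType).
Implicit Types (m n : nat) (x t : R) (z : R * R) (w c : R * R -> R).
Notation mesh := (mesh R).

Definition snap m x : R := (cell (mesh m) x)%:~R * mesh m.

(* As [m] grows, [dyad m w] is a martingale for the dyadic partitions of the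
   [x]-axis: see [dyad_orthogonal_le]. *)
Definition dyad m w z : R :=
  (w (snap m z.1 + mesh m, z.2) - w (snap m z.1, z.2)) / mesh m.

Definition cellwise m c := forall z, c (snap m z.1, z.2) = c z.

Lemma meshS m : mesh m = mesh m.+1 + mesh m.+1.
Proof.
by rewrite -[mesh m]/(2^-1 ^+ m) -[mesh m.+1]/(2^-1 ^+ m.+1) exprS; field.
Qed.

Lemma snap_itv m x : snap m x <= x < snap m x + mesh m.
Proof. by have := cell_itv x (mesh_gt0 R m); rewrite mulrDl mul1r. Qed.

Lemma snap_snap m x : snap m (snap m x) = snap m x.
Proof.
rewrite /snap; congr (_%:~R * _); apply: cell_eq; first exact: mesh_gt0.
by rewrite lexx /= mulrDl mul1r ltrDl mesh_gt0.
Qed.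

Lemma measurable_snap m : measurable_fun setT (snap m).
Proof. exact: (measurable_cell_fun (fun i => i%:~R * mesh m) (mesh_gt0 R m)). Qed.

Lemma snapS m x : snap m.+1 x = snap m x \/ snap m.+1 x = snap m x + mesh m.+1.
Proof.
have h0 := mesh_gt0 R m.+1; have hS := meshS m.
have /andP[x1 x2] := snap_itv m x; have /andP[y1 y2] := snap_itv m.+1 x.
have E : snap m x = (2 * cell (mesh m) x)%:~R * mesh m.+1.
  by rewrite /snap intrM hS; ring.
have : cell (mesh m.+1) x = 2 * cell (mesh m) x \/ cell (mesh m.+1) x = 2 * cell (mesh m) x + 1.
  have L : (2 * cell (mesh m) x)%:~R < (cell (mesh m.+1) x + 1)%:~R :> R.
    by rewrite -(ltr_pM2r h0) -E intrD mulrDl mul1r -/(snap m.+1 x); lra.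
  have U : (cell (mesh m.+1) x)%:~R < (2 * cell (mesh m) x + 2)%:~R :> R.
    by rewrite -(ltr_pM2r h0) -/(snap m.+1 x) intrD mulrDl -E; lra.
  move: L U; rewrite !ltr_int; move: (cell _ _) (cell _ _) => p q; clear; lia.
case=> H; [left|right]; rewrite E /snap H //.
by rewrite intrD mulrDl mul1r.
Qed.

Lemma cellwise_snap m z : snap m (snap m.+1 z.1) = snap m z.1.
Proof.
rewrite /snap; congr (_%:~R * _); apply: cell_eq; first exact: mesh_gt0.
rewrite mulrDl mul1r -/(snap m z.1) -/(snap m.+1 z.1).
have h0 := mesh_gt0 R m.+1; have hS := meshS m.
by case: (snapS m z.1) => ->; apply/andP; split; lra.
Qed.

Lemma cellwiseS m c : cellwise m c -> cellwise m.+1 c.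
Proof. by move=> cm z; rewrite -[RHS]cm -[LHS]cm /= cellwise_snap. Qed.

Lemma measurable_pair_map (f : R -> R) : measurable_fun setT f ->
  measurable_fun setT (fun z : R * R => (f z.1, z.2)).
Proof.
move=> mf; apply: measurable_fun_pair; last exact: measurable_snd.
by apply: measurableT_comp => //; exact: measurable_fst.
Qed.

Lemma bm_dyad m w : bm2 R w -> bm2 R (dyad m w).
Proof.
move=> bw; rewrite /dyad.
have B : bm2 R (fun z : R * R => w (snap m z.1 + mesh m, z.2) - w (snap m z.1, z.2)).
  apply: bmB.
    apply: (bm_comp (U := fun z : R * R => (snap m z.1 + mesh m, z.2))) bw.
    apply: (measurable_pair_map (f := fun x => snap m x + mesh m)).
    by apply: measurable_funD => //; exact: measurable_snap.
  apply: (bm_comp (U := fun z : R * R => (snap m z.1, z.2))) bw.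
  by apply: measurable_pair_map; exact: measurable_snap.
exact: (bmM B (bm_cst _ (mesh m)^-1)).
Qed.

Lemma measurable_shift2 (a b : R) :
  @measurable_fun _ _ (measurableTypeR R * measurableTypeR R)%type
    (measurableTypeR R * measurableTypeR R)%type setT (fun z : R * R => (z.1 + a, z.2 + b)).
Proof.
by apply: measurable_fun_pair; apply: measurable_funD; rewrite ?measurable_fst ?measurable_snd.
Qed.

Lemma bfs2_shift a b f : bfs (leb2 R) f -> bfs (leb2 R) (fun z => f (z.1 + a, z.2 + b)).
Proof. exact: (@bfs_comp _ _ R (leb2 R) _ (measurable_shift2 a b) (@lebesgue2_translation R a b)). Qed.

Lemma integral2_shift a b f : bfs (leb2 R) f ->
  \int[leb2 R]_z f (z.1 + a, z.2 + b) = \int[leb2 R]_z f z.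
Proof.
exact: (@bfs_integral_comp _ _ R (leb2 R) _ (measurable_shift2 a b) (@lebesgue2_translation R a b)).
Qed.

(* Splitting an [m]-cell into halves, [c (dyad m.+1 w - dyad m w)] takes opposite
   values on them; its integral thus cancels by translation. *)
Lemma dyad_orthogonal m w c : bm2 R w -> bfs (leb2 R) c -> cellwise m c ->
  \int[leb2 R]_z (c z * dyad m.+1 w z) = \int[leb2 R]_z (c z * dyad m w z).
Proof.
move=> bw bc cm; have h0 := mesh_gt0 R m.+1; have hS := meshS m.
pose F z := c z * (dyad m.+1 w z - dyad m w z).
pose left : set (R * R) := [set z | snap m.+1 z.1 = snap m z.1].
have mleft : measurable left.
  have -> : left = (fun z : R * R => snap m.+1 z.1 - snap m z.1) @^-1` [set 0].
    by apply/seteqP; split=> z /=; [move=> ->; rewrite subrr|move/eqP; rewrite subr_eq0 => /eqP].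
  rewrite -[X in measurable X]setTI.
  have : measurable_fun setT (fun z : R * R => snap m.+1 z.1 - snap m z.1).
    by apply: measurable_funB; apply: (measurableT_comp (measurable_snap _)); exact: measurable_fst.
  by apply => //; exact: measurable_set1.
have bF : bfs (leb2 R) F.
  by apply: bfsMr => //; apply: bmB; exact: bm_dyad.
pose Fl z := F z * \1_left z.
have bFl : bfs (leb2 R) Fl by apply: bfsMr => //; exact: bm_indic.
have FE z : F z = Fl z - Fl (z.1 - mesh m.+1, z.2 + 0).
  rewrite addr0 /Fl !indicE; case: z => x t /=.
  have /andP[x1 x2] := snap_itv m x; have /andP[y1 y2] := snap_itv m.+1 x.
  have Sx : snap m.+1 (x - mesh m.+1) = snap m.+1 x - mesh m.+1.
    by rewrite /snap -{2}[x](subrK (mesh m.+1)) cellD // intrD mulrDl mul1r addrK.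
  case: (snapS m x) => H.
    (* From a left half, the translate by [- mesh m.+1] lands in the right half of the preceding
       cell, where [Fl] vanishes; from a right half it lands in the left half of the same cell. *)
    rewrite [(x, t) \in left]mem_set // mulr1.
    rewrite memNset ?mulr0 ?subr0 // /left /= Sx H => E.
    have : snap m (x - mesh m.+1) = snap m x - mesh m.
      have -> : snap m x - mesh m = (cell (mesh m) x - 1)%:~R * mesh m.
        by rewrite /snap intrB mulrBl mul1r.
      rewrite /snap; congr (_%:~R * _); apply: cell_eq; first exact: mesh_gt0.
      rewrite intrB subrK mulrBl mul1r -/(snap m x).
      by rewrite H in y1 y2; apply/andP; split; lra.
    by rewrite -E hS; lra.
  have K : snap m (x - mesh m.+1) = snap m x.
    rewrite /snap; congr (_%:~R * _); apply: cell_eq; first exact: mesh_gt0.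
    by rewrite mulrDl mul1r -/(snap m x); apply/andP; split; lra.
  rewrite [(x, t) \in left]memNset; last by rewrite /left /= H; lra.
  rewrite mem_set; last by rewrite /left /= Sx H K; ring.
  rewrite mulr0 mulr1 sub0r /F /dyad /= Sx K H -[c (x, t)]cm -[c (x - _, t)]cm /= K.
  set p := snap m x; have -> : p + mesh m.+1 - mesh m.+1 = p by ring.
  have -> : p + mesh m.+1 + mesh m.+1 = p + mesh m by rewrite -addrA -hS.
  have -> : (mesh m)^-1 = (mesh m.+1)^-1 / 2 by rewrite hS -mulr2n -(mulr_natl (mesh m.+1) 2) invfM mulrC.
  by field; exact: lt0r_neq0.
have : \int[leb2 R]_z F z = 0.
  under eq_Rintegral do rewrite FE.
  rewrite RintegralB //; [|exact: bfs_integrable|exact/bfs_integrable/bfs2_shift].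
  by rewrite (integral2_shift (- mesh m.+1) 0 bFl) subrr.
rewrite /F; under eq_Rintegral do rewrite mulrBr.
rewrite RintegralB //; first by move/eqP; rewrite subr_eq0 => /eqP.
  by apply: bfs_integrable; apply: bfsMr => //; exact: bm_dyad.
by apply: bfs_integrable; apply: bfsMr => //; exact: bm_dyad.
Qed.

Lemma dyad_orthogonal_le m n w c : (m <= n)%N ->
  bm2 R w -> bfs (leb2 R) c -> cellwise m c ->
  \int[leb2 R]_z (c z * dyad n w z) = \int[leb2 R]_z (c z * dyad m w z).
Proof.
move=> mn bw bc; elim: n mn => [|n IH]; first by rewrite leqn0 => /eqP->.
rewrite leq_eqVlt => /orP[/eqP->//|]; rewrite ltnS => mn cm.
rewrite dyad_orthogonal //; first exact: IH.
elim: n mn {IH} => [|n IH]; first by rewrite leqn0 => /eqP<-.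
by rewrite leq_eqVlt => /orP[/eqP<-//|]; rewrite ltnS => /IH/cellwiseS.
Qed.

Lemma cellwise_dyad m w : cellwise m (dyad m w).
Proof. by move=> z; rewrite /dyad /= snap_snap. Qed.

End martingale.

Section integral_sum.
Context d (T : measurableType d) (R : realType) (mu : {measure set T -> \bar R}).

Lemma bfs0 : bfs mu (fun _ => 0).
Proof.
split; first exact: bm_cst.
by exists set0; split=> //; rewrite measure0.
Qed.

Lemma bfs_sum n (f : nat -> T -> R) : (forall i, bfs mu (f i)) ->
  bfs mu (fun z => \sum_(i < n) f i z).
Proof.
move=> bf; elim: n => [|n IH].
  by under eq_fun do rewrite big_ord0; exact: bfs0.
by under eq_fun do rewrite big_ord_recr; exact: bfsD.
Qed.

Lemma bfs_integral_sum n (f : nat -> T -> R) : (forall i, bfs mu (f i)) ->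
  \int[mu]_z (\sum_(i < n) f i z) = \sum_(i < n) \int[mu]_z f i z.
Proof.
move=> bf; elim: n => [|n IH].
  rewrite big_ord0; under eq_Rintegral do rewrite big_ord0.
  by rewrite /Rintegral integral0.
under eq_Rintegral do rewrite big_ord_recr /=.
rewrite RintegralD ?IH ?big_ord_recr //; apply: bfs_integrable => //.
exact: bfs_sum.
Qed.

Lemma bfs_le f g : bfs mu f -> bfs mu g -> (forall z, f z <= g z) ->
  \int[mu]_z f z <= \int[mu]_z g z.
Proof. by move=> bf bg fg; apply: le_Rintegral => //; exact: bfs_integrable. Qed.

Lemma bfs_indic_integral (A : set T) : measurable A -> (mu A < +oo)%E ->
  \int[mu]_z (\1_A z) = fine (mu A).
Proof. by move=> mA fA; rewrite /Rintegral integral_indic // setIT. Qed.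

End integral_sum.

Section window.
Context (R : realType).

(** The integer half-width and the half-open interval make this a union of cells of every dyadic
    mesh, so that its indicator can multiply the test functions of the martingale; see
    [cellwise_window]. *)
Definition window (J : nat) (T : R) : set (R * R) := `[- J%:R, J%:R[ `*` `]0, T[.

Lemma measurable_window J T : measurable (window J T).
Proof. by apply: measurableX; exact: measurable_itv. Qed.

Lemma lebesgue2_rect (a b c d : R) (p q r s : bool) : a <= b -> c <= d ->
  leb2 R ([set` Interval (BSide p a) (BSide q b)] `*` [set` Interval (BSide r c) (BSide s d)]) =
  ((b - a) * (d - c))%:E.
Proof.
move=> ab cd.
have len x y k l : x <= y ->
    leb R [set` Interval (BSide k x) (BSide l y)] = (y - x)%:E.
  rewrite le_eqVlt lebesgue_measure_itv /= lte_fin => /orP[/eqP->|->].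
    by rewrite ltxx subrr.
  by rewrite EFinB.
rewrite product_measure1E; [|exact: measurable_itv|exact: measurable_itv].
rewrite EFinM; congr (_ * _)%E; exact: len.
Qed.

Lemma window_fin J T : (leb2 R (window J T) < +oo)%E.
Proof.
have [T0|T0] := leP 0 T.
  have JJ : - J%:R <= J%:R :> R by have := ler0n R J; lra.
  by rewrite lebesgue2_rect ?ltry.
have -> : window J T = set0.
  by apply/seteqP; split=> // z [_]; rewrite /= in_itv /=; lra.
by rewrite measure0.
Qed.

End window.

Lemma int_offset (p q : int) (r : nat) : q <= p -> p < q + Posz r ->
  exists2 l : nat, (l < r)%N & p = q + Posz l.
Proof. by move=> qp pr; exists (absz (p - q)); lia. Qed.

(** * Energy of the dyadic quotients of the scheme *)

Section energy.
Context (R : realType) (phi : R -> R) (lam D B L S : R) (a0 : R -> R)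
  (a s : nat -> nat -> int -> R).
Hypothesis sc : scheme phi lam D B L S a0 a s.
Hypothesis phi_cont : continuous phi.
Notation h := (mesh R).
Notation tau n := (lam * mesh R n ^+ 2).
Let w n z := phi (grid_state lam a n z).

Lemma dyad_grid n z : dyad n (w n) z =
  (phi (a n (slot (tau n) z.2) (cell (h n) z.1 + 1)) -
   phi (a n (slot (tau n) z.2) (cell (h n) z.1))) / h n.
Proof.
have h0 := mesh_gt0 R n.
have E : cell (h n) (snap n z.1) = cell (h n) z.1.
  apply: cell_eq => //; rewrite lexx /= mulrDl mul1r -/(snap n z.1).
  by rewrite ltrDl.
by rewrite /dyad /w /grid_state /interp /= cellD // E.
Qed.

Lemma bm_grid n : bm2 R (grid_state lam a n).
Proof.
split; first by apply: measurable_interp; [exact: mesh_gt0|exact: tau_gt0 sc n].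
by exists B => z; rewrite ger0_norm; have /andP[] := scheme_bnd sc n (slot (tau n) z.2) (cell (h n) z.1).
Qed.

Lemma phi_bnd x : 0 <= x <= B -> `|phi x| <= L * B.
Proof.
move=> /andP[x0 xB]; have B0 := le_trans x0 xB; have L0 := scheme_L sc.
have := scheme_phi_lip sc (x := 0) (y := x).
rewrite lexx B0 x0 xB (scheme_phi0 sc) !subr0 => /(_ isT isT).
rewrite -[phi x ^+ 2]real_normK ?num_real //.
have [->|p0] := eqVneq (phi x) 0; first by rewrite normr0 mulr_ge0 // ltW.
have n0 : 0 < `|phi x| by rewrite normr_gt0.
move=> H; have : `|phi x| ^+ 2 <= L * B * `|phi x|.
  apply: le_trans H _; rewrite -mulrA ler_pM2l //.
  by apply: le_trans (ler_wpM2l x0 (ler_norm _)) _; rewrite ler_wpM2r.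
by rewrite expr2 ler_pM2r.
Qed.

Lemma bm_flux n : bm2 R (w n).
Proof.
have [m _] := bm_grid n; split.
  by apply: measurableT_comp => //; exact: continuous_measurable_fun.
by exists (L * B) => z; apply: phi_bnd; exact: scheme_bnd sc n _ _.
Qed.

(** At its own mesh the quotient is constant on space-time cells of area [h * tau], so each cell
    contributes [lam * h] times a squared increment. The integral is thus the sum of
    [scheme_sum_energy0] without weights; on the window these are at least [expR (- J)], whence the
    factor [expR J]. *)
Lemma dyad_energy (T : R) (J : nat) : 0 < T -> exists C, 0 <= C /\ forall n, (J <= n)%N ->
  \int[leb2 R]_z (\1_(window J T) z * dyad n (w n) z ^+ 2) <= C.
Proof.
move=> T0; have /andP[lam0 lam1] := scheme_lam sc.
pose K := energy_const0 lam D B L S ((T + 1) / lam).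
exists (lam * expR J%:R * K); split.
  have K0 : 0 <= K.
    have := @scheme_sum_energy0 _ _ _ _ _ _ _ _ _ _ sc (T + 1) 0%N 0%N.
    by rewrite big_ord0 mulr0; apply; rewrite mul0r; lra.
  by rewrite mulr_ge0 // mulr_ge0 ?expR_ge0 // ltW.
move=> n Jn; have h0 := mesh_gt0 R n; have h1 := mesh_le1 R n.
have tau0 := tau_gt0 sc n; have tauh := tau_le sc n.
pose W m i := phi (a n m i).
pose i0 : int := - Posz (J * 2 ^ n); pose r := (J * 2 ^ n + J * 2 ^ n)%N.
have i0E : i0%:~R * h n = - J%:R.
  by rewrite /i0 mulrNz mulNr -pmulrn natrM -mulrA mesh_pow2 mulr1.
have rE : (i0 + Posz r)%:~R * h n = J%:R.
  rewrite /i0 /r PoszD addKr.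
  by rewrite -pmulrn natrM -mulrA mesh_pow2 mulr1.
(* The last slot overshoots [T] by at most [tau <= 1]; hence the horizon [T + 1] in the constant. *)
pose N := (Num.truncn (T / tau n)).+1.
have TN : T <= N%:R * tau n by rewrite -ler_pdivrMr //; exact/ltW/truncnS_gt.
have NT : N%:R * tau n <= T + 1.
  rewrite /N -[_.+1]addn1 natrD mulrDl mul1r lerD //; last by lra.
  by rewrite -ler_pdivlMr // truncn_le divr_ge0 // ltW.
pose rect m i : set (R * R) := `[i%:~R * h n, (i%:~R + 1) * h n[ `*` `[m%:R * tau n, (m%:R + 1) * tau n[.
have mu_rect m i : leb2 R (rect m i) = (h n * tau n)%:E.
  rewrite lebesgue2_rect; try by rewrite mulrDl mul1r lerDl ltW.
  by congr EFin; ring.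
have m_rect m i : measurable (rect m i) by apply: measurableX; exact: measurable_itv.
have f_rect m i : (leb2 R (rect m i) < +oo)%E.
  by apply: le_lt_trans (ltry (h n * tau n)); rewrite mu_rect.
have brect m i : bfs (leb2 R) (\1_(rect m i)).
  exact: (@bfs_indic _ _ R (leb2 R) _ (m_rect m i) (f_rect m i)).
pose G m l z := ((W m (i0 + Posz l + 1) - W m (i0 + Posz l)) / h n) ^+ 2 * \1_(rect m (i0 + Posz l)) z.
have bG m l : bfs (leb2 R) (G m l).
  by apply: bfsZ; exact: brect.
have bG2 m : bfs (leb2 R) (fun z => \sum_(l < r) G m l z) by exact: bfs_sum.
have G0 m l z : 0 <= G m l z by rewrite mulr_ge0 ?sqr_ge0 // indicE.
apply: le_trans (_ : \int[leb2 R]_z (\sum_(m < N) \sum_(l < r) G m l z) <= _).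
  apply: bfs_le.
  - have bd : bm2 R (fun z => dyad n (w n) z ^+ 2).
      have b := bm_dyad n (bm_flux n).
      by have := bmM b b; under eq_fun do rewrite -expr2.
    have bw : bfs (leb2 R) (\1_(window J T)).
      exact: (@bfs_indic _ _ R (leb2 R) _ (measurable_window J T) (window_fin J T)).
    exact: (bfsMr bw bd).
  - exact: (bfs_sum N bG2).
  move=> z; rewrite indicE; case: (boolP (z \in _)) => [|_]; last first.
    by rewrite mul0r; apply: sumr_ge0 => m _; apply: sumr_ge0 => l _.
  rewrite inE => -[]; rewrite /= !in_itv /= => /andP[z1 z2] /andP[z3 z4]; rewrite mul1r.
  have /andP[c1 c2] := cell_itv z.1 h0.
  have /andP[s1 s2] := slot_itv tau0 (ltW z3).
  have mN : (slot (tau n) z.2 < N)%N.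
    by rewrite -(ltr_nat R) -(ltr_pM2r tau0); lra.
  have ci : i0 <= cell (h n) z.1.
    rewrite -ltzD1 -(ltr_int R) -(ltr_pM2r h0) i0E intrD; lra.
  have ci2 : cell (h n) z.1 < i0 + Posz r.
    by rewrite -(ltr_int R) -(ltr_pM2r h0) rE; lra.
  have [l lr El] : exists2 l : nat, (l < r)%N & cell (h n) z.1 = i0 + Posz l.
    exact: int_offset.
  rewrite (bigD1 (Ordinal mN)) //= (bigD1 (Ordinal lr)) //= -addrA ler_wpDr //.
    by apply: addr_ge0; [|apply: sumr_ge0 => m _]; apply: sumr_ge0.
  rewrite dyad_grid /G El -/(W _ _) -/(W _ _) indicE mem_set ?mulr1 //.
  split => /=; rewrite in_itv /=; last by rewrite s1.
  by rewrite -El c1.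
have := bfs_integral_sum N bG2 => /= ->.
have -> : \sum_(m < N) \int[leb2 R]_z (\sum_(l < r) G m l z) =
    \sum_(m < N) lam * h n * \sum_(l < r) (W m (i0 + Posz l + 1) - W m (i0 + Posz l)) ^+ 2.
  apply: eq_bigr => m _; rewrite (bfs_integral_sum r (bG m)) mulr_sumr; apply: eq_bigr => l _.
  rewrite RintegralZl //; last first.
    exact: bfs_integrable.
  have -> : \int[leb2 R]_z (\1_(rect m (i0 + Posz l)) z) = h n * tau n.
    transitivity (fine (leb2 R (rect m (i0 + Posz l)))); last by rewrite mu_rect.
    exact: (@bfs_indic_integral _ _ R (leb2 R) _ (m_rect _ _) (f_rect _ _)).
  by field; exact: lt0r_neq0.
have := @scheme_sum_energy0 _ _ _ _ _ _ _ _ _ _ sc (T + 1) n N NT.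
move/(ler_wpM2l (mulr_ge0 (ltW lam0) (expR_ge0 J%:R))); rewrite -/K; apply: le_trans.
rewrite mulrA mulr_sumr; apply: ler_sum => m _.
have -> : lam * expR J%:R * h n = lam * h n * expR J%:R by ring.
rewrite -[leRHS]mulrA ler_pM2l ?mulr_gt0 // -ler_pdivrMl ?expR_gt0 // -expRN.
apply: (@zsum_window_weight R (weight (h n)) _ (expR (- J%:R)) _ (fun i => (W m (i + 1) - W m i) ^+ 2)).
- by move=> i; exact: weight_gt0.
- by move=> i; exact: sqr_ge0.
- rewrite /i0; have : (J * 2 ^ n <= n * 2 ^ n)%N by rewrite leq_mul2r Jn orbT.
  by move: (J * 2 ^ n)%N (n * 2 ^ n)%N; clear; lia.
- rewrite /i0 /r; have : (J * 2 ^ n <= n * 2 ^ n)%N by rewrite leq_mul2r Jn orbT.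
  by move: (J * 2 ^ n)%N (n * 2 ^ n)%N; clear; lia.
- move=> j jr; apply: weight_ge => //.
  have E : (absz (i0 + Posz j)%R <= J * 2 ^ n)%N.
    by move: jr; rewrite /i0 /r; move: (J * 2 ^ n)%N; clear; lia.
  have -> : J%:R = (J * 2 ^ n)%:R * h n by rewrite natrM -mulrA mesh_pow2 mulr1.
  rewrite mulrC.
  by rewrite ler_pM2r // ler_nat.
Qed.

End energy.

(** * The limit of the dyadic difference quotients *)

Definition variation (R : realType) (u : nat -> R) : \bar R :=
  (\sum_(0 <= n <oo) `|u n.+1 - u n|%:E)%E.

Section variation.
Context (R : realType).
Implicit Types u : nat -> R.

Lemma variation_ge0 u : (0 <= variation u)%E.
Proof. by apply: nneseries_ge0 => n _ _; rewrite lee_fin. Qed.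

Lemma variation_partial u n : ((\sum_(0 <= i < n) `|u i.+1 - u i|)%:E <= variation u)%E.
Proof.
have := @nneseries_lim_ge R (fun i => `|u i.+1 - u i|%:E) xpredT 0 n.
by rewrite sumEFin; apply => i _ _; rewrite lee_fin.
Qed.

Lemma variation_le u n : (`|u n|%:E <= `|u 0%N|%:E + variation u)%E.
Proof.
apply: le_trans (leeD2l _ (variation_partial u n)); rewrite lee_fin.
have -> : u n = u 0%N + \sum_(0 <= i < n) (u i.+1 - u i) by rewrite telescope_sumr //; ring.
apply: le_trans (ler_normD _ _) _; rewrite lerD2l; exact: ler_norm_sum.
Qed.

Lemma variation_cvg u : (variation u < +oo)%E -> cvgn u.
Proof.
move=> fu; have : cvgn [normed series (telescope u)].
  apply: nondecreasing_is_cvgn.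
    by apply: nondecreasing_series => n _ _; exact: normr_ge0.
  exists (fine (variation u)) => _ [n _ <-] /=.
  rewrite -lee_fin fineK ?ge0_fin_numE ?variation_ge0 //.
  exact: variation_partial.
move/normed_cvg; rewrite telescopeK => H.
have : cvgn (fun n => (u n - u 0%N) + u 0%N) by apply: is_cvgD => //; exact: is_cvg_cst.
by under eq_fun do rewrite subrK.
Qed.

End variation.

Section variation_dct.
Context d (X : measurableType d) (R : realType) (mu : {measure set X -> \bar R}).

Lemma measurable_variation (F : nat -> X -> R) : (forall n, measurable_fun setT (F n)) ->
  measurable_fun setT (fun z => variation (F ^~ z)).
Proof.
move=> mF; apply: ge0_emeasurable_sum => [n z _ _|n _]; first by rewrite lee_fin.
by apply/measurable_EFinP; apply: measurableT_comp => //; exact: measurable_funB.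
Qed.

(** An integrable total variation does two things at once: it is finite almost everywhere, which
    forces convergence there, and together with [F 0] it dominates the whole sequence. The limit [g]
    is prescribed only where the variation is finite. *)
Lemma variation_dct (F : nat -> X -> R) (g theta : X -> R) :
  (forall n, measurable_fun setT (F n)) -> measurable_fun setT g ->
  mu.-integrable setT (EFin \o F 0%N) ->
  (\int[mu]_z variation (F ^~ z) < +oo)%E ->
  (forall z, (variation (F ^~ z) < +oo)%E -> F n z @[n --> \oo] --> g z) ->
  bounded_measurable theta ->
  mu.-integrable setT (EFin \o (fun z => g z * theta z)) /\
  \int[mu]_z (F n z * theta z) @[n --> \oo] --> \int[mu]_z (g z * theta z).
Proof.
move=> mF mg iF0 fV Fg [mth [K thK]].
have mV := measurable_variation mF.
have iV : mu.-integrable setT (fun z => variation (F ^~ z)).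
  apply/integrableP; split=> //; under eq_integral do rewrite gee0_abs ?variation_ge0 //.
  exact: fV.
have K1 : 0 <= `|K| + 1 by rewrite addr_ge0.
pose G z : \bar R := ((`|K| + 1)%:E * (`|F 0%N z|%:E + variation (F ^~ z)))%E.
have iG : mu.-integrable setT G.
  by apply: integrableZl => //; apply: integrableD => //; exact: integrable_norm iF0.
have dom n z : (`|(F n z * theta z)%:E| <= G z)%E.
  rewrite /= normrM mulrC EFinM; apply: lee_pmul; rewrite ?lee_fin //.
    by apply: le_trans (thK z) _; have := ler_norm K; lra.
  exact: variation_le.
have aeV := integrable_ae measurableT iV.
have [||||i1 _ c] := @dominated_convergence _ _ _ mu setT measurableT
  (fun n => EFin \o (fun z => F n z * theta z)) (EFin \o (fun z => g z * theta z)) G _ _ _ iG.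
- by move=> n; apply/measurable_EFinP; exact: measurable_funM.
- by apply/measurable_EFinP; exact: measurable_funM.
- apply: filterS aeV => z /(_ Logic.I) Vz _; apply: cvg_EFin; first exact: nearW.
  apply: cvgM; last exact: cvg_cst.
  by apply: Fg; rewrite -ge0_fin_numE // variation_ge0.
- by apply: aeW => z n _; exact: dom.
split=> //; rewrite /Rintegral; apply: fine_cvg; rewrite fineK; first exact: c.
exact: integrable_fin_num.
Qed.

End variation_dct.

Lemma lebesgue_itv_fin (R : realType) (a b : R) (p q : bool) :
  (leb R [set` Interval (BSide p a) (BSide q b)] < +oo)%E.
Proof. by rewrite lebesgue_measure_itv /=; case: ifP => _; exact: ltry. Qed.

(** * The martingale limit and its [L^2] bound *)

Section gradient.
Context (R : realType) (w : R * R -> R) (T : R).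
Hypothesis bw : bm2 R w.
Hypothesis energy : forall J : nat, exists C, forall m,
  \int[leb2 R]_z (\1_(window J T) z * dyad m w z ^+ 2) <= C.
Notation win J := (\1_(window J T) : R * R -> R).

Lemma bfs_window J : bfs (leb2 R) (win J).
Proof. exact: (@bfs_indic _ _ R (leb2 R) _ (measurable_window J T) (window_fin J T)). Qed.

Lemma window_sqr J z : win J z * win J z = win J z.
Proof. by rewrite indicE; case: (_ \in _); rewrite ?mulr1 ?mulr0. Qed.

Lemma cellwise_window J m : cellwise m (win J).
Proof.
move=> [x t]; rewrite !indicE /=; congr (nat_of_bool _)%:R.
have h0 := mesh_gt0 R m; have /andP[x1 x2] := snap_itv m x.
have JE : J%:R = (J * 2 ^ m)%:R * mesh R m by rewrite natrM -mulrA mesh_pow2 mulr1.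
have iff1 : (- J%:R <= snap m x) = (- J%:R <= x).
  apply/idP/idP => [|H]; first by move/le_trans; apply.
  rewrite /snap JE -mulNr ler_pM2r // pmulrn -mulrNz ler_int.
  by rewrite floor_ge_int ler_pdivlMr // mulrNz mulNr -pmulrn -JE.
have iff2 : (snap m x < J%:R) = (x < J%:R).
  apply/idP/idP => [H|]; last by apply: le_lt_trans.
  apply: lt_le_trans x2 _; move: H; rewrite /snap JE ltr_pM2r // pmulrn ltr_int => H.
  rewrite -[X in _ + X]mul1r -mulrDl ler_pM2r // -(intrD _ _ 1) ler_int.
  by rewrite -ltzD1 ltrD2r.
rewrite /window; apply/idP/idP => /set_mem[]; rewrite /= !in_itv /= => /andP[a1 a2] a3;
  apply/mem_set; split; rewrite /= in_itv //=.
  by rewrite -iff1 -iff2 a1.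
by rewrite iff1 iff2 a1.
Qed.

Let E J m := \int[leb2 R]_z (win J z * dyad m w z ^+ 2).

Let bd m : bm2 R (dyad m w). Proof. exact: bm_dyad. Qed.

Let bwd J m n : bfs (leb2 R) (fun z => win J z * (dyad m w z * dyad n w z)).
Proof. by apply: (bfsMr (bfs_window J)); exact: bmM. Qed.

Let cross J m n : (m <= n)%N ->
  \int[leb2 R]_z (win J z * (dyad m w z * dyad n w z)) = E J m.
Proof.
move=> mn; have c : cellwise m (fun z => win J z * dyad m w z).
  by move=> z; rewrite [win J (_, _)]cellwise_window [dyad m w (_, _)]cellwise_dyad.
have := dyad_orthogonal_le mn bw (bfsMr (bfs_window J) (bd m)) c.
under eq_Rintegral do rewrite -mulrA; move=> ->.
by apply: eq_Rintegral => z _; rewrite -mulrA expr2.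
Qed.

(** Pythagoras: an increment of the martingale is orthogonal to its past, because [dyad m w]
    restricted to a window is itself an admissible cellwise factor. *)
Lemma dyad_increment J m n : (m <= n)%N ->
  \int[leb2 R]_z (win J z * (dyad n w z - dyad m w z) ^+ 2) = E J n - E J m.
Proof.
move=> mn.
have EE : forall z, win J z * (dyad n w z - dyad m w z) ^+ 2 =
  win J z * (dyad n w z * dyad n w z) - (2 * (win J z * (dyad m w z * dyad n w z)) -
    win J z * (dyad m w z * dyad m w z)) by move=> z; ring.
under eq_Rintegral do rewrite EE.
have b1 := bwd J n n; have b2 := bwd J m n; have b3 := bwd J m m.
rewrite RintegralB //; [|exact: bfs_integrable|exact: (bfs_integrable (bfsB (bfsZ 2 b2) b3))].
rewrite RintegralB //; [|exact: (bfs_integrable (bfsZ 2 b2))|exact: bfs_integrable].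
rewrite RintegralZl //; last exact: bfs_integrable.
by rewrite !cross //; ring.
Qed.

Lemma dyad_energy_mono J m n : (m <= n)%N ->
  \int[leb2 R]_z (win J z * dyad m w z ^+ 2) <= \int[leb2 R]_z (win J z * dyad n w z ^+ 2).
Proof.
move=> mn; rewrite -subr_ge0 -(dyad_increment J mn); apply: Rintegral_ge0 => z _.
by rewrite mulr_ge0 ?sqr_ge0 // indicE.
Qed.

(** The energies on a window increase with the mesh index and are bounded, so their increments
    become small. Window and tolerance [4^-J] are tied to the same index [J]: one subsequence serves
    all windows, at a summable rate. *)
Lemma dyad_subsequence : exists mm : nat -> nat, [/\ forall j, (j <= mm j)%N,
  forall i j, (i <= j)%N -> (mm i <= mm j)%N &
  forall J n, (mm J <= n)%N ->
    \int[leb2 R]_z (win J z * (dyad n w z - dyad (mm J) w z) ^+ 2) <= mesh R J ^+ 2].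
Proof.
have step J : exists N : nat, forall n m, (N <= m)%N -> (m <= n)%N -> E J n - E J m <= mesh R J ^+ 2.
  have [C HC] := energy J.
  have cE : cvgn (E J).
    by apply: nondecreasing_is_cvgn; [exact: dyad_energy_mono|exists C => _ [m _ <-]; exact: HC].
  have e0 : 0 < mesh R J ^+ 2 by rewrite exprn_gt0 // mesh_gt0.
  have := cE; move/cvgrPdist_le => /(_ _ e0)[N _ HN]; exists N => n m Nm mn.
  have LE : E J n <= limn (E J) := nondecreasing_cvgn_le (dyad_energy_mono J) cE n.
  have := HN m Nm; rewrite -/(E J n) -/(E J m).
  by have := ler_norm (limn (E J) - E J m); lra.
have /choice[N HN] := step.
(* The maximum makes the choice monotone and at least [N j]; the summand [j] makes it tend to
   infinity. *)
pose mm j := (\max_(i < j.+1) N i + j)%N.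
have mono i j : (i <= j)%N -> (mm i <= mm j)%N.
  move=> ij; rewrite /mm leq_add //; apply/bigmax_leqP => k _.
  have kj : (k < j.+1)%N by apply: leq_trans (ltn_ord k) _.
  exact: (leq_bigmax (F := fun i : 'I_j.+1 => N i) (Ordinal kj)).
exists mm; split=> // [j|J n Jn]; first by rewrite leq_addl.
rewrite dyad_increment //; apply: HN => //; apply: leq_trans (leq_addr J _).
exact: (leq_bigmax (F := fun i : 'I_J.+1 => N i) ord_max).
Qed.

Lemma mesh_series c : 0 <= c -> (\sum_(0 <= n <oo) (mesh R n * c)%:E < +oo)%E.
Proof.
move=> c0; apply: (@le_lt_trans _ _ (2 * c)%:E); last exact: ltry.
apply: lime_le.
  by apply: is_cvg_nneseries => n _ _; rewrite lee_fin mulr_ge0 // ltW // mesh_gt0.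
apply: nearW => n; rewrite sumEFin lee_fin -mulr_suml ler_wpM2r //.
suff -> : \sum_(0 <= i < n) mesh R i = 2 - 2 * mesh R n.
  by have := mesh_gt0 R n; lra.
elim: n => [|n IH]; first by rewrite big_geq // /mesh expr0; ring.
by rewrite big_nat_recr //= IH (meshS R n); ring.
Qed.

Lemma window_le J K z : (J <= K)%N -> win J z <= win K z.
Proof.
move=> JK; rewrite !indicE; have [zJ|_] := boolP (z \in window J T); last by rewrite ler0n.
rewrite mem_set // ; move/set_mem : zJ => -[/= z1 z2]; split => //=.
have : J%:R <= K%:R :> R by rewrite ler_nat.
by move: z1; rewrite !in_itv /= => /andP[? ?] ?; apply/andP; split; lra.
Qed.

Section subsequence.
Variable mm : nat -> nat.
Hypotheses (mm_ge : forall j, (j <= mm j)%N) (mm_mono : forall i j, (i <= j)%N -> (mm i <= mm j)%N)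
  (mm_inc : forall J n, (mm J <= n)%N ->
    \int[leb2 R]_z (win J z * (dyad n w z - dyad (mm J) w z) ^+ 2) <= mesh R J ^+ 2).

Let f J n z := win J z * dyad (mm (n + J)) w z.

Let bf J n : bfs (leb2 R) (f J n). Proof. exact: (bfsMr (bfs_window J) (bd _)). Qed.

Let mf J n : mfun2 (f J n). Proof. by have [[m _] _] := bf J n; exact: m. Qed.

(** The sequence [f] starts at [mm J], so that its [n]-th increment is controlled on the window
    [n + J], which contains the window [J]. *)
Lemma dyad_variation J : (\int[leb2 R]_z variation (f J ^~ z) < +oo)%E.
Proof.
pose c := \int[leb2 R]_z win J z + 1.
have c0 : 0 <= c.
  by rewrite addr_ge0 //; apply: Rintegral_ge0 => z _; rewrite indicE.
have mF n : mfun2 (fun z => `|f J n.+1 z - f J n z|%:E).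
  apply/measurable_EFinP; apply: measurableT_comp => //.
  exact: measurable_funB (mf J n.+1) (mf J n).
apply: le_lt_trans (mesh_series c0); rewrite /variation (integral_nneseries _ measurableT mF); last first.
  by move=> n z _; rewrite lee_fin.
apply: lee_nneseries => [n _ _|n _]; first by apply: integral_ge0 => z _; rewrite lee_fin.
pose D z := dyad (mm (n.+1 + J)) w z - dyad (mm (n + J)) w z.
have h0 := mesh_gt0 R n.
have bD : bm2 R (fun z => D z ^+ 2).
  have b : bm2 R D by apply: bmB.
  by have := bmM b b; under eq_fun do rewrite -expr2.
(* Young's inequality [|D| <= h + D^2 / h] with [h = 2^-n]: as the integral of [D^2] is at most
   [h^2], both terms are of order [h] and the series is geometric. The [+ 1] in [c] pays for the
   second term. *)
pose F z := mesh R n * win J z + (mesh R n)^-1 * (win J z * D z ^+ 2).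
have bwD : bfs (leb2 R) (fun z => win J z * D z ^+ 2) := bfsMr (bfs_window J) bD.
have bF : bfs (leb2 R) F := bfsD (bfsZ (mesh R n) (bfs_window J)) (bfsZ (mesh R n)^-1 bwD).
have IF : \int[leb2 R]_z F z <= mesh R n * c.
  rewrite RintegralD //; [|exact: (bfs_integrable (bfsZ _ (bfs_window J)))|exact: (bfs_integrable (bfsZ _ bwD))].
  rewrite RintegralZl //; last exact: (bfs_integrable (bfs_window J)).
  rewrite RintegralZl //; last exact: (bfs_integrable bwD).
  rewrite /c mulrDr lerD2l mulr1 ler_pdivrMl // -expr2.
  have le1 : \int[leb2 R]_z (win J z * D z ^+ 2) <= \int[leb2 R]_z (win (n + J) z * D z ^+ 2).
    apply: bfs_le => //; first exact: (bfsMr (bfs_window (n + J)) bD).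
    by move=> z; rewrite ler_wpM2r ?sqr_ge0 // window_le // leq_addl.
  apply: le_trans le1 _; apply: le_trans (mm_inc _) _; first by apply: mm_mono; rewrite leq_add2r.
  rewrite ler_sqr ?nnegrE ?(ltW (mesh_gt0 _ _)) // /mesh ler_iXn2l ?invr_gt0 ?invf_lt1 ?ltr1n //.
  by rewrite leq_addr.
apply: (@le_trans _ _ (\int[leb2 R]_z (F z)%:E)%E).
  apply: ge0_le_integral => //.
  - by have [[m _] _] := bF; apply/measurable_EFinP; exact: m.
  move=> z _; rewrite lee_fin /f -mulrBr -/(D z) /F normrM ger0_norm; last by rewrite indicE.
  have -> : mesh R n * win J z + (mesh R n)^-1 * (win J z * D z ^+ 2) =
    win J z * (mesh R n + (mesh R n)^-1 * D z ^+ 2) by ring.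
  rewrite ler_wpM2l ?indicE // -(ler_pM2l h0) mulrDr mulrA divff ?lt0r_neq0 // mul1r.
  rewrite -[D z ^+ 2]real_normK ?num_real // -expr2.
  have := sqr_ge0 (mesh R n - `|D z|); have := sqr_ge0 (mesh R n); have := sqr_ge0 `|D z|.
  by lra.
rewrite -[X in (X <= _)%E]fineK; first by rewrite lee_fin.
by apply: integrable_fin_num => //; exact: bfs_integrable.
Qed.

(* An upper limit, so as to be measurable everywhere; [variation_dct] applies
   because [dyad (mm j) w] has an integrable variation on every window. *)
Definition dyad_limit z : R := fine (limn_esup (fun j => (dyad (mm j) w z)%:E)).
Notation g := dyad_limit.

Lemma measurable_dyad_limit : mfun2 g.
Proof.
apply: measurableT_comp => //; apply: measurable_fun_limn_esup => j.
by apply/measurable_EFinP; have [m _] := bd (mm j); exact: m.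
Qed.

Let mgw J : mfun2 (fun z => win J z * g z).
Proof.
apply: measurable_funM; last exact: measurable_dyad_limit.
by have [[m _] _] := bfs_window J; exact: m.
Qed.

Let f_cvg J z : (variation (f J ^~ z) < +oo)%E -> f J n z @[n --> \oo] --> win J z * g z.
Proof.
have [zJ|/negPf zJ] := boolP (z \in window J T); last first.
  have -> : f J ^~ z = cst 0 by apply/funext => n; rewrite /f indicE zJ mul0r.
  by move=> _; rewrite indicE zJ mul0r; exact: cvg_cst.
have -> : f J ^~ z = fun n => dyad (mm (n + J)) w z.
  by apply/funext => n; rewrite /f indicE zJ mul1r.
rewrite indicE zJ mul1r => V.
have c : cvgn (fun j => dyad (mm j) w z).
  have /cvg_ex[l] := variation_cvg V.
  by rewrite (@cvg_shiftn J _ (fun j => dyad (mm j) w z) (nbhs l)) => H; apply/cvg_ex; exists l.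
rewrite (@cvg_shiftn J _ (fun j => dyad (mm j) w z) (nbhs (g z))) /g.
have cE : (dyad (mm j) w z)%:E @[j --> \oo] --> (limn (fun j => dyad (mm j) w z))%:E.
  by apply: cvg_EFin => //; exact: nearW.
by rewrite (cvg_limn_einf_sup cE).2.
Qed.

Lemma dyad_limit_plane J (theta : R * R -> R) : bm2 R theta ->
  (leb2 R).-integrable setT (EFin \o (fun z => win J z * g z * theta z)) /\
  \int[leb2 R]_z (win J z * dyad (mm j) w z * theta z) @[j --> \oo] -->
    \int[leb2 R]_z (win J z * g z * theta z).
Proof.
move=> bt.
have [i c] := variation_dct (mf J) (mgw J) (bfs_integrable (bf J 0)) (dyad_variation J) (@f_cvg J) bt.
split; first exact: i.
by rewrite -(cvg_shiftn J); exact: c.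
Qed.

(** By Tonelli the variation is integrable in [x] for almost every [t]. The exceptional set depends
    on the variation alone, so that [theta] may be quantified after [t]. *)
Lemma dyad_limit_section J : {ae leb R, forall t (theta : R -> R), bm1 R theta ->
  (leb R).-integrable setT (EFin \o (fun x => win J (x, t) * g (x, t) * theta x)) /\
  \int[leb R]_x (win J (x, t) * dyad (mm j) w (x, t) * theta x) @[j --> \oo] -->
    \int[leb R]_x (win J (x, t) * g (x, t) * theta x)}.
Proof.
have mV : mfun2 (fun z => variation (f J ^~ z)) by exact: measurable_variation.
have := dyad_variation J; rewrite (fubini_tonelli2 _ mV); last by move=> z; exact: variation_ge0.
set G := fubini_G _ _ => GT.
have mG : measurable_fun setT G.
  by apply: measurable_fun_fubini_tonelli_G => // z; exact: variation_ge0.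
have G0 t : (0 <= G t)%E by apply: integral_ge0 => x _; exact: variation_ge0.
have iG : (leb R).-integrable setT G.
  by apply/integrableP; split=> //; under eq_integral do rewrite gee0_abs ?G0 //.
apply: filterS (integrable_ae measurableT iG) => t /(_ Logic.I) Gt theta bt.
have ms (k : R * R -> R) : mfun2 k -> @measurable_fun _ _ (measurableTypeR R) _ setT (fun x => k (x, t)).
  by move=> mk; exact: measurable_fun_pair1.
have Vt : (\int[leb R]_x variation (fun n => f J n (x, t)) < +oo)%E by rewrite ltey_eq Gt.
have i0 : (leb R).-integrable setT (EFin \o (fun x => f J 0 (x, t))).
  apply: bfs_integrable; split.
    split; first exact: ms.
    by have [[_ [K fK]] _] := bf J 0; exists K => x.
  exists `[- J%:R, J%:R[%classic; split; first exact: measurable_itv.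
    exact: lebesgue_itv_fin.
  move=> x xJ; rewrite /f indicE memNset ?mul0r // => -[/= H _]; exact: xJ.
have [i c] := @variation_dct _ _ R (leb R) (fun n x => f J n (x, t)) (fun x => win J (x, t) * g (x, t)) theta
  (fun n => ms _ (mf J n)) (ms _ (mgw J)) i0 Vt (fun x => @f_cvg J (x, t)) bt.
split; first exact: i.
by rewrite -(cvg_shiftn J); exact: c.
Qed.

(** Fatou along the subsequence; the integrand agrees almost everywhere with the lower limit of the
    squares, since it converges wherever the variation is finite. *)
Lemma dyad_limit_sqr J : (\int[leb2 R]_z (win J z * g z ^+ 2)%:E < +oo)%E.
Proof.
have [C HC] := energy J.
have iV : (leb2 R).-integrable setT (fun z => variation (f J ^~ z)).
  apply/integrableP; split; first exact: measurable_variation.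
  by under eq_integral do rewrite gee0_abs ?variation_ge0 //; exact: dyad_variation.
have msq (k : R * R -> R) : mfun2 k -> mfun2 (fun z => (k z ^+ 2)%:E).
  by move=> mk; apply/measurable_EFinP; exact: measurable_funX.
have ->: (\int[leb2 R]_z (win J z * g z ^+ 2)%:E =
    \int[leb2 R]_z (limn_einf (fun n => (f J n z ^+ 2)%:E)))%E.
  apply: ge0_ae_eq_integral => //.
  - apply/measurable_EFinP; apply: measurable_funM; first by have [[m _] _] := bfs_window J; exact: m.
    by apply: measurable_funX; exact: measurable_dyad_limit.
  - have -> : (fun z => limn_einf (fun n => (f J n z ^+ 2)%:E)) =
        (fun z => - limn_esup (fun n => - (f J n z ^+ 2)%:E))%E.
      by apply/funext => z; rewrite -limn_einfN; congr limn_einf; apply/funext => n; rewrite /= opprK.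
    apply: measurableT_comp => //; apply: measurable_fun_limn_esup => n.
    by apply: measurableT_comp => //; exact: msq.
  - by move=> z _; rewrite lee_fin mulr_ge0 ?sqr_ge0 ?indicE.
  - move=> z _; rewrite limn_einf_lim; apply: lime_ge; first exact: is_cvg_einfs.
    apply: nearW => n; apply: le_ereal_inf_tmp => _ [k _ <-]; rewrite lee_fin; exact: sqr_ge0.
  - apply: filterS (integrable_ae measurableT iV) => z /(_ Logic.I) Vz _.
    have c : f J n z @[n --> \oo] --> win J z * g z.
      by apply: f_cvg; rewrite -ge0_fin_numE // variation_ge0.
    have cE : (f J n z ^+ 2)%:E @[n --> \oo] --> ((win J z * g z) ^+ 2)%:E.
      by apply: cvg_EFin; [exact: nearW|exact: (cvgM c c)].
    rewrite (cvg_limn_einf_sup cE).1; congr EFin.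
    by rewrite exprMn [win J z ^+ 2]expr2 window_sqr.
apply: (@le_lt_trans _ _ C%:E); last exact: ltry.
apply: le_trans (fatou _ _ _ _) _ => //.
- by move=> n; exact: msq.
- by move=> n z _; rewrite lee_fin sqr_ge0.
rewrite limn_einf_lim; apply: lime_le; first exact: is_cvg_einfs.
apply: nearW => n; apply: le_trans (ereal_inf_lbound _) _; first by exists n => //=.
rewrite -[X in (X <= _)%E]fineK; last first.
  apply: integrable_fin_num => //; apply: bfs_integrable.
  by have := bfsMr (bf J n) (bfs_bm (bf J n)); under eq_fun do rewrite -expr2.
rewrite lee_fin; apply: le_trans (HC (mm (n + J))).
rewrite le_eqVlt; apply/orP; left; apply/eqP; apply: eq_Rintegral => z _.
by rewrite /f exprMn [win J z ^+ 2]expr2 window_sqr.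
Qed.

Lemma dyad_limit_sqr_integrable J :
  (leb2 R).-integrable setT (EFin \o (fun z => win J z * g z ^+ 2)).
Proof.
apply/integrableP; split.
  apply/measurable_EFinP; apply: measurable_funM; first by have [[m _] _] := bfs_window J; exact: m.
  by apply: measurable_funX; exact: measurable_dyad_limit.
apply: le_lt_trans (dyad_limit_sqr J).
rewrite le_eqVlt; apply/orP; left; apply/eqP; apply: eq_integral => z _ /=.
by rewrite ger0_norm // mulr_ge0 ?sqr_ge0 // indicE.
Qed.

End subsequence.

End gradient.

Section calculus.
Context (R : realType).
Implicit Types (f : R -> R) (x a b : R).

(** The mean value theorem with [a = b] allowed, as clamped times may coincide. *)
Lemma derive1_increment f a b : a <= b ->
  (forall x, a < x < b -> derivable f x 1) -> {within `[a, b], continuous f} ->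
  exists2 c, a <= c <= b & f b - f a = (if a < b then derive1 f c else 0) * (b - a) /\ (a < b -> a < c < b).
Proof.
move=> ab df cf; have [->|ab'] := eqVneq a b.
  by exists b; rewrite ?lexx // ltxx; split=> //; rewrite !subrr mulr0.
have lab : a < b by rewrite lt_neqAle ab' ab.
have [x xab|c cab E] := @MVT R f (derive1 f) a b lab _ cf.
  rewrite derive1E; apply: derivableP; apply: df.
  by move: xab; rewrite in_itv.
move: cab; rewrite in_itv /= => /andP[c1 c2].
by exists c; rewrite ?lab ?(ltW c1) ?(ltW c2) // c1 c2.
Qed.

Lemma derive1_lipschitz f a b M : a <= b ->
  (forall x, a < x < b -> derivable f x 1) -> {within `[a, b], continuous f} ->
  (forall x, a < x < b -> `|derive1 f x| <= M) -> `|f b - f a| <= M * (b - a).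
Proof.
move=> ab df cf dM; have [c cab [-> H]] := derive1_increment ab df cf.
case: ifP => [lab|nab].
  rewrite normrM (ger0_norm (_ : 0 <= b - a)) ?subr_ge0 // ler_wpM2r ?subr_ge0 //.
  exact: dM (H lab).
by rewrite mul0r normr0; have -> : b = a; [lra|rewrite subrr mulr0].
Qed.

Lemma derive1_seq f x (h : nat -> R) : derivable f x 1 ->
  h n @[n --> \oo] --> 0 -> (forall n, h n != 0) ->
  (f (x + h n) - f x) / h n @[n --> \oo] --> derive1 f x.
Proof.
move=> df h0 hn0.
have hd : h n @[n --> \oo] --> 0^'.
  move=> A [e /= e0 He]; have /cvgrPdist_lt/(_ _ e0) := h0.
  by apply: filterS => n Hn; apply: He.
have : (fun h0 : R => h0^-1 *: ((f \o shift x) (h0 *: 1) - f x)) @ 0^' --> 'D_1 f x.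
  exact: df.
rewrite -derive1E => /(cvg_comp _ _ hd); apply: cvg_trans.
apply: near_eq_cvg; apply: nearW => n /=.
by rewrite [_ *: 1]mulr1 [_ *: _]mulrC [h n + x]addrC.
Qed.

Lemma mesh_cvg0 : mesh R n @[n --> \oo] --> 0.
Proof.
apply/cvgrPdist_le => e e0; have [N HN] := mesh_small e0.
exists N => // n Nn; rewrite sub0r normrN ger0_norm ?(ltW (mesh_gt0 R n)) //.
exact: HN.
Qed.

Lemma snap_cvg x : snap n x @[n --> \oo] --> x.
Proof.
apply/cvgrPdist_le => e e0; have [N HN] := mesh_small e0.
exists N => // n Nn; have /andP[x1 x2] := snap_itv n x; have := HN n Nn.
by rewrite ler_norml => h; apply/andP; split; lra.
Qed.

End calculus.

Lemma ae_imply (R : realType) (P Q : R -> Prop) : (forall t, P t -> Q t) ->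
  {ae leb R, forall t, P t} -> {ae leb R, forall t, Q t}.
Proof. by move=> PQ; apply: negligibleS => t /= nQ /PQ. Qed.

(** * The weak derivative on almost every time slice *)

Section weak_gradient.
Context (R : realType) (w : R * R -> R) (T : R).
Hypothesis bw : bm2 R w.
Variable mm : nat -> nat.
Hypotheses (mm_ge : forall j, (j <= mm j)%N) (mm_mono : forall i j, (i <= j)%N -> (mm i <= mm j)%N)
  (mm_inc : forall J n, (mm J <= n)%N ->
    \int[leb2 R]_z (\1_(window J T) z * (dyad n w z - dyad (mm J) w z) ^+ 2) <= mesh R J ^+ 2).
Notation win J := (\1_(window J T) : R * R -> R).
Notation g := (dyad_limit w mm).

(** By the martingale property the pairing with [theta] no longer changes from mesh [m] on, so it
    already equals its limit. *)
Lemma dyad_limit_cellwise J m theta : bfs (leb2 R) theta -> cellwise m theta ->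
  (forall z, ~ window J T z -> theta z = 0) ->
  \int[leb2 R]_z (theta z * dyad m w z) = \int[leb2 R]_z (theta z * g z).
Proof.
move=> bt cm th0.
have wt z : win J z * theta z = theta z.
  rewrite indicE; have [zJ|zJ] := pselect (window J T z); first by rewrite mem_set // mul1r.
  by rewrite th0 // mulr0.
have [_] := dyad_limit_plane bw mm_mono mm_inc J (bfs_bm bt).
have -> : (\int[leb2 R]_z (win J z * g z * theta z)) = \int[leb2 R]_z (theta z * g z).
  by apply: eq_Rintegral => z _; rewrite -[in RHS]wt; ring.
move=> c; symmetry; apply: (cvg_unique _ c) => //; apply: cvg_near_cst; near=> j.
have mj : (m <= mm j)%N.
  by apply: leq_trans (mm_ge j); near: j; exact: nbhs_infty_ge.
rewrite -(dyad_orthogonal_le mj bw bt cm); apply: eq_Rintegral => z _.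
by rewrite -[in RHS]wt; ring.
Unshelve. all: by end_near. Qed.

(** Summation by parts on a slice moves the quotient onto [psi]. What is left involves [w] only at
    the grid points [snap m x]; continuity in [x] makes these values tend to [w (x, t)], where
    integrability of [w] alone would say nothing. *)
Lemma dyad_limit_weak_derivative (J : nat) : {ae leb R, forall t, 0 < t < T ->
  continuous (fun x => w (x, t)) -> forall psi : R -> R,
  (forall x, derivable psi x 1) -> bm1 R (derive1 psi) ->
  (forall x, ~ (- J%:R <= x < J%:R) -> psi x = 0) ->
  \int[leb R]_x (w (x, t) * derive1 psi x) = - \int[leb R]_x (g (x, t) * psi x)}.
Proof.
apply: ae_imply (dyad_limit_section bw mm_mono mm_inc J) => t H t0 wc psi dpsi [mpsi' [M psiM]] psi0.
have [_ [K wK]] := bw.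
have cpsi : continuous psi.
  by move=> x; apply: differentiable_continuous; apply/derivable1_diffP.
have lip x y : x <= y -> `|psi y - psi x| <= M * (y - x).
  by move=> xy; apply: derive1_lipschitz => //; exact: continuous_subspaceT.
have M0 : 0 <= M by apply: le_trans (psiM 0); exact: normr_ge0.
have bpsi : bm1 R psi.
  split; first exact: continuous_measurable_fun.
  exists (M * (2 * J%:R)) => x; have [xJ|/psi0 ->] := pselect (- J%:R <= x < J%:R); last first.
    by rewrite normr0 !mulr_ge0.
  move/andP: xJ => [x1 x2]; have := lip x J%:R (ltW x2).
  rewrite (psi0 J%:R) ?ltxx ?andbF // sub0r normrN => /le_trans; apply.
  by rewrite ler_wpM2l //; lra.
have fpsi : bfs (leb R) psi.
  split=> //; exists `[- J%:R, J%:R[%classic; split; [exact: measurable_itv|exact: lebesgue_itv_fin|].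
  by move=> x /= H'; apply: psi0 => Hx; apply: H'; rewrite /= in_itv.
have mwt (f : R -> R) : measurable_fun setT f -> bm1 R (fun x => w (f x, t)).
  move=> mf; have [mw _] := bw; split; last by exists K => x; exact: wK.
  have m1 : measurable_fun setT (fun x => w (x, t)) by exact: continuous_measurable_fun.
  exact: (measurableT_comp m1 mf).
have [_ c] := H _ bpsi.
(* Translation by one mesh commutes with [snap m], and the window disappears because [psi] vanishes
   outside it. *)
have E1 m : \int[leb R]_x (win J (x, t) * dyad m w (x, t) * psi x) =
    - \int[leb R]_x (w (snap m x, t) * ((psi (x - mesh R m) - psi x) / - mesh R m)).
  have h0 := mesh_gt0 R m; have hn : mesh R m != 0 by exact: lt0r_neq0.
  have ms := @measurable_snap R m.
  have b1 : bfs (leb R) (fun x => w (snap m x + mesh R m, t) * psi x).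
    by apply: bfsMl => //; apply: (mwt (fun x => snap m x + mesh R m)); exact: measurable_funD.
  have b2 : bfs (leb R) (fun x => w (snap m x, t) * psi x) := bfsMl (mwt _ ms) fpsi.
  have tr (a : R) f : bfs (leb R) f -> bfs (leb R) (fun x => f (x + a)) /\
      \int[leb R]_x f (x + a) = \int[leb R]_x f x.
    move=> bf; split; first exact: (@bfs_comp _ _ R (leb R) _ (measurable_translation a) (@lebesgue_translation R a)).
    exact: (@bfs_integral_comp _ _ R (leb R) _ (measurable_translation a) (@lebesgue_translation R a)).
  have b3 : bfs (leb R) (fun x => w (snap m x, t) * psi (x - mesh R m)) := bfsMl (mwt _ ms) (proj1 (tr (- mesh R m) _ fpsi)).
  have E3 : \int[leb R]_x (w (snap m x + mesh R m, t) * psi x) =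
      \int[leb R]_x (w (snap m x, t) * psi (x - mesh R m)).
    rewrite -(proj2 (tr (- mesh R m) _ b1)); apply: eq_Rintegral => x _.
    congr (w (_, _) * _); rewrite /snap -{2}[x](subrK (mesh R m)) cellD // intrD.
    by rewrite mulrDl mul1r.
  have -> : \int[leb R]_x (win J (x, t) * dyad m w (x, t) * psi x) =
      \int[leb R]_x ((mesh R m)^-1 * (w (snap m x + mesh R m, t) * psi x - w (snap m x, t) * psi x)).
    apply: eq_Rintegral => x _; rewrite indicE.
    have [xJ|xJ] := pselect (- J%:R <= x < J%:R); last by rewrite psi0 // !mulr0 subrr mulr0.
    rewrite mem_set; last by split; rewrite /= in_itv.
    by rewrite /dyad /=; ring.
  rewrite RintegralZl //; last exact: (bfs_integrable (bfsB b1 b2)).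
  rewrite RintegralB //; [|exact: bfs_integrable|exact: bfs_integrable].
  rewrite E3 -RintegralB //; [|exact: bfs_integrable|exact: bfs_integrable].
  rewrite -RintegralZl //; last exact: (bfs_integrable (bfsB b3 b2)).
  rewrite [X in _ = - X](_ : _ = -1 * \int[leb R]_x ((mesh R m)^-1 *
      (w (snap m x, t) * psi (x - mesh R m) - w (snap m x, t) * psi x))).
    by rewrite mulN1r opprK.
  rewrite -RintegralZl //; last exact: (bfs_integrable (bfsZ _ (bfsB b3 b2))).
  by apply: eq_Rintegral => x _; field.
have c2 : \int[leb R]_x (w (snap m x, t) * ((psi (x - mesh R m) - psi x) / - mesh R m)) @[m --> \oo] -->
    \int[leb R]_x (w (x, t) * derive1 psi x).
  apply: (@bfs_dct _ _ R (leb R) _ _ (`|K| * M) `[- (J%:R + 1), J%:R + 1[%classic).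
  - exact: measurable_itv.
  - exact: lebesgue_itv_fin.
  - move=> n; have [m1 _] := mwt _ (@measurable_snap R n).
    apply: measurable_funM; first exact: m1.
    apply: measurable_funM; last exact: measurable_cst.
    apply: continuous_measurable_fun => x; apply: cvgB; last exact: cpsi.
    apply: continuous_cvg; [exact: cpsi|apply: cvgB; [exact: cvg_id|exact: cvg_cst]].
  - move=> n x; have h0 := mesh_gt0 R n; rewrite normrM ler_pM //.
      by apply: le_trans (wK _) _; exact: ler_norm.
    rewrite normrM normfV normrN (gtr0_norm h0) ler_pdivrMr // distrC.
    by apply: le_trans (lip (x - mesh R n) x _) _; [lra|rewrite subKr].
  - move=> n x; rewrite /= in_itv /= => xJ; have := mesh_gt0 R n; have := mesh_le1 R n => h1 h0.
    rewrite !psi0 ?subrr ?mul0r ?mulr0 //; move=> /andP[x1 x2]; apply: xJ; apply/andP; split; lra.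
  - have m1 : measurable_fun setT (fun x => w (x, t)) by exact: continuous_measurable_fun.
    exact: measurable_funM m1 mpsi'.
  - apply: aeW => x; apply: cvgM.
      exact: (cvg_comp (fun n => snap n x) (fun y => w (y, t)) (@snap_cvg R x) (wc x)).
    apply: derive1_seq => //.
      by rewrite -[0]oppr0; apply: cvgN; exact: mesh_cvg0.
    by move=> n; rewrite oppr_eq0 lt0r_neq0 // mesh_gt0.
have c3 : \int[leb R]_x (win J (x, t) * dyad (mm j) w (x, t) * psi x) @[j --> \oo] -->
    - \int[leb R]_x (w (x, t) * derive1 psi x).
  under eq_fun do rewrite E1.
  apply: cvgN; have cm : mm j @[j --> \oo] --> \oo.
    move=> A [N _ NA]; exists N => // j /= Nj; apply: NA => /=.
    exact: leq_trans Nj (mm_ge j).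
  exact: (cvg_comp _ _ cm c2).
have -> : \int[leb R]_x (g (x, t) * psi x) = \int[leb R]_x (win J (x, t) * g (x, t) * psi x).
  apply: eq_Rintegral => x _; rewrite indicE.
  have [xJ|xJ] := pselect (- J%:R <= x < J%:R); last by rewrite psi0 // !mulr0.
  by rewrite mem_set ?mul1r //; split; rewrite /= in_itv.
by rewrite (cvg_unique _ c c3) // opprK.
Qed.

End weak_gradient.

(** * Test functions *)

Lemma cvg_pair_plane (R : realType) (I : Type) (F : set_system I) {FF : Filter F}
  (f g : I -> R) (x y : R) : f @ F --> x -> g @ F --> y ->
  (fun i => (f i, g i)) @ F --> ((x, y) : R * R).
Proof. by move=> fx gy; exact: (cvg_pair (G := nbhs x) (H := nbhs y) fx gy). Qed.

Section continuous_plane.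
Context (R : realType).
Implicit Types (F : R * R -> R).

Lemma continuous2_measurable F : continuous F -> mfun2 F.
Proof.
move=> cF; apply: (@measurable_fun_cvg _ _ R setT (fun n z => F (snap n z.1, snap n z.2))).
  move=> n; have h0 := mesh_gt0 R n.
  apply: (measurable_countable_factor (c := fun z : R * R => (cell (mesh R n) z.1, cell (mesh R n) z.2))
    (fun i => F (i.1%:~R * mesh R n, i.2%:~R * mesh R n))) => -[i j].
  have -> : (fun z : R * R => (cell (mesh R n) z.1, cell (mesh R n) z.2)) @^-1` [set (i, j)] =
      (cell (mesh R n) @^-1` [set i]) `*` (cell (mesh R n) @^-1` [set j]).
    by apply/seteqP; split=> z /= [-> ->].
  by apply: measurableX; rewrite cell_preimage //; exact: measurable_itv.
move=> [x t] _; apply: (cvg_comp (fun n => (snap n x, snap n t)) F _ (cF (x, t))).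
by apply: cvg_pair_plane; exact: snap_cvg.
Qed.

(** Compactness of a rectangle, with an ultrafilter finer than [\oo] in the role of a convergent
    subsequence. *)
Let bounded_pair_cvg (J K : R) (x t : nat -> R) : (forall n, `|x n| <= J) -> (forall n, `|t n| <= K) ->
  exists (U : set_system nat) (p q : R), [/\ ProperFilter U, \oo `<=` U, x @ U --> p & t @ U --> q].
Proof.
move=> xJ tK; have [U [UU ooU]] := ultraFilterLemma eventually_filter.
have PU : ProperFilter U by exact: ultra_proper.
have [p xp] := ultra_bounded_cvg UU xJ; have [q tq] := ultra_bounded_cvg UU tK.
by exists U, p, q.
Qed.

Lemma continuous2_bounded F (J K : R) : continuous F ->
  exists M, forall x t, `|x| <= J -> `|t| <= K -> `|F (x, t)| <= M.
Proof.
move=> cF; apply: contrapT => no.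
have : forall n : nat, exists z : R * R, [/\ `|z.1| <= J, `|z.2| <= K & n%:R < `|F z|].
  move=> n; apply: contrapT => H; apply: no; exists n%:R => x t xJ tK.
  by rewrite leNgt; apply/negP => Fn; apply: H; exists (x, t).
move=> /choice[z Hz].
have [U [p [q [PU ooU zp zq]]]] := @bounded_pair_cvg J K (fun n => (z n).1) (fun n => (z n).2)
  (fun n => let: And3 a _ _ := Hz n in a)
  (fun n => let: And3 _ a _ := Hz n in a).
have c : F (z n) @[n --> U] --> F (p, q).
  have -> : (fun n => F (z n)) = (fun n => F ((z n).1, (z n).2)).
    by apply/funext => n; case: (z n).
  exact: (cvg_comp _ F (cvg_pair_plane zp zq) (cF (p, q))).
have : U [set n | `|F (z n)| <= `|F (p, q)| + 1].
  have /cvgrPdist_le/(_ 1 ltr01) := c; apply: filterS => n /= H.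
  by have := ler_normB (F (p, q)) (F (p, q) - F (z n)); rewrite subKr; lra.
have : U [set n | `|F (p, q)| + 1 <= n%:R].
  apply: ooU; exists (Num.truncn (`|F (p, q)| + 1)).+1 => // n /= Hn.
  by apply/ltW; apply: lt_le_trans (truncnS_gt _) _; rewrite ler_nat.
move=> A /(filterI A) /filter_ex [n [/= a b]].
have [_ _] := Hz n; lra.
Qed.

Lemma continuous2_uniform F (J K : R) : continuous F -> forall e : R, 0 < e ->
  exists2 d, 0 < d & forall x y t, `|x| <= J -> `|t| <= K -> `|x - y| <= d ->
    `|F (x, t) - F (y, t)| <= e.
Proof.
move=> cF e e0; apply: contrapT => no.
have : forall n : nat, exists z : R * R * R, [/\ `|z.1.1| <= J, `|z.2| <= K,
    `|z.1.1 - z.1.2| <= mesh R n & e < `|F (z.1.1, z.2) - F (z.1.2, z.2)|].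
  move=> n; apply: contrapT => H; apply: no; exists (mesh R n); first exact: mesh_gt0.
  move=> x y t xJ tK xy; rewrite leNgt; apply/negP => Fe; apply: H.
  by exists (x, y, t).
move=> /choice[z Hz].
have [U [p [q [PU ooU zp zq]]]] := @bounded_pair_cvg J K (fun n => (z n).1.1) (fun n => (z n).2)
  (fun n => let: And4 a _ _ _ := Hz n in a)
  (fun n => let: And4 _ a _ _ := Hz n in a).
have m0 : mesh R n @[n --> U] --> 0.
  by apply: cvg_trans (@mesh_cvg0 R) => A HA; exact: ooU.
have yp : (z n).1.2 @[n --> U] --> p.
  have d0 : (z n).1.1 - (z n).1.2 @[n --> U] --> 0.
    apply/cvgrPdist_le => k k0; have /cvgrPdist_le/(_ k k0) := m0.
    apply: filterS => n /=; rewrite !sub0r !normrN ger0_norm ?(ltW (mesh_gt0 _ _)) // => H.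
    by have [_ _ + _] := Hz n; move/le_trans; apply.
  have : (z n).1.1 - ((z n).1.1 - (z n).1.2) @[n --> U] --> p - 0.
    exact: cvgB zp d0.
  rewrite subr0; have -> : (fun n => (z n).1.1 - ((z n).1.1 - (z n).1.2)) = (fun n => (z n).1.2).
    by apply/funext => n; rewrite subKr.
  exact.
have c1 : F ((z n).1.1, (z n).2) @[n --> U] --> F (p, q).
  exact: (cvg_comp _ F (cvg_pair_plane zp zq) (cF (p, q))).
have c2 : F ((z n).1.2, (z n).2) @[n --> U] --> F (p, q).
  exact: (cvg_comp _ F (cvg_pair_plane yp zq) (cF (p, q))).
have c3 : F ((z n).1.1, (z n).2) - F ((z n).1.2, (z n).2) @[n --> U] --> F (p, q) - F (p, q).
  exact: cvgB c1 c2.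
move: c3; rewrite subrr => /cvgrPdist_le/(_ e e0)/filter_ex[n].
by rewrite sub0r normrN; have [_ _ _] := Hz n; lra.
Qed.

End continuous_plane.

Section clamp.
Context (R : realType) (T : R).
Hypothesis T0 : 0 < T.

(** The projection of the time axis onto [[0, T]]. Composing with it extends a function continuous
    within the closed strip to one continuous on the whole plane. *)
Definition clamp (t : R) : R := Num.max 0 (Num.min t T).

Lemma clamp_in t : 0 <= clamp t <= T.
Proof. by rewrite /clamp le_max lexx /= ge_max ltW //= ge_min lexx orbT. Qed.

Lemma clamp_id t : 0 <= t <= T -> clamp t = t.
Proof. by move=> /andP[t0 tT]; rewrite /clamp min_l // max_r. Qed.

Lemma clamp_le s t : s <= t -> clamp s <= clamp t.
Proof.
by move=> st; rewrite /clamp ge_max !le_max lexx /= le_min !ge_min st lexx !orbT.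
Qed.

Lemma clamp_lip s t : s <= t -> clamp t - clamp s <= t - s.
Proof. by rewrite /clamp /Num.max /Num.min; do !case: ifP; lra. Qed.

Lemma clamp_cont : continuous clamp.
Proof.
move=> t; apply/cvgrPdist_le => e e0; near=> s.
have ts : `|t - s| <= e.
  by near: s; exact: (@cvgr_dist_le _ _ _ _ (nbhs_filter t) id t cvg_id).
apply: le_trans ts; have [st|/ltW st] := leP s t.
  by rewrite !ger0_norm ?subr_ge0 ?clamp_le // clamp_lip.
by rewrite !ler0_norm ?subr_le0 ?clamp_le // !opprB clamp_lip.
Unshelve. all: by end_near. Qed.

Lemma strip_extend (f : R * R -> R) : {within strip T, continuous f} ->
  continuous (fun z : R * R => f (z.1, clamp z.2)).
Proof.
move=> cf z; have sz : forall y : R * R, strip T (y.1, clamp y.2).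
  by move=> y; split=> //=; rewrite in_itv /=; exact: clamp_in.
have /subspace_continuousP/(_ (z.1, clamp z.2) (sz z)) := cf.
apply: (cvg_comp (fun y : R * R => (y.1, clamp y.2)) f).
have c : (fun y : R * R => (y.1, clamp y.2)) @ z --> (z.1, clamp z.2).
  apply: cvg_pair_plane; first exact: cvg_fst.
  have s2 : snd @ z --> z.2 by exact: cvg_snd.
  exact: (cvg_comp snd clamp s2 (@clamp_cont z.2)).
move=> A HA; have H : nbhs z (fun y : R * R => strip T (y.1, clamp y.2) -> A (y.1, clamp y.2)).
  exact: (c _ HA).
have : nbhs z (fun y : R * R => A (y.1, clamp y.2)) by apply: filterS H => y; apply; exact: sz.
exact.
Qed.

End clamp.

Section test_function.
Context (R : realType) (T : R) (Psi : R * R -> R).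
Hypothesis T0 : 0 < T.
Hypothesis FTPsi : FT T Psi.
Notation q := (\1_(QT T) : R * R -> R).

Lemma QTE z : q z = if 0 < z.2 < T then 1 else 0.
Proof.
case: z => x t; rewrite indicE in_setX in_setT mem_setE in_itv /=.
by case: ifP.
Qed.

Lemma bm_QT : bm2 R q.
Proof.
by apply: bm_indic; apply: measurableX; [exact: measurableT|exact: measurable_itv].
Qed.

Lemma FT_support : exists J : nat, forall z, strip T z -> J%:R <= `|z.1| -> Psi z = 0.
Proof.
have [_ _ [J J0 sup]] := FTPsi; exists (Num.truncn J).+1 => z sz Jz.
apply/eqP; apply: contraT => nz; have /sup[] : closure [set z | strip T z /\ Psi z != 0] z.
  exact: (@subset_closure _ [set z | strip T z /\ Psi z != 0]).
rewrite /= in_itv /= -ler_norml => zJ _.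
by have := truncnS_gt J; lra.
Qed.

Lemma FT_final x : Psi (x, T) = 0. Proof. by have [_ ->] := FTPsi. Qed.

Variable J : nat.
Hypothesis supJ : forall z, strip T z -> J%:R <= `|z.1| -> Psi z = 0.

Let stripI (x t : R) : 0 <= t <= T -> strip T (x, t).
Proof. by move=> tT; split=> //=; rewrite in_itv. Qed.

Let QTI (x t : R) : 0 < t < T -> QT T (x, t).
Proof. by move=> tT; split=> //=; rewrite in_itv. Qed.

Let derivx (x t : R) : 0 < t < T -> derivable (fun y => Psi (y, t)) x 1.
Proof. by move=> tT; have [[_ /(_ x t (QTI x tT))[]]] := FTPsi. Qed.

Let derivt (x t : R) : 0 < t < T -> derivable (fun s => Psi (x, s)) t 1.
Proof. by move=> tT; have [[_ /(_ x t (QTI x tT))[]]] := FTPsi. Qed.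

(** Frozen at [Psi (x, 0)] before time 0 and at [Psi (x, T) = 0] after [T], this extension is
    Lipschitz in time, whereas extension by 0 jumps at time 0. *)
Definition time_clamp z := Psi (z.1, clamp T z.2).

Let cont_clamp : continuous time_clamp.
Proof. by have [[c _ _ _] _ _] := FTPsi; exact: strip_extend. Qed.

Lemma time_clamp_support z : J%:R <= `|z.1| -> time_clamp z = 0.
Proof. by move=> Jz; apply: supJ => //; apply: stripI; exact: clamp_in. Qed.

Let clamp_id' (t : R) : 0 < t < T -> clamp T t = t.
Proof. by move=> /andP[? ?]; rewrite clamp_id // !ltW. Qed.

Let bm_restrict (f F : R * R -> R) : continuous F ->
  (forall x t : R, 0 < t < T -> F (x, t) = f (x, t)) ->
  (forall x t : R, J%:R < `|x| -> 0 < t < T -> f (x, t) = 0) ->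
  exists M : R, bm2 R (fun z => q z * f z) /\ forall z, 0 < z.2 < T -> `|f z| <= M.
Proof.
move=> cF Ff f0; have [M HM] := @continuous2_bounded R F J%:R T cF.
have fM z : 0 < z.2 < T -> `|f z| <= Num.max 0 M.
  case: z => x t /= tT; rewrite le_max; have [Jx|xJ] := ltP J%:R `|x|.
    by rewrite f0 // normr0 lexx.
  rewrite -Ff // HM ?orbT //; move/andP: tT => [t0 tT].
  by rewrite gtr0_norm // ltW.
exists (Num.max 0 M); split=> //.
have -> : (fun z => q z * f z) = (fun z => q z * F z).
  by apply/funext => -[x t]; rewrite QTE /=; case: ifP => [tT|_]; [rewrite Ff|rewrite !mul0r].
split; first by apply: measurable_funM; [have [m _] := bm_QT; exact: m|exact: continuous2_measurable].
exists (Num.max 0 M) => -[x t]; rewrite QTE /=; case: ifP => [tT|_].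
  by rewrite mul1r Ff // fM.
by rewrite mul0r normr0 le_max lexx.
Qed.

Let ext (f : R * R -> R) : (exists g : R * R -> R, {within strip T, continuous g} /\
    forall z, QT T z -> g z = f z) ->
  exists F : R * R -> R, continuous F /\ forall x t : R, 0 < t < T -> F (x, t) = f (x, t).
Proof.
move=> [g [cg gf]]; exists (fun z => g (z.1, clamp T z.2)); split; first exact: strip_extend.
by move=> x t tT /=; rewrite clamp_id' // gf //; exact: QTI.
Qed.

Let dx_out (x t : R) : J%:R < `|x| -> 0 < t < T -> dx Psi (x, t) = 0.
Proof.
move=> xJ tT; have h0 n : mesh R n != 0 by rewrite lt0r_neq0 // mesh_gt0.
have := derive1_seq (@derivx x _ tT) (@mesh_cvg0 R) h0.
rewrite -[derive1 _ _]/(dx Psi (x, t)) => c; apply: (cvg_unique _ c) => //.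
have d0 : 0 < `|x| - J%:R by lra.
have [N HN] := mesh_small d0; apply: cvg_near_cst; exists N => // n /= Nn.
have sT y : strip T (y, t) by apply: stripI; move/andP: tT => [? ?]; rewrite !ltW.
rewrite !supJ ?subrr ?mul0r //=; first exact: ltW.
have := ler_normB (x + mesh R n) (mesh R n); rewrite addrK (gtr0_norm (mesh_gt0 R n)).
by have := HN n Nn; lra.
Qed.

Let dt_out (x t : R) : J%:R < `|x| -> 0 < t < T -> dt Psi (x, t) = 0.
Proof.
move=> xJ tT; have h0 n : mesh R n != 0 by rewrite lt0r_neq0 // mesh_gt0.
have := derive1_seq (@derivt x _ tT) (@mesh_cvg0 R) h0.
rewrite -[derive1 _ _]/(dt Psi (x, t)) => c; apply: (cvg_unique _ c) => //.
move/andP: tT => [t0 tT].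
have d0 : 0 < T - t by lra.
have [N HN] := mesh_small d0; apply: cvg_near_cst; exists N => // n /= Nn.
have := HN n Nn; have := mesh_gt0 R n => m0 m1.
by rewrite !supJ ?subrr ?mul0r //=; try exact: ltW; apply: stripI; apply/andP; split; lra.
Qed.

Lemma FT_bm : bm2 R (fun z => q z * Psi z).
Proof.
have out (x t : R) : J%:R < `|x| -> 0 < t < T -> Psi (x, t) = 0.
  move=> Jx /andP[t0 tT]; apply: supJ; last exact: ltW.
  by apply: stripI; rewrite !ltW.
have eqP' (x t : R) : 0 < t < T -> time_clamp (x, t) = Psi (x, t).
  by move=> tT; rewrite /time_clamp /= clamp_id'.
by have [M []] := bm_restrict cont_clamp eqP' out.
Qed.

Lemma FT_dx_bm : bm2 R (fun z => q z * dx Psi z).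
Proof.
have [[_ _ ex _] _ _] := FTPsi; have [F [cF Fx]] := ext ex.
by have [M []] := bm_restrict cF Fx dx_out.
Qed.

Lemma FT_dt_bm : exists M : R, bm2 R (fun z => q z * dt Psi z) /\
  forall z, 0 < z.2 < T -> `|dt Psi z| <= M.
Proof.
have [[_ _ _ et] _ _] := FTPsi; have [F [cF Ft]] := ext et.
exact: bm_restrict cF Ft dt_out.
Qed.

Lemma FT_support_out z : J%:R <= `|z.1| -> q z * Psi z = 0.
Proof.
case: z => x t /= Jx; rewrite QTE /=; case: ifP => [/andP[t0 tT]|]; last by rewrite mul0r.
by rewrite supJ ?mulr0 //; apply: stripI; rewrite !ltW.
Qed.

Lemma FT_dx_out z : J%:R < `|z.1| -> q z * dx Psi z = 0.
Proof.
by case: z => x t /= Jx; rewrite QTE /=; case: ifP => [tT|]; rewrite ?mul0r // dx_out // mulr0.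
Qed.

Lemma FT_dt_out z : J%:R < `|z.1| -> q z * dt Psi z = 0.
Proof.
by case: z => x t /= Jx; rewrite QTE /=; case: ifP => [tT|]; rewrite ?mul0r // dt_out // mulr0.
Qed.

Let window_support (f : R * R -> R) : (forall z, J%:R < `|z.1| -> q z * f z = 0) ->
  forall z, ~ window J.+1 T z -> q z * f z = 0.
Proof.
move=> f0 [x t] zJ; have [xJ|xJ] := ltP J%:R `|x|; first exact: f0.
rewrite QTE /=; case: ifP => [tT|_]; last by rewrite mul0r.
exfalso; apply: zJ; split; rewrite /= in_itv //= -natr1.
by move: xJ; rewrite ler_norml => /andP[x1 x2]; apply/andP; split; lra.
Qed.

Lemma FT_dx_window z : ~ window J.+1 T z -> q z * dx Psi z = 0.
Proof. exact: window_support FT_dx_out z. Qed.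

Lemma FT_bfs : bfs (leb2 R) (fun z => q z * Psi z).
Proof.
split; first exact: FT_bm.
exists (window J.+1 T); split; [exact: measurable_window|exact: window_fin|].
by apply: window_support => z zJ; apply: FT_support_out; exact: ltW.
Qed.

Lemma FT_dt_bfs : bfs (leb2 R) (fun z => q z * dt Psi z).
Proof.
split; first by have [M []] := FT_dt_bm.
exists (window J.+1 T); split; [exact: measurable_window|exact: window_fin|].
exact: window_support FT_dt_out.
Qed.

(** Difference quotient and derivative of the test function are both uniformly close to a function
    constant on coarse cells, the kind on which the martingale property acts. The quotient is a
    derivative at an intermediate point, and the continuous extension of [dx Psi] is uniformly
    continuous. *)
Lemma FT_dx_uniform e : 0 < e -> exists N : nat, forall n m, (N <= n)%N -> (N <= m)%N -> forall z,
  `|(q (z.1 + mesh R n, z.2) * Psi (z.1 + mesh R n, z.2) - q z * Psi z) / mesh R n -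
    q (snap m z.1, z.2) * dx Psi (snap m z.1, z.2)| <= e /\
  `|q z * dx Psi z - q (snap m z.1, z.2) * dx Psi (snap m z.1, z.2)| <= e.
Proof.
move=> e0; have [[_ _ ex _] _ _] := FTPsi; have [F [cF Fx]] := ext ex.
have [d d0 Hd] := @continuous2_uniform R F (J%:R + 4) T cF e e0.
have d20 : 0 < d / 2 by rewrite divr_gt0.
have [N HN] := mesh_small d20; exists N => n m Nn Nm -[x t]; rewrite !QTE /=.
have hn0 := mesh_gt0 R n; have hn1 := mesh_le1 R n; have hm1 := mesh_le1 R m.
have dn := HN n Nn; have dm := HN m Nm; have /andP[s1 s2] := snap_itv m x.
case: ifP => [tT|_]; last first.
  by split; rewrite !mul0r ?subrr ?mul0r ?subrr normr0 ltW.
rewrite !mul1r; have nT : `|t| <= T by move/andP: tT => [? ?]; rewrite gtr0_norm // ltW.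
(* Up to [J + 3] the base points have modulus at most [J + 4], where [Hd] applies; beyond, every
   point involved is within distance 2 of [x] and stays outside the support. *)
have [xJ|xJ] := leP `|x| (J%:R + 3).
  split; last first.
    by rewrite -!Fx //; apply: Hd => //; [lra|rewrite ler_norml; apply/andP; split; lra].
  have xh : x <= x + mesh R n by rewrite lerDl ltW.
  have dv y : x < y < x + mesh R n -> derivable (fun y : R => Psi (y, t)) y 1.
    by move=> _; exact: derivx.
  have cv : {within `[x, x + mesh R n], continuous (fun y : R => Psi (y, t))}.
    by apply: continuous_subspaceT => y; apply/differentiable_continuous/derivable1_diffP; exact: derivx.
  have [c /andP[c1 c2] [E _]] := derive1_increment xh dv cv.
  rewrite E ltrDl hn0 [x + mesh R n]addrC addrK mulfK ?lt0r_neq0 //.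
  rewrite -[derive1 _ _]/(dx Psi (c, t)) -!Fx //; apply: Hd => //.
    have := ler_normD x (c - x); rewrite [x + _]addrC subrK.
    rewrite (ger0_norm (_ : 0 <= c - x)); last by lra.
    by lra.
  by rewrite ler_norml; apply/andP; split; lra.
have sT y : strip T (y, t) by apply: stripI; move/andP: tT => [? ?]; rewrite !ltW.
have far y : `|y - x| <= 2 -> J%:R < `|y|.
  by have := ler_normB y (y - x); rewrite subKr; lra.
have f1 : J%:R < `|snap m x| by apply: far; rewrite ler_norml; apply/andP; split; lra.
have f2 : J%:R < `|x + mesh R n| by apply: far; rewrite ler_norml; apply/andP; split; lra.
have f3 : J%:R < `|x| by lra.
rewrite !dx_out // (supJ (sT x)) ?(ltW f3) // (supJ (sT (x + mesh R n))) ?(ltW f2) //.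
by split; rewrite ?subrr ?mul0r ?subrr normr0 ltW.
Qed.

Lemma time_clamp_bm : bm2 R time_clamp.
Proof.
split; first exact: continuous2_measurable cont_clamp.
have [M HM] := @continuous2_bounded R time_clamp J%:R T cont_clamp.
exists (Num.max 0 M) => -[x t]; rewrite le_max.
have [Jx|xJ] := leP J%:R `|x|; first by rewrite time_clamp_support // normr0 lexx.
have -> : time_clamp (x, t) = time_clamp (x, clamp T t).
  by rewrite /time_clamp /= [in RHS]clamp_id // clamp_in.
rewrite HM ?orbT ?(ltW xJ) //.
by have /andP[t1 t2] := clamp_in T0 t; rewrite ger0_norm.
Qed.

Let time_clamp_near (x t : R) : 0 < t < T -> {near t, (fun s => time_clamp (x, s)) =1 (fun s => Psi (x, s))}.
Proof.
move=> tT; have : t \in `]0, T[ by rewrite in_itv.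
move=> /near_in_itvoo; apply: filterS => s; rewrite in_itv /= => sT.
by rewrite /time_clamp /= clamp_id'.
Qed.

Lemma time_clamp_derive (x t : R) : 0 < t < T ->
  derivable (fun s => time_clamp (x, s)) t 1 /\ derive1 (fun s => time_clamp (x, s)) t = dt Psi (x, t).
Proof.
move=> tT; split.
  by apply: (near_eq_derivable _ (@derivt x _ tT)) => //; apply: filterS (time_clamp_near x tT) => s ->.
rewrite /dt /= !derive1E; apply: near_eq_derive => //; exact: time_clamp_near.
Qed.

Lemma time_clamp_lip : exists M, 0 <= M /\ forall x s t : R, s <= t ->
  `|time_clamp (x, t) - time_clamp (x, s)| <= M * (t - s).
Proof.
have [M [_ HM]] := FT_dt_bm; exists (Num.max 0 M); rewrite le_max lexx; split=> // x s t st.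
pose f y := time_clamp (x, y).
have fE y : f y = f (clamp T y) by rewrite /f /time_clamp /= [in RHS]clamp_id // clamp_in.
rewrite -/(f t) -/(f s) (fE t) (fE s).
have /andP[a1 a2] := clamp_in T0 s; have /andP[b1 b2] := clamp_in T0 t.
have M0 : 0 <= Num.max 0 M by rewrite le_max lexx.
apply: (@le_trans _ _ (Num.max 0 M * (clamp T t - clamp T s))); last first.
  by rewrite ler_wpM2l // clamp_lip.
apply: derive1_lipschitz; first exact: clamp_le.
- move=> y /andP[y1 y2]; have yT : 0 < y < T by apply/andP; split; lra.
  by have [] := time_clamp_derive x yT.
- apply: continuous_subspaceT => y.
  have p : (fun y : R => (x, y)) @ y --> (x, y) by apply: cvg_pair_plane; [exact: cvg_cst|exact: cvg_id].
  exact: (cvg_comp (fun y : R => (x, y)) time_clamp p (@cont_clamp (x, y))).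
- move=> y /andP[y1 y2]; have yT : 0 < y < T by apply/andP; split; lra.
  by have [_ ->] := time_clamp_derive x yT; rewrite le_max HM ?orbT.
Qed.

End test_function.

(** * Passage to the limit in the flux *)

Section integrable_arith.
Context d (X : measurableType d) (R : realType) (mu : {measure set X -> \bar R}).
Implicit Types f g : X -> R.

Lemma integrable_scale f (c : R) : mu.-integrable setT (EFin \o f) ->
  mu.-integrable setT (EFin \o (fun z => c * f z)).
Proof.
move=> intf; rewrite (_ : EFin \o _ = fun z => (c%:E * (EFin \o f) z)%E); last first.
  by apply/funext => z /=; rewrite EFinM.
exact: integrableZl.
Qed.

Lemma integrable_plus f g : mu.-integrable setT (EFin \o f) ->
  mu.-integrable setT (EFin \o g) -> mu.-integrable setT (EFin \o (fun z => f z + g z)).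
Proof.
move=> intf intg; rewrite (_ : EFin \o _ = ((EFin \o f) \+ (EFin \o g))%E).
  exact: integrableD.
by apply/funext => z /=; rewrite EFinD.
Qed.

End integrable_arith.

Section window_test.
Context (R : realType) (T : R) (K : nat).
Notation win := (\1_(window K T) : R * R -> R).

Lemma window_in z : window K T z -> win z = 1.
Proof. by move=> zK; rewrite indicE mem_set. Qed.

Lemma window_out z : ~ window K T z -> win z = 0.
Proof. by move=> zK; rewrite indicE memNset. Qed.

Lemma window_test_integrable (f p : R * R -> R) : mfun2 f ->
  (leb2 R).-integrable setT (EFin \o (fun z => win z * f z ^+ 2)) ->
  bm2 R p -> (forall z, ~ window K T z -> p z = 0) ->
  (leb2 R).-integrable setT (EFin \o (fun z => f z * p z)).
Proof.
move=> mf intf [mp [c pc]] p0.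
have iw : (leb2 R).-integrable setT (EFin \o win).
  by apply: (@bfs_integrable _ _ R (leb2 R)); exact: bfs_window.
have c0 : 0 <= c by apply: le_trans (pc (0, 0)).
have ib : (leb2 R).-integrable setT (EFin \o (fun z => c * (win z + win z * f z ^+ 2))).
  by apply: integrable_scale; apply: integrable_plus.
apply: le_integrable ib => //.
  by apply/measurable_EFinP; exact: measurable_funM.
move=> z _ /=; rewrite lee_fin; have [zK|zK] := pselect (window K T z); last first.
  by rewrite p0 // mulr0 normr0.
rewrite window_in // mul1r normrM mulrC [leRHS]ger0_norm; last first.
  by rewrite mulr_ge0 // addr_ge0 // sqr_ge0.
apply: ler_pM => //; rewrite -[f z ^+ 2]real_normK ?num_real //.
by have := sqr_ge0 (`|f z| - 1); have := normr_ge0 (f z); lra.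
Qed.

(** From [|f| <= 1 + f^2]: the error depends on [f] only through its energy on the window, hence is
    uniform along the approximations. *)
Lemma window_test_close (f p1 p2 : R * R -> R) (e C : R) : mfun2 f ->
  (leb2 R).-integrable setT (EFin \o (fun z => win z * f z ^+ 2)) ->
  \int[leb2 R]_z (win z * f z ^+ 2) <= C ->
  bm2 R p1 -> bm2 R p2 -> (forall z, ~ window K T z -> p1 z = 0) ->
  (forall z, ~ window K T z -> p2 z = 0) -> 0 <= e -> (forall z, `|p1 z - p2 z| <= e) ->
  `|\int[leb2 R]_z (f z * p1 z) - \int[leb2 R]_z (f z * p2 z)| <=
    e * (\int[leb2 R]_z win z + C).
Proof.
move=> mf intf fC b1 b2 o1 o2 e0 pe.
have i1 := window_test_integrable mf intf b1 o1.
have i2 := window_test_integrable mf intf b2 o2.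
have bd : bm2 R (fun z => p1 z - p2 z) by exact: bmB.
have od z : ~ window K T z -> p1 z - p2 z = 0 by move=> zK; rewrite o1 // o2 // subrr.
have i12 := window_test_integrable mf intf bd od.
rewrite -RintegralB //; under eq_Rintegral do rewrite -mulrBr.
apply: le_trans (le_normr_Rintegral _ i12) _ => //.
have iw : (leb2 R).-integrable setT (EFin \o win).
  by apply: (@bfs_integrable _ _ R (leb2 R)); exact: bfs_window.
have iS : (leb2 R).-integrable setT (EFin \o (fun z => win z + win z * f z ^+ 2)).
  exact: integrable_plus.
apply: (@le_trans _ _ (\int[leb2 R]_z (e * (win z + win z * f z ^+ 2)))).
  apply: le_Rintegral => //.
  - exact: integrable_norm i12.
  - exact: integrable_scale.
  move=> z _; have [zK|zK] := pselect (window K T z); last first.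
    by rewrite od // mulr0 normr0 window_out // mul0r addr0 mulr0.
  rewrite window_in // mul1r normrM mulrC.
  apply: ler_pM => //; rewrite -[f z ^+ 2]real_normK ?num_real //.
  by have := sqr_ge0 (`|f z| - 1); have := normr_ge0 (f z); lra.
by rewrite RintegralZl // ler_wpM2l // RintegralD // lerD2l.
Qed.

End window_test.

Section strip_limit.
Context (R : realType) (T K : R) (f_ : nat -> R * R -> R) (f : R * R -> R).
Hypotheses (mf : forall n, mfun2 (f_ n)) (fK : forall n z, `|f_ n z| <= K).
Hypothesis f_cvg : forall z, 0 < z.2 < T -> f_ n z @[n --> \oo] --> f z.
Hypothesis f_out : forall z, ~~ (0 < z.2 < T) -> f z = 0.

Lemma strip_limit_le z : `|f z| <= K.
Proof.
have K0 : 0 <= K by apply: le_trans (fK 0%N z).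
have [zT|/f_out ->] := boolP (0 < z.2 < T); last by rewrite normr0.
have c : `|f_ n z| @[n --> \oo] --> `|f z| by apply: cvg_norm; exact: f_cvg.
have cv : cvgn (fun n => `|f_ n z|) by apply/cvg_ex; exists `|f z|.
rewrite -(cvg_lim (@Rhausdorff R) c); apply: limr_le => //.
by apply: nearW => n; exact: fK.
Qed.

Lemma bm_strip_limit : bm2 R f.
Proof.
split; last by exists K; exact: strip_limit_le.
apply: (@measurable_fun_cvg _ _ R setT (fun n z => (\1_(QT T) : R * R -> R) z * f_ n z)).
  by move=> n; apply: measurable_funM; [have [m _] := bm_QT T; exact: m|exact: mf].
move=> z _; have [zT|zT] := boolP (0 < z.2 < T).
  have -> : (fun n => (\1_(QT T) : R * R -> R) z * f_ n z) = f_ ^~ z.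
    by apply/funext => n; rewrite QTE zT mul1r.
  exact: f_cvg.
have -> : (fun n => (\1_(QT T) : R * R -> R) z * f_ n z) = fun=> 0.
  by apply/funext => n; rewrite QTE (negbTE zT) mul0r.
by rewrite f_out //; exact: cvg_cst.
Qed.

Lemma dyad_strip_cvg m z : 0 < z.2 < T -> dyad m (f_ n) z @[n --> \oo] --> dyad m f z.
Proof.
by move=> zT; rewrite /dyad; apply: cvgM; [apply: cvgB; exact: f_cvg|exact: cvg_cst].
Qed.

Lemma dyad_bound m (g : R * R -> R) z : (forall y, `|g y| <= K) ->
  `|dyad m g z| <= (K + K) / mesh R m.
Proof.
move=> gK; rewrite /dyad normrM normfV (gtr0_norm (mesh_gt0 R m)).
rewrite ler_wpM2r ?invr_ge0 ?(ltW (mesh_gt0 R m)) //.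
by apply: le_trans (ler_normB _ _) _; rewrite lerD.
Qed.

Lemma strip_dct_window (J : nat) (F_ : nat -> R * R -> R) (F : R * R -> R) M :
  (forall n, mfun2 (F_ n)) -> (forall n z, `|F_ n z| <= M) ->
  (forall n z, ~ window J T z -> F_ n z = 0) -> mfun2 F ->
  (forall z, ~ window J T z -> F z = 0) ->
  (forall z, 0 < z.2 < T -> F_ n z @[n --> \oo] --> F z) ->
  \int[leb2 R]_z F_ n z @[n --> \oo] --> \int[leb2 R]_z F z.
Proof.
move=> mF FM F0 mG G0 cF.
apply: (@bfs_dct _ _ R (leb2 R) F_ F M (window J T)) => //.
- exact: measurable_window.
- exact: window_fin.
apply: aeW => z; have [zJ|zJ] := pselect (window J T z).
  by apply: cF; case: zJ => _; rewrite /= in_itv.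
have -> : F_ ^~ z = fun=> 0 by apply/funext => n; exact: F0.
by rewrite G0 //; exact: cvg_cst.
Qed.

End strip_limit.

(** * The limit of one species and its energy *)

Section species.
Context (R : realType) (phi : R -> R) (lam D B L S : R) (a0 : R -> R)
  (a s : nat -> nat -> int -> R).
Hypothesis sc : scheme phi lam D B L S a0 a s.
Hypothesis phi_cont : continuous phi.
Variables (T : R) (sigma : nat -> nat) (u : R * R -> R).
Hypotheses (T0 : 0 < T) (sigma_ge : forall j, (j <= sigma j)%N).
Hypothesis u_cvg : forall z, 0 < z.2 < T -> grid_state lam a (sigma j) z @[j --> \oo] --> u z.
Hypothesis u_out : forall z, ~~ (0 < z.2 < T) -> u z = 0.
Notation h := (mesh R).
Notation tau n := (lam * mesh R n ^+ 2).
Notation win J := (\1_(window J T) : R * R -> R).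
Notation q := (\1_(QT T) : R * R -> R).

Let v j z := grid_state lam a (sigma j) z.
Let w z := phi (u z).
Let wn j z := phi (v j z).

Let phi00 : phi 0 = 0. Proof. exact: scheme_phi0 sc. Qed.

Lemma grid_state_bnd n z : 0 <= grid_state lam a n z <= B.
Proof. exact: scheme_bnd sc n _ _. Qed.

Let vB j z : `|v j z| <= B.
Proof. by have /andP[? ?] := grid_state_bnd (sigma j) z; rewrite ger0_norm. Qed.

Let mv j : mfun2 (v j). Proof. by have [m _] := bm_grid sc (sigma j); exact: m. Qed.

Lemma bm_species : bm2 R u.
Proof. exact: bm_strip_limit mv vB u_cvg u_out. Qed.

Let mwn j : mfun2 (wn j). Proof. by have [m _] := bm_flux sc phi_cont (sigma j); exact: m. Qed.
Let wnB j z : `|wn j z| <= L * B. Proof. exact: (phi_bnd sc (grid_state_bnd _ _)). Qed.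
Let wn_cvg z : 0 < z.2 < T -> wn j z @[j --> \oo] --> w z.
Proof. by move=> zT; apply: continuous_cvg; [exact: phi_cont|exact: u_cvg]. Qed.
Let w_out z : ~~ (0 < z.2 < T) -> w z = 0.
Proof. by move=> zT; rewrite /w u_out. Qed.

Lemma bm_species_flux : bm2 R w.
Proof. exact: bm_strip_limit mwn wnB wn_cvg w_out. Qed.

(** The bound passes to the limit at a fixed mesh [m]: there dominated convergence applies, and the
    energy of an approximation at mesh [m] is at most that at its own finer mesh [sigma j], which
    the scheme controls. *)
Lemma species_energy (J : nat) : exists C, 0 <= C /\
  (forall n, (J <= n)%N -> \int[leb2 R]_z (win J z * dyad n (fun y => phi (grid_state lam a n y)) z ^+ 2) <= C) /\
  (forall m, \int[leb2 R]_z (win J z * dyad m w z ^+ 2) <= C).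
Proof.
have [C [C0 HC]] := dyad_energy sc phi_cont J T0; exists C; split=> //; split=> // m.
have bdn j : bm2 R (dyad m (wn j)) by apply: bm_dyad; exact: bm_flux sc phi_cont _.
have bd : bm2 R (dyad m w) by apply: bm_dyad; exact: bm_species_flux.
have mwin : mfun2 (win J) by have [[mm _] _] := @bfs_window R T J; exact: mm.
have c : \int[leb2 R]_z (win J z * dyad m (wn j) z ^+ 2) @[j --> \oo] -->
    \int[leb2 R]_z (win J z * dyad m w z ^+ 2).
  apply: (@strip_dct_window R T J _ _ (((L * B + L * B) / h m) ^+ 2)).
  - move=> j; apply: measurable_funM => //; have [mj _] := bdn j.
    by under eq_fun do rewrite expr2; exact: measurable_funM.
  - move=> j z; have K0 : 0 <= ((L * B + L * B) / h m) ^+ 2 by rewrite sqr_ge0.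
    have [zJ|zJ] := pselect (window J T z); last by rewrite window_out // mul0r normr0.
    rewrite window_in // mul1r normrX lerXn2r ?nnegrE //.
      by apply: le_trans (dyad_bound m z (wnB j)).
    exact: (dyad_bound m z (wnB j)).
  - by move=> j z zJ; rewrite window_out // mul0r.
  - apply: measurable_funM => //; have [mj _] := bd.
    by under eq_fun do rewrite expr2; exact: measurable_funM.
  - by move=> z zJ; rewrite window_out // mul0r.
  - move=> z zT; apply: cvgM; first exact: cvg_cst.
    have cd := @dyad_strip_cvg R T wn w wn_cvg m z zT.
    exact: (cvgM cd cd).
have cv : cvgn (fun j => \int[leb2 R]_z (win J z * dyad m (wn j) z ^+ 2)).
  by apply/cvg_ex; eexists; exact: c.
rewrite -(cvg_lim (@Rhausdorff R) c); apply: limr_le => //.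
exists (maxn m J) => // j /=; rewrite geq_max => /andP[mj Jj].
apply: le_trans (HC (sigma j) (leq_trans Jj (sigma_ge j))).
apply: dyad_energy_mono; first exact: bm_flux sc phi_cont _.
exact: leq_trans mj (sigma_ge j).
Qed.

End species.

Section flux_limit.
Context (R : realType) (T Mb : R) (sigma : nat -> nat) (wn : nat -> R * R -> R)
  (w : R * R -> R) (mm : nat -> nat) (Psi : R * R -> R) (J : nat).
Notation win J := (\1_(window J T) : R * R -> R).
Notation q := (\1_(QT T) : R * R -> R).
Notation h := (mesh R).
Hypotheses (T0 : 0 < T) (sigma_ge : forall j, (j <= sigma j)%N).
Hypotheses (bwn : forall j, bm2 R (wn j)) (wnB : forall j z, `|wn j z| <= Mb) (bw : bm2 R w).
Hypothesis wn_cvg : forall z, 0 < z.2 < T -> wn j z @[j --> \oo] --> w z.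
Hypothesis energy : forall K : nat, exists C,
  (forall j, (K <= j)%N -> \int[leb2 R]_z (win K z * dyad (sigma j) (wn j) z ^+ 2) <= C) /\
  (forall m, \int[leb2 R]_z (win K z * dyad m w z ^+ 2) <= C).
Hypotheses (mm_ge : forall j, (j <= mm j)%N) (mm_mono : forall i j, (i <= j)%N -> (mm i <= mm j)%N)
  (mm_inc : forall J n, (mm J <= n)%N ->
    \int[leb2 R]_z (win J z * (dyad n w z - dyad (mm J) w z) ^+ 2) <= mesh R J ^+ 2).
Hypothesis FTPsi : FT T Psi.
Hypothesis supJ : forall z, strip T z -> J%:R <= `|z.1| -> Psi z = 0.
Notation g := (dyad_limit w mm).
Let P z := q z * Psi z.
Let DP n z := (P (z.1 + h n, z.2) - P z) / h n.
Let K := J.+2.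
Let theta m z := q (snap m z.1, z.2) * dx Psi (snap m z.1, z.2).

Let outK (z : R * R) : ~ window K T z -> 0 < z.2 < T -> J%:R + 2 <= `|z.1|.
Proof.
move=> zK zT; rewrite leNgt; apply/negP => zJ; apply: zK; split=> /=; last by rewrite in_itv.
rewrite in_itv /=; move: zJ; rewrite ltr_norml /K -[J.+2]addn2 natrD => /andP[z1 z2].
by apply/andP; split; lra.
Qed.

Let qE z : ~~ (0 < z.2 < T) -> q z = 0.
Proof. by move=> zT; rewrite QTE (negbTE zT). Qed.

Lemma test_quotient_out n z : ~ window K T z -> DP n z = 0.
Proof.
move=> zK; have [zT|zT] := boolP (0 < z.2 < T); last first.
  by rewrite /DP /P !qE //= !mul0r subrr mul0r.
have zJ := outK zK zT; have h0 := mesh_gt0 R n; have h1 := mesh_le1 R n.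
rewrite /DP /P (FT_support_out supJ) /=; last first.
  have := ler_normB (z.1 + h n) (h n); rewrite addrK (gtr0_norm h0) => H.
  by lra.
by rewrite (FT_support_out supJ) ?subrr ?mul0r //; lra.
Qed.

Let theta_out m z : ~ window K T z -> theta m z = 0.
Proof.
move=> zK; have [zT|zT] := boolP (0 < z.2 < T); last by rewrite /theta qE // mul0r.
have zJ := outK zK zT; have h1 := mesh_le1 R m; have /andP[s1 s2] := snap_itv m z.1.
apply: (FT_dx_out FTPsi supJ) => /=.
have := ler_normB (snap m z.1) (snap m z.1 - z.1); rewrite subKr.
have : `|snap m z.1 - z.1| <= 1 by rewrite ler_norml; apply/andP; split; lra.
by lra.
Qed.

Let dx_window z : ~ window K T z -> q z * dx Psi z = 0.
Proof.
move=> zK; have [zT|zT] := boolP (0 < z.2 < T); last by rewrite qE // mul0r.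
by have zJ := outK zK zT; apply: (FT_dx_out FTPsi supJ); lra.
Qed.

Let bP : bm2 R P. Proof. exact: FT_bm T0 FTPsi _ supJ. Qed.

Lemma bm_test_quotient n : bm2 R (DP n).
Proof.
have b1 : bm2 R (fun z => P (z.1 + h n, z.2)).
  apply: (bm_comp (U := fun z : R * R => (z.1 + h n, z.2))) bP.
  by apply: (measurable_pair_map (f := fun x => x + h n)); exact: measurable_funD.
exact: (bmM (bmB b1 bP) (bm_cst _ (h n)^-1)).
Qed.

Let bdx : bm2 R (fun z => q z * dx Psi z). Proof. exact: (FT_dx_bm T0 FTPsi supJ). Qed.

Let btheta m : bm2 R (theta m).
Proof.
apply: (bm_comp (U := fun z : R * R => (snap m z.1, z.2))) bdx.
by apply: measurable_pair_map; exact: measurable_snap.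
Qed.

Let bfs_theta m : bfs (leb2 R) (theta m).
Proof.
split; first exact: btheta.
exists (window K T); split; [exact: measurable_window|exact: window_fin|exact: theta_out].
Qed.

Let theta_cell m : cellwise m (theta m).
Proof. by move=> z; rewrite /theta /= snap_snap. Qed.

(** Three errors of size [e / 3]. The coarse mesh [N] is fixed first, making [theta N] a good
    substitute for the quotient and for the derivative of the test function, uniformly in [j]; only
    then does [j] tend to infinity. *)
Lemma flux_limit :
  \int[leb2 R]_z (dyad (sigma j) (wn j) z * DP (sigma j) z) @[j --> \oo] -->
  \int[leb2 R]_z (g z * (q z * dx Psi z)).
Proof.
have [C [Cn Cw]] := energy K.
have en2 J' : exists C, forall m, \int[leb2 R]_z (win J' z * dyad m w z ^+ 2) <= C.
  by have [C' []] := energy J'; exists C'.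
have mg : mfun2 g by exact: measurable_dyad_limit bw mm.
have mwin : mfun2 (win K) by have [[mmm _] _] := @bfs_window R T K; exact: mmm.
have ig : (leb2 R).-integrable setT (EFin \o (fun z => win K z * g z ^+ 2)).
  exact: (dyad_limit_sqr_integrable bw en2 mm_mono mm_inc K).
pose G := \int[leb2 R]_z (win K z * g z ^+ 2).
pose W := \int[leb2 R]_z win K z.
have W0 : 0 <= W by apply: Rintegral_ge0 => z _; rewrite indicE.
have G0 : 0 <= G by apply: Rintegral_ge0 => z _; rewrite mulr_ge0 ?sqr_ge0 // indicE.
have C0 : 0 <= C.
  by apply: le_trans (Cw 0%N); apply: Rintegral_ge0 => z _; rewrite mulr_ge0 ?sqr_ge0 // indicE.
apply/cvgrPdist_le => e e0.
(* One constant for both substitutions: [C] bounds the energies of the approximations, [G] is that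
   of the limit. *)
pose M := W + C + G + 1; have M0 : 0 < M by rewrite /M; lra.
pose d := e / 3 / M; have d0 : 0 < d by rewrite !divr_gt0.
have dM : d * M = e / 3 by rewrite /d divfK // lt0r_neq0.
have [N HN] := FT_dx_uniform T0 FTPsi supJ d0.
have close2 : `|\int[leb2 R]_z (g z * (q z * dx Psi z)) - \int[leb2 R]_z (g z * theta N z)| <= e / 3.
  apply: le_trans (_ : d * (W + G) <= _).
    apply: (window_test_close (K := K) (T := T)) => //; try exact: ltW; try exact: dx_window; try exact: theta_out.
    by move=> z; have [_] := HN N N (leqnn N) (leqnn N) z.
  by rewrite -dM ler_wpM2l ?(ltW d0) // /M; lra.
have cv : \int[leb2 R]_z (theta N z * dyad N (wn j) z) @[j --> \oo] -->
    \int[leb2 R]_z (theta N z * dyad N w z).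
  have [_ [c thc]] := btheta N.
  apply: (@strip_dct_window R T K _ _ (c * ((Mb + Mb) / h N))).
  - by move=> j; have [m _] := bmM (btheta N) (bm_dyad N (bwn j)); exact: m.
  - by move=> j z; rewrite normrM ler_pM //; exact: (dyad_bound N z (wnB j)).
  - by move=> j z zK; rewrite theta_out // mul0r.
  - by have [m _] := bmM (btheta N) (bm_dyad N bw); exact: m.
  - by move=> z zK; rewrite theta_out // mul0r.
  - move=> z zT; apply: cvgM; first exact: cvg_cst.
    exact: (@dyad_strip_cvg R T wn w wn_cvg N z zT).
(* Against a factor constant on [N]-cells, the quotient of the limit at mesh [N] may be replaced by
   the limit gradient. *)
have := cv; rewrite (dyad_limit_cellwise bw mm_ge mm_mono mm_inc (bfs_theta N) (@theta_cell N) (@theta_out N)).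
under eq_Rintegral do rewrite mulrC.
have e3 : 0 < e / 3 by rewrite divr_gt0.
move=> /cvgrPdist_le/(_ _ e3) [N2 _ H2].
exists (N + N2 + K)%N => // j /= Hj.
have [j1 j2 j3] : [/\ (N <= j)%N, (N2 <= j)%N & (K <= j)%N] by split; apply: leq_trans Hj; [exact: leq_trans (leq_addr _ _) (leq_addr _ _)|exact: leq_trans (leq_addl _ _) (leq_addr _ _)|exact: leq_addl].
have {}H2 := H2 j j2.
have Ns : (N <= sigma j)%N by exact: leq_trans (sigma_ge j).
have bd : bm2 R (dyad (sigma j) (wn j)) by exact: bm_dyad.
have close1 : `|\int[leb2 R]_z (dyad (sigma j) (wn j) z * DP (sigma j) z) -
    \int[leb2 R]_z (dyad (sigma j) (wn j) z * theta N z)| <= e / 3.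
  apply: le_trans (_ : d * (W + C) <= _).
    apply: (window_test_close (K := K) (T := T)) => //; try exact: ltW; try exact: theta_out.
    - by have [m _] := bd; exact: m.
    - apply: (@bfs_integrable _ _ R (leb2 R)); apply: bfsMr; first exact: bfs_window.
      exact: (bmM bd bd).
    - exact: Cn.
    - exact: bm_test_quotient.
    - exact: test_quotient_out.
    - by move=> z; have [] := HN (sigma j) N Ns (leqnn N) z.
  by rewrite -dM ler_wpM2l ?(ltW d0) // /M; lra.
(* The same exchange for the approximation, from mesh [sigma j] down to [N]. *)
have E : \int[leb2 R]_z (dyad (sigma j) (wn j) z * theta N z) =
    \int[leb2 R]_z (theta N z * dyad N (wn j) z).
  rewrite -(dyad_orthogonal_le Ns (bwn j) (bfs_theta N) (@theta_cell N)).
  by under eq_Rintegral do rewrite mulrC.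
rewrite E in close1.
set x1 := \int[leb2 R]_z (g z * _) in close2 *; set x2 := \int[leb2 R]_z _ in close2.
set y1 := \int[leb2 R]_z _ in close1 *; set y2 := \int[leb2 R]_z _ in close1.
have -> : x1 - y1 = (x1 - x2) + (x2 - y2) - (y1 - y2) by ring.
apply: le_trans (ler_normB _ _) _; have := ler_normD (x1 - x2) (x2 - y2).
by move: close1 close2 H2; lra.
Qed.

End flux_limit.

(** * The weak form *)

Section bfs_linear.
Context d (X : measurableType d) (R : realType) (mu : {measure set X -> \bar R}).
Implicit Types f g : X -> R.

Lemma bfs_integralD f g : bfs mu f -> bfs mu g ->
  \int[mu]_z (f z + g z) = \int[mu]_z f z + \int[mu]_z g z.
Proof. by move=> bf bg; rewrite RintegralD //; exact: bfs_integrable. Qed.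

Lemma bfs_integralB f g : bfs mu f -> bfs mu g ->
  \int[mu]_z (f z - g z) = \int[mu]_z f z - \int[mu]_z g z.
Proof. by move=> bf bg; rewrite RintegralB //; exact: bfs_integrable. Qed.

Lemma bfs_integralZ f (c : R) : bfs mu f -> \int[mu]_z (c * f z) = c * \int[mu]_z f z.
Proof. by move=> bf; rewrite RintegralZl //; exact: bfs_integrable. Qed.

End bfs_linear.

Section discrete_weak_form.
Context (R : realType) (phi : R -> R) (lam D B L S : R) (a0 : R -> R)
  (a s : nat -> nat -> int -> R).
Hypothesis sc : scheme phi lam D B L S a0 a s.
Hypothesis phi_cont : continuous phi.
Notation h := (mesh R).
Notation tau n := (lam * mesh R n ^+ 2).
Variables (P : R * R -> R) (J n : nat).
Hypothesis Jn : (J + 2 <= n)%N.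
Hypothesis bP : bfs (leb2 R) P.
Hypothesis supP : forall z, P z != 0 -> `|z.1| < J%:R /\ 0 < z.2.
Let A z := grid_state lam a n z.
Let W z := phi (grid_state lam a n z).
Let Sr z := interp (h n) (tau n) (s n) z.

Let h0 : 0 < h n. Proof. exact: mesh_gt0. Qed.
Let t0 : 0 < tau n. Proof. exact: tau_gt0 sc n. Qed.

Lemma slotD t : 0 <= t -> slot (tau n) (t + tau n) = (slot (tau n) t).+1.
Proof.
move=> t1; rewrite /slot mulrDl divff ?lt0r_neq0 // addrC truncnD ?rpred1 ?nnegrE //.
  by rewrite truncn1 add1n.
by rewrite divr_ge0 // ltW.
Qed.

Lemma cellB x : cell (h n) (x - h n) = cell (h n) x - 1.
Proof. by rewrite -[x in RHS](subrK (h n)) cellD // addrK. Qed.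

Lemma cell_inside x : `|x| < J%:R -> (absz (cell (h n) x) < n * 2 ^ n)%N.
Proof.
move=> xJ; have /andP[x1 x2] := cell_itv x h0; have h1 := mesh_le1 R n.
have Pn : (n * 2 ^ n)%:R * h n = n%:R by rewrite natrM -mulrA mesh_pow2 mulr1.
have nJ : (J%:R + 2 : R) <= n%:R by rewrite -(natrD _ J 2) ler_nat.
move: xJ; rewrite ltr_norml => /andP[y1 y2].
have U : (cell (h n) x)%:~R < (n * 2 ^ n)%:R :> R by rewrite -(ltr_pM2r h0) Pn; lra.
have V : - (n * 2 ^ n)%:R < (cell (h n) x)%:~R :> R.
  by rewrite -(ltr_pM2r h0) mulNr Pn; move: x2; rewrite mulrDl mul1r; lra.
have U' : (cell (h n) x)%:~R < ((n * 2 ^ n)%N%:Z)%:~R :> R by exact: U.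
have V' : (- (n * 2 ^ n)%N%:Z)%:~R < (cell (h n) x)%:~R :> R by rewrite rmorphN.
move: U' V'; rewrite !ltr_int; move: (n * 2 ^ n)%N (cell _ _) => p c; clear; lia.
Qed.

Lemma grid_state_step z : `|z.1| < J%:R -> 0 <= z.2 ->
  A (z.1, z.2 + tau n) = A z +
    (D * (W (z.1 + h n, z.2) - 2 * W z + W (z.1 - h n, z.2)) - tau n * Sr z).
Proof.
case: z => x t /= xJ tt; rewrite /A /W /Sr /grid_state /interp /= slotD // cellD // cellB.
exact: (scheme_step sc) (cell_inside xJ).
Qed.

Let bA : bm2 R A. Proof. exact: bm_grid sc n. Qed.
Let bW : bm2 R W. Proof. exact: bm_flux sc phi_cont n. Qed.
Lemma bm_reaction : bm2 R Sr.
Proof.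
split; first exact: measurable_interp.
by exists S => z; have /andP[? ?] := scheme_reaction_bnd sc n (slot (tau n) z.2) (cell (h n) z.1); rewrite ger0_norm.
Qed.

Let bshift c e (f : R * R -> R) : bm2 R f -> bm2 R (fun z => f (z.1 + c, z.2 + e)).
Proof. by move=> bf; apply: (bm_comp (U := fun z : R * R => (z.1 + c, z.2 + e))) bf; exact: measurable_shift2. Qed.

Let bshift1 c (f : R * R -> R) : bm2 R f -> bm2 R (fun z => f (z.1 + c, z.2)).
Proof. by move=> bf; have := bshift c 0 bf; under eq_fun do rewrite addr0. Qed.

Let fshift c e (f : R * R -> R) : bfs (leb2 R) f -> bfs (leb2 R) (fun z => f (z.1 + c, z.2 + e)).
Proof. exact: bfs2_shift. Qed.

Lemma dyad_shift z : dyad n W z = (W (z.1 + h n, z.2) - W z) / h n.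
Proof. by rewrite dyad_grid // /W /grid_state /interp /= cellD. Qed.

Lemma integral_shift_swap (c e : R) (f g : R * R -> R) : bfs (leb2 R) f -> bm2 R g ->
  \int[leb2 R]_z (f (z.1 - c, z.2 - e) * g z) = \int[leb2 R]_z (f z * g (z.1 + c, z.2 + e)).
Proof.
move=> bf bg.
have b : bfs (leb2 R) (fun z => f (z.1 - c, z.2 - e) * g z).
  by apply: bfsMr => //; exact: (fshift (- c) (- e) bf).
rewrite -(integral2_shift c e b); apply: eq_Rintegral => z _ /=.
by rewrite !addrK; case: z.
Qed.

(** The scheme is invoked only where [P] is nonzero. There [Jn] places the point inside the grid,
    and positivity of time lets [slot] advance by one; on negative times it is constantly 0. The
    factor [D / lam] is [D / tau n] times the [h n ^+ 2] of the two quotients. *)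
Lemma discrete_weak_form :
  \int[leb2 R]_z ((P (z.1, z.2 - tau n) - P z) / tau n * A z) =
  - (D / lam * \int[leb2 R]_z (dyad n W z * ((P (z.1 + h n, z.2) - P z) / h n))) -
  \int[leb2 R]_z (P z * Sr z).
Proof.
have l0 : lam != 0 by have /andP[l _] := scheme_lam sc; exact: lt0r_neq0.
have hn0 : h n != 0 by exact: lt0r_neq0.
have tn0 : tau n != 0 by exact: lt0r_neq0.
have bPt : bfs (leb2 R) (fun z => P (z.1, z.2 - tau n)).
  by have := fshift 0 (- tau n) bP; under eq_fun do rewrite addr0.
have bPh : bfs (leb2 R) (fun z => P (z.1 + h n, z.2)).
  by have := fshift (h n) 0 bP; under eq_fun do rewrite addr0.
have E1 : \int[leb2 R]_z ((P (z.1, z.2 - tau n) - P z) / tau n * A z) =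
    (tau n)^-1 * (\int[leb2 R]_z (P (z.1, z.2 - tau n) * A z) - \int[leb2 R]_z (P z * A z)).
  have b1 := bfsMr bPt bA; have b2 := bfsMr bP bA; have b3 := bfsB b1 b2.
  rewrite -(bfs_integralB b1 b2) -(bfs_integralZ _ b3).
  by apply: eq_Rintegral => z _; ring.
have E2 : \int[leb2 R]_z (P (z.1, z.2 - tau n) * A z) = \int[leb2 R]_z (P z * A (z.1, z.2 + tau n)).
  have := integral_shift_swap 0 (tau n) bP bA.
  by under eq_Rintegral do rewrite subr0; under [in RHS]eq_Rintegral do rewrite addr0.
pose I1 := \int[leb2 R]_z (P z * W z).
pose I2 := \int[leb2 R]_z (P z * W (z.1 + h n, z.2)).
pose I3 := \int[leb2 R]_z (P z * W (z.1 - h n, z.2)).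
have bWp : bm2 R (fun z => W (z.1 + h n, z.2)) by exact: bshift1.
have bWm : bm2 R (fun z => W (z.1 - h n, z.2)) by exact: (bshift1 (- h n)).
have f1 := bfsMr bP bW; have f2 := bfsMr bP bWp; have f3 := bfsMr bP bWm.
have fS := bfsMr bP bm_reaction; have fA := bfsMr bP bA.
have E3 : \int[leb2 R]_z (P z * A (z.1, z.2 + tau n)) = \int[leb2 R]_z (P z * A z) +
    (D * (I2 - 2 * I1 + I3) - tau n * \int[leb2 R]_z (P z * Sr z)).
  have b2 := bfsZ 2 f1; have b3 := bfsB f2 b2; have b4 := bfsD b3 f3.
  have b5 := bfsZ D b4; have b6 := bfsZ (tau n) fS; have b7 := bfsB b5 b6.
  rewrite -(bfs_integralZ (tau n) fS) -(bfs_integralZ 2 f1) -(bfs_integralB f2 b2).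
  rewrite -(bfs_integralD b3 f3) -(bfs_integralZ D b4) -(bfs_integralB b5 b6) -(bfs_integralD fA b7).
  apply: eq_Rintegral => z _; have [->|/supP[zJ z0]] := eqVneq (P z) 0; first by rewrite !mul0r; ring.
  by rewrite grid_state_step ?ltW //; ring.
have E4 : \int[leb2 R]_z (P (z.1 + h n, z.2) * W z) = I3.
  have := integral_shift_swap (- h n) 0 bP bW.
  by under eq_Rintegral do rewrite opprK subr0; under [in RHS]eq_Rintegral do rewrite addr0.
have E5 : \int[leb2 R]_z (P (z.1 + h n, z.2) * W (z.1 + h n, z.2)) = I1.
  have := integral2_shift (h n) 0 f1; rewrite -/I1 => <-.
  by apply: eq_Rintegral => z _; rewrite addr0.
have E6 : \int[leb2 R]_z (dyad n W z * ((P (z.1 + h n, z.2) - P z) / h n)) =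
    (h n ^+ 2)^-1 * (2 * I1 - I2 - I3).
  have -> : 2 * I1 - I2 - I3 = (I1 - I3) - (I2 - I1) by ring.
  rewrite -{1}E5 -E4 /I2 /I1.
  have g1 := bfsMr bPh bWp; have g2 := bfsMr bPh bW.
  have d1 := bfsB g1 g2; have d2 := bfsB f2 f1; have d3 := bfsB d1 d2.
  rewrite -(bfs_integralB g1 g2) -(bfs_integralB f2 f1) -(bfs_integralB d1 d2) -(bfs_integralZ _ d3).
  by apply: eq_Rintegral => z _; rewrite dyad_shift; field.
rewrite E1 E2 E3 E6; set X := \int[leb2 R]_z (P z * A z); set Y := \int[leb2 R]_z (P z * Sr z).
by field; apply/andP; split.
Qed.

End discrete_weak_form.

(** * Time differences of the test function and the initial datum *)

Section time_shift.
Context (R : realType) (T : R) (Psi : R * R -> R).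
Hypotheses (T0 : 0 < T) (FTPsi : FT T Psi).
Notation q := (\1_(QT T) : R * R -> R).
Notation c := (time_clamp T Psi).
Let P z := q z * Psi z.

Lemma clamp_neg (t : R) : t <= 0 -> clamp T t = 0.
Proof. by move=> t0; rewrite /clamp min_l ?max_l // (le_trans t0) // ltW. Qed.

Lemma clamp_final (t : R) : T <= t -> clamp T t = T.
Proof. by move=> tT; rewrite /clamp min_r // max_r // ltW. Qed.

Lemma time_clamp_pos z : 0 < z.2 -> c z = P z.
Proof.
case: z => x t /= t0; rewrite /P QTE /time_clamp /= t0 /=; case: ltP => tT.
  by rewrite mul1r clamp_id // !ltW.
by rewrite mul0r clamp_final // (FT_final FTPsi).
Qed.

Lemma time_clamp_initial x : c (x, 0) = Psi (x, 0).
Proof. by rewrite /time_clamp /= clamp_neg. Qed.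

(** The product of [Psi] with the indicator jumps at time 0. Its backward difference splits into the
    difference of the Lipschitz extension, which yields [dt Psi], and the jump, seen for
    [0 < t <= tau] only, which yields the initial integral. *)
Lemma test_time_shift (tau : R) z : 0 < tau ->
  P (z.1, z.2 - tau) - P z =
  (if 0 < z.2 then c (z.1, z.2 - tau) - c z else 0) -
  \1_`]0, tau] z.2 * c (z.1, 0).
Proof.
case: z => x t /= tau0; rewrite indicE mem_setE in_itv /=.
have P0 s : s <= 0 -> P (x, s) = 0 by move=> s0; rewrite /P QTE /= ltNge s0 /= mul0r.
have [t0|t0] := ltP 0 t; last by rewrite !P0 ?mul0r ?subrr //=; lra.
rewrite (@time_clamp_pos (x, t)) //=; have [tt|tt] := leP t tau.
  have s0 : t - tau <= 0 by lra.
  by rewrite P0 // mul1r /time_clamp /= !clamp_neg //; ring.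
by rewrite mul0r subr0 (@time_clamp_pos (x, t - tau)) //=; lra.
Qed.

End time_shift.

Section initial.
Context (R : realType) (phi : R -> R) (lam D B L S : R) (a0 : R -> R)
  (a s : nat -> nat -> int -> R).
Hypothesis sc : scheme phi lam D B L S a0 a s.
Hypothesis a0_cont : continuous a0.
Notation h := (mesh R).
Notation tau n := (lam * mesh R n ^+ 2).
Variables (c : R -> R) (J : nat).
Hypotheses (c_cont : continuous c) (c_bnd : exists M, forall x, `|c x| <= M).
Hypothesis supc : forall x, J%:R <= `|x| -> c x = 0.

Let aB n m i : `|a n m i| <= B.
Proof. by have /andP[? ?] := scheme_bnd sc n m i; rewrite ger0_norm. Qed.

Let G n z := \1_`]0, tau n] z.2 * c z.1 / tau n * grid_state lam a n z.

Let mc : measurable_fun [set: measurableTypeR R] c.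
Proof. exact: continuous_measurable_fun. Qed.

Lemma bfs_initial n : bfs (leb2 R) (G n).
Proof.
have t0 := tau_gt0 sc n.
have [M cM] := c_bnd.
have b1 : bm2 R (fun z => c z.1).
  split; last by exists M => z; exact: cM.
  by apply: measurableT_comp => //; exact: measurable_fst.
have b2 : bm2 R (fun z => \1_`]0, tau n] z.2).
  split; last by exists 1 => z; rewrite indicE; case: (_ \in _); rewrite ?normr1 ?normr0.
  apply: (measurableT_comp (f := (\1_`]0, tau n] : R -> R))); last exact: measurable_snd.
  by apply: measurable_indic; exact: measurable_itv.
split.
  exact: (bmM (bmM (bmM b2 b1) (bm_cst _ (tau n)^-1)) (bm_grid sc n)).
exists (window J (tau n + 1)); split; [exact: measurable_window|exact: window_fin|].
move=> [x t] zJ; rewrite /G /= indicE mem_setE in_itv /=; have [/andP[t1 t2]|_] := boolP (0 < t <= tau n); last by rewrite !mul0r.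
have [xJ|xJ] := leP J%:R `|x|; first by rewrite supc // mulr0 !mul0r.
exfalso; apply: zJ; split => /=; rewrite in_itv /=; last by apply/andP; split; lra.
by move: xJ; rewrite ltr_norml => /andP[x1 x2]; rewrite x2 ltW.
Qed.

Lemma initial_integral n :
  \int[leb2 R]_z G n z = \int[leb R]_x (c x * a n 0%N (cell (h n) x)).
Proof.
have t0 := tau_gt0 sc n.
rewrite [LHS]/Rintegral -(integral12_prod_meas1 (bfs_integrable (bfs_initial n))).
congr fine; apply: eq_integral => x _; rewrite /fubini_F /=.
pose b t := c x / tau n * grid_state lam a n (x, t).
have mb : measurable_fun setT b.
  apply: measurable_funM => //; rewrite /grid_state /interp /=.
  apply: (measurable_countable_factor (c := slot (tau n)) (fun m => a n m (cell (h n) x))) => m.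
  exact: slot_preimage.
transitivity (\int[leb R]_(t in `]0%R, tau n]) (b t)%:E)%E.
  rewrite [RHS]integral_mkcond; apply: eq_integral => t _.
  by rewrite patchE /G /= indicE; case: (t \in _); rewrite ?mul0r // mul1r.
(* At [t = tau n] the slot is already 1; without this end point the grid function is in its initial
   state on the whole interval. *)
rewrite -integral_itv_bndo_bndc; last by apply/measurable_EFinP; exact: measurable_funTS mb.
rewrite (eq_integral (fun=> (c x / tau n * a n 0%N (cell (h n) x))%:E)); last first.
  move=> t; rewrite inE /= in_itv /= => /andP[t1 t2].
  rewrite /b /grid_state /interp /=; have -> // : slot (tau n) t = 0%N.
  by apply: truncn_def; rewrite divr_ge0 ?ltW // ltr_pdivrMr // mul1r.
rewrite integral_cst //= lebesgue_measure_itv /= lte_fin t0 -EFinB subr0 -EFinM.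
by congr EFin; field; have /andP[l _] := scheme_lam sc; rewrite !lt0r_neq0 // mesh_gt0.
Qed.

Lemma initial_limit (sigma : nat -> nat) : (forall j, (j <= sigma j)%N) ->
  \int[leb2 R]_z G (sigma j) z @[j --> \oo] --> \int[leb R]_x (c x * a0 x).
Proof.
move=> sigma_ge; under eq_fun do rewrite initial_integral.
have [M cM] := c_bnd; have ma : measurable_fun [set: measurableTypeR R] a0 by exact: continuous_measurable_fun.
apply: (@bfs_dct _ (measurableTypeR R) R (leb R) _ _ (M * B) `](- J%:R), J%:R[%classic).
- exact: measurable_itv.
- exact: lebesgue_itv_fin.
- by move=> j; apply: measurable_funM => //; exact: (measurable_cell_fun (fun i => a (sigma j) 0%N i) (mesh_gt0 R _)).
- by move=> j x; rewrite normrM ler_pM.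
- move=> j x; rewrite /= in_itv /= -ltr_norml => /negP; rewrite -leNgt => xJ.
  by rewrite supc // mul0r.
- exact: measurable_funM.
apply: aeW => x; have [xJ|xJ] := leP J%:R `|x|.
  by under eq_fun do rewrite supc // mul0r; rewrite supc // mul0r; exact: cvg_cst.
apply: cvgM; first exact: cvg_cst.
have sx : snap (sigma j) x @[j --> \oo] --> x.
  apply/cvgrPdist_le => e e0; have /cvgrPdist_le/(_ e e0)[N _ HN] := @snap_cvg R x.
  by exists N => // j /= Nj; apply: HN => /=; exact: leq_trans Nj (sigma_ge j).
have ac : a0 (snap (sigma j) x) @[j --> \oo] --> a0 x by exact: (cvg_comp _ a0 sx (@a0_cont x)).
apply: cvg_trans _ ac; apply: near_eq_cvg.
exists (J + 2)%N => // j /= Jj; rewrite /= (scheme_init sc) //.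
by apply: cell_inside xJ; exact: leq_trans Jj (sigma_ge j).
Qed.

End initial.

Lemma lebesgue2_horizontal (R : realType) (T : R) : {ae leb2 R, forall z : R * R, z.2 != T}.
Proof.
exists ([set: R] `*` [set T]); split.
- by apply: measurableX; [exact: measurableT|exact: measurable_set1].
- rewrite [LHS](@product_measure1E _ _ _ _ R (leb R) (leb R)) //.
  have L0 : leb R [set T] = 0%E by exact: lebesgue_measure_set1.
  by rewrite -[RHS](mule0 (leb R [set: R])) -L0.
- by move=> [x t] /= /negP; rewrite negbK => /eqP ->.
Qed.

Section weak_form.
Context (R : realType) (phi : R -> R) (lam D B L S : R) (a0 : R -> R)
  (a s : nat -> nat -> int -> R).
Hypothesis sc : scheme phi lam D B L S a0 a s.
Hypotheses (phi_cont : continuous phi) (a0_cont : continuous a0).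
Variables (T : R) (sigma : nat -> nat) (u r : R * R -> R) (mm : nat -> nat).
Hypotheses (T0 : 0 < T) (sigma_ge : forall j, (j <= sigma j)%N).
Hypothesis u_cvg : forall z, 0 < z.2 < T -> grid_state lam a (sigma j) z @[j --> \oo] --> u z.
Hypothesis u_out : forall z, ~~ (0 < z.2 < T) -> u z = 0.
Notation h := (mesh R).
Notation tau n := (lam * mesh R n ^+ 2).
Hypothesis r_cvg : forall z, 0 < z.2 < T ->
  interp (h (sigma j)) (tau (sigma j)) (s (sigma j)) z @[j --> \oo] --> r z.
Hypothesis r_out : forall z, ~~ (0 < z.2 < T) -> r z = 0.
Notation w := (fun z => phi (u z)).
Hypotheses (mm_ge : forall j, (j <= mm j)%N) (mm_mono : forall i j, (i <= j)%N -> (mm i <= mm j)%N)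
  (mm_inc : forall J n, (mm J <= n)%N ->
    \int[leb2 R]_z ((\1_(window J T) : R * R -> R) z * (dyad n w z - dyad (mm J) w z) ^+ 2) <= mesh R J ^+ 2).
Notation q := (\1_(QT T) : R * R -> R).
Notation g := (dyad_limit w mm).

Let tau_cvg0 : tau (sigma j) @[j --> \oo] --> 0.
Proof.
apply/cvgrPdist_le => e e0; have [N HN] := mesh_small e0; exists N => // j /= Nj.
rewrite sub0r normrN gtr0_norm ?(tau_gt0 sc) //; apply: le_trans (tau_le sc _) _.
by apply: HN; exact: leq_trans Nj (sigma_ge j).
Qed.

Section test.
Variables (Psi : R * R -> R) (J : nat).
Hypothesis FTPsi : FT T Psi.
Hypothesis supJ : forall z, strip T z -> J%:R <= `|z.1| -> Psi z = 0.
Let P z := q z * Psi z.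
Notation c := (time_clamp T Psi).
Let F j z := (if 0 < z.2 then c (z.1, z.2 - tau (sigma j)) - c z else 0) / tau (sigma j) *
  grid_state lam a (sigma j) z.

Let t0 j : 0 < tau (sigma j). Proof. exact: tau_gt0 sc _. Qed.
Let t1 j : tau (sigma j) <= 1. Proof. exact: le_trans (tau_le sc _) (mesh_le1 _ _). Qed.

Let supP z : P z != 0 -> `|z.1| < J%:R /\ 0 < z.2.
Proof.
move=> Pz; split.
  by rewrite ltNge; apply: contra Pz => zJ; rewrite /P (FT_support_out supJ).
by rewrite ltNge; apply: contra Pz => zJ; rewrite /P QTE ltNge zJ mul0r.
Qed.

Let bP : bfs (leb2 R) P. Proof. exact: FT_bfs T0 FTPsi _ supJ. Qed.

Let bdt : bm2 R (fun z => q z * dt Psi z).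
Proof. by have [M []] := FT_dt_bm T0 FTPsi supJ. Qed.

Let bc : bm2 R c. Proof. exact: (time_clamp_bm T0 FTPsi supJ). Qed.

Let c_out z : J%:R <= `|z.1| -> c z = 0.
Proof. exact: time_clamp_support T0 _ supJ _. Qed.

Let mF j : mfun2 (F j).
Proof.
have b1 : bm2 R (fun z => c (z.1, z.2 - tau (sigma j))).
  have := bm_comp (U := fun z : R * R => (z.1 + 0, z.2 - tau (sigma j))) (measurable_shift2 _ _) bc.
  by under eq_fun do rewrite addr0.
have [m1 _] := bmB b1 bc; have [m2 _] := bm_grid sc (sigma j).
apply: measurable_funM => //; apply: measurable_funM => //.
apply: measurable_fun_ifT => //.
by apply: measurable_fun_ltr => //; exact: measurable_snd.
Qed.

Let F_window j z : ~ window J (T + 1) z -> F j z = 0.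
Proof.
move: z => [x t] zJ; rewrite /F /=; case: ifP => [tp|_]; last by rewrite !mul0r.
have [xJ|xJ] := leP J%:R `|x|; first by rewrite !c_out //= subrr !mul0r.
have tT : T + 1 <= t.
  rewrite leNgt; apply/negP => tT; apply: zJ; split; rewrite /= in_itv /= ?tp //.
  by move: xJ; rewrite ltr_norml => /andP[x1 x2]; rewrite x2 ltW.
have := t1 j => tj.
by rewrite /time_clamp /= !clamp_final ?subrr ?mul0r //; lra.
Qed.

Lemma time_difference_limit :
  \int[leb2 R]_z F j z @[j --> \oo] --> \int[leb2 R]_z (- (u z * (q z * dt Psi z))).
Proof.
have [M [M0 HM]] := time_clamp_lip T0 FTPsi supJ.
have [mdt _] := bdt; have [mu _] := bm_species sc u_cvg u_out.
apply: (@bfs_dct _ _ R (leb2 R) F _ (M * B) (window J (T + 1))) => //.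
- exact: measurable_window.
- exact: window_fin.
- move=> j z; rewrite /F normrM ler_pM //; last first.
    by have /andP[? ?] := grid_state_bnd sc (sigma j) z; rewrite ger0_norm.
  have tj := t0 j; rewrite normrM normfV (gtr0_norm tj) ler_pdivrMr //.
  case: ifP => _; last by rewrite normr0 mulr_ge0 // ltW.
  case: z => x t /=; rewrite distrC; have := HM x (t - tau (sigma j)) t.
  by rewrite subKr; apply; rewrite gerBl ltW.
- by apply: measurable_funN; exact: measurable_funM.
(* On [t = T] the backward quotient may keep the slope from inside while the indicator of the open
   strip is already 0. This line is null; convergence holds off it. *)
apply: (negligibleS _ (lebesgue2_horizontal T)) => z /= nz; apply: contra_not nz; case: z => x t /= tT.
have [tle|tp] := leP t 0.
  rewrite QTE /= ltNge tle /= mul0r mulr0 oppr0.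
  have -> : F ^~ (x, t) = fun=> 0 by apply/funext => j; rewrite /F /= ltNge tle /= !mul0r.
  exact: cvg_cst.
have [tlt|tge] := ltP t T; last first.
  rewrite QTE /= tp ltNge tge /= mul0r mulr0 oppr0.
  have tgt : 0 < t - T by rewrite subr_gt0 lt_neqAle eq_sym tT.
  have /cvgrPdist_le/(_ _ tgt)[N _ HN] := tau_cvg0.
  apply: cvg_near_cst; exists N => // j /= Nj.
  have := HN j Nj; rewrite /= sub0r normrN gtr0_norm // => tj.
  by rewrite /F /= tp /time_clamp /= !clamp_final ?subrr ?mul0r //; lra.
have zT : 0 < t < T by rewrite tp.
rewrite QTE /= zT mul1r.
have [der dE] := time_clamp_derive FTPsi x zT.
have hN0 : - tau (sigma j) @[j --> \oo] --> 0 by rewrite -oppr0; exact: cvgN.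
have hNn j : - tau (sigma j) != 0 by rewrite oppr_eq0 lt0r_neq0.
have := derive1_seq der hN0 hNn; rewrite dE => cd.
have -> : - (u (x, t) * dt Psi (x, t)) = (- dt Psi (x, t)) * u (x, t) by ring.
have -> : F ^~ (x, t) = fun j => (- ((c (x, t - tau (sigma j)) - c (x, t)) / (- tau (sigma j)))) *
    grid_state lam a (sigma j) (x, t).
  by apply/funext => j; rewrite /F /= tp invrN mulrN opprK.
by apply: cvgM; [exact: cvgN|exact: u_cvg].
Qed.

Lemma weak_form_test :
  \int[leb R]_x (a0 x * Psi (x, 0)) + \int[leb2 R]_z (u z * (q z * dt Psi z)) =
  D / lam * \int[leb2 R]_z (g z * (q z * dx Psi z)) + \int[leb2 R]_z (q z * Psi z * r z).
Proof.
have SB j z : `|interp (h (sigma j)) (tau (sigma j)) (s (sigma j)) z| <= S.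
  have /andP[? ?] := scheme_reaction_bnd sc (sigma j) (slot (tau (sigma j)) z.2) (cell (h (sigma j)) z.1).
  by rewrite ger0_norm.
have mS j : mfun2 (interp (h (sigma j)) (tau (sigma j)) (s (sigma j))).
  by have [m _] := bm_reaction sc (sigma j); exact: m.
have br : bm2 R r := bm_strip_limit mS SB r_cvg r_out.
pose X j := \int[leb2 R]_z (dyad (sigma j) (fun z => phi (grid_state lam a (sigma j) z)) z *
  ((P (z.1 + h (sigma j), z.2) - P z) / h (sigma j))).
pose Y j := \int[leb2 R]_z (P z * interp (h (sigma j)) (tau (sigma j)) (s (sigma j)) z).
pose Gj j := \int[leb2 R]_z (\1_`]0, tau (sigma j)] z.2 * c (z.1, 0) / tau (sigma j) *
  grid_state lam a (sigma j) z).
have [K PK] : exists K, forall z, `|P z| <= K by have [[_ ]] := bP.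
have Xl : X j @[j --> \oo] --> \int[leb2 R]_z (g z * (q z * dx Psi z)).
  apply: (@flux_limit R T (L * B) sigma (fun j z => phi (grid_state lam a (sigma j) z)) w mm Psi J) => //.
  - by move=> j; exact: bm_flux sc phi_cont _.
  - by move=> j z; exact: (phi_bnd sc (grid_state_bnd sc _ _)).
  - exact: (bm_species_flux sc phi_cont u_cvg u_out).
  - by move=> z zT; apply: continuous_cvg; [exact: phi_cont|exact: u_cvg].
  - move=> K'; have [C [_ [C1 C2]]] := species_energy sc phi_cont T0 sigma_ge u_cvg u_out K'.
    by exists C; split=> // j Kj; apply: C1; exact: leq_trans Kj (sigma_ge j).
have Yl : Y j @[j --> \oo] --> \int[leb2 R]_z (P z * r z).
  have [[mP _] [W [mW Wfin PW]]] := bP.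
  apply: (@bfs_dct _ _ R (leb2 R) _ _ (K * S) W) => //.
  - by move=> j; exact: measurable_funM.
  - by move=> j z; rewrite normrM ler_pM.
  - by move=> j z zW; rewrite PW // mul0r.
  - by have [m _] := (bfsMr bP br).1; exact: m.
  - apply: aeW => z; have [zT|zT] := boolP (0 < z.2 < T).
      by apply: cvgM; [exact: cvg_cst|exact: r_cvg].
    have P0 : P z = 0 by rewrite /P QTE (negbTE zT) mul0r.
    by rewrite P0; under eq_fun do rewrite mul0r; rewrite mul0r; exact: cvg_cst.
have c0c : continuous (fun x => c (x, 0)).
  move=> x; have [[cPsi _ _ _] _ _] := FTPsi.
  have p : (fun y : R => (y, 0 : R)) @ x --> (x, 0 : R) by apply: cvg_pair_plane; [exact: cvg_id|exact: cvg_cst].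
  exact: (cvg_comp (fun y : R => (y, 0)) c p (@strip_extend R T T0 Psi cPsi (x, 0))).
have Gl : Gj j @[j --> \oo] --> \int[leb R]_x (c (x, 0) * a0 x).
  apply: (initial_limit sc a0_cont (c := fun x => c (x, 0)) (J := J)) => //.
    by have [_ [M cM]] := bc; exists M => x; exact: cM.
  by move=> x xJ; exact: c_out.
have Fl := time_difference_limit.
have bF j : bfs (leb2 R) (F j).
  have [_ [M cM]] := bc.
  split; last by exists (window J (T + 1)); split; [exact: measurable_window|exact: window_fin|exact: F_window].
  split; first exact: mF.
  exists ((M + M) / tau (sigma j) * B) => z; rewrite /F normrM ler_pM //; last first.
    by have /andP[? ?] := grid_state_bnd sc (sigma j) z; rewrite ger0_norm.
  have tj := t0 j; rewrite normrM normfV (gtr0_norm tj) ler_wpM2r ?invr_ge0 ?(ltW tj) //.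
  case: ifP => _; first by apply: le_trans (ler_normB _ _) _; rewrite lerD.
  by rewrite normr0 addr_ge0 // (le_trans _ (cM z)).
have bG j := @bfs_initial R phi lam D B L S a0 a s sc (fun x => c (x, 0)) J c0c
  (let: conj _ (ex_intro M cM) := bc in ex_intro _ M (fun x => cM (x, 0))) (fun x xJ => c_out (z := (x, 0)) xJ) (sigma j).
(* Only eventually, once the grid contains the support of the test function with room to spare. *)
have E : \forall j \near \oo, \int[leb2 R]_z F j z - Gj j = - (D / lam * X j) - Y j.
  exists (J + 2)%N => // j /= Jj.
  rewrite -(discrete_weak_form sc phi_cont (leq_trans Jj (sigma_ge j)) bP supP).
  rewrite -(bfs_integralB (bF j) (bG j)); apply: eq_Rintegral => z _.
  by rewrite (test_time_shift T0 FTPsi) // /F; rewrite !mulrBl.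
have l1 : \int[leb2 R]_z F j z - Gj j @[j --> \oo] -->
   \int[leb2 R]_z (- (u z * (q z * dt Psi z))) - \int[leb R]_x (c (x, 0) * a0 x) by exact: cvgB.
have l2 : - (D / lam * X j) - Y j @[j --> \oo] -->
   - (D / lam * \int[leb2 R]_z (g z * (q z * dx Psi z))) - \int[leb2 R]_z (P z * r z).
  by apply: cvgB Yl; apply: cvgN; apply: cvgM Xl; exact: cvg_cst.
have l3 : \int[leb2 R]_z F j z - Gj j @[j --> \oo] -->
   - (D / lam * \int[leb2 R]_z (g z * (q z * dx Psi z))) - \int[leb2 R]_z (P z * r z).
  by apply: cvg_trans _ l2; apply: near_eq_cvg; apply: filterS E => j ->.
have := cvg_unique (@Rhausdorff R) l1 l3.
have -> : \int[leb R]_x (c (x, 0) * a0 x) = \int[leb R]_x (a0 x * Psi (x, 0)).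
  by apply: eq_Rintegral => x _; rewrite (time_clamp_initial Psi T0) mulrC.
have bu : bfs (leb2 R) (fun z => u z * (q z * dt Psi z)).
  by apply: bfsMl; [exact: (bm_species sc u_cvg u_out)|exact: FT_dt_bfs T0 FTPsi _ supJ].
have -> : \int[leb2 R]_z (- (u z * (q z * dt Psi z))) = - \int[leb2 R]_z (u z * (q z * dt Psi z)).
  by rewrite -mulN1r -(bfs_integralZ _ bu); apply: eq_Rintegral => z _; rewrite mulN1r.
by move=> H; apply: oppr_inj; rewrite !opprD [LHS]addrC; exact: H.
Qed.

End test.

Lemma weak_form Psi : FT T Psi ->
  \int[leb R]_x (a0 x * Psi (x, 0)) + \int[leb2 R]_z (u z * (q z * dt Psi z)) =
  D / lam * \int[leb2 R]_z (g z * (q z * dx Psi z)) + \int[leb2 R]_z (q z * Psi z * r z).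
Proof. by move=> FTPsi; have [J supJ] := FT_support FTPsi; exact: weak_form_test FTPsi supJ. Qed.

End weak_form.

(** * Sobolev regularity *)

Section Lebesgue_norms.
Context d (X : measurableType d) (R : realType) (mu : {measure set X -> \bar R}).
Implicit Types f : X -> R.

Lemma Lnorm2_sqr f : ('N[mu]_2%:E[EFin \o f] ^+ 2 = \int[mu]_x (f x ^+ 2)%:E)%E.
Proof.
have N2 : (2 : R) != 0 by [].
transitivity ('N[mu]_2%:E[EFin \o f] `^ 2)%E.
  have := Lnorm_ge0 mu 2%:E (EFin \o f).
  case: ('N[mu]_2%:E[EFin \o f])%E => [x|_|//].
    by rewrite lee_fin => x0; rewrite poweR_EFin powR_mulrn.
  by rewrite expe2 mulyy poweRE (negbTE N2) eqxx.
rewrite (poweR_Lnorm mu _ N2); apply: eq_integral => x _ /=.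
by rewrite powR_mulrn // real_normK // num_real.
Qed.

Lemma Lfun2 f : measurable_fun setT f -> (\int[mu]_x (f x ^+ 2)%:E < +oo)%E ->
  f \in Lfun mu 2%:E.
Proof.
rewrite -Lnorm2_sqr => mf ff; apply/andP; split; rewrite inE //=.
rewrite /finite_norm; move: ff (Lnorm_ge0 mu 2%:E (EFin \o f)).
by case: ('N[mu]_2%:E[EFin \o f])%E => [x||] //=; rewrite ?ltry // expe2 mulyy.
Qed.

Lemma Lfun_bounded f : bounded_measurable f -> f \in Lfun mu +oo%E.
Proof.
move=> [mf [K fK]]; apply/andP; split; rewrite inE //=.
rewrite /finite_norm unlock; case: ifP => _ //.
apply: (@le_lt_trans _ _ K%:E); last exact: ltry.
by apply/ess_supP; apply: aeW => x /=; rewrite lee_fin.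
Qed.

End Lebesgue_norms.

Section sobolev_limit.
Context (R : realType) (w : R * R -> R) (T : R) (mm : nat -> nat).
Notation win J := (\1_(window J T) : R * R -> R).
Hypothesis bw : bm2 R w.
Hypothesis energy : forall J : nat, exists C, forall m,
  \int[leb2 R]_z (win J z * dyad m w z ^+ 2) <= C.
Hypotheses (mm_ge : forall j, (j <= mm j)%N) (mm_mono : forall i j, (i <= j)%N -> (mm i <= mm j)%N)
  (mm_inc : forall J n, (mm J <= n)%N ->
    \int[leb2 R]_z (win J z * (dyad n w z - dyad (mm J) w z) ^+ 2) <= mesh R J ^+ 2).
Hypothesis w_cont : forall x t : R, 0 < t < T -> {for x, continuous (fun x => w (x, t))}.
Notation g := (dyad_limit w mm).
Variable J : R.
Hypothesis J0 : 0 < J.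
Notation I := (`]- J, J[%classic : set R).
Let K := (Num.truncn J).+1.

Let JK : J < K%:R. Proof. exact: truncnS_gt. Qed.

Let mg : mfun2 g. Proof. exact: measurable_dyad_limit bw mm. Qed.

Let winE x t : I x -> 0 < t < T -> win K (x, t) = 1.
Proof.
move=> /=; rewrite in_itv /= => /andP[x1 x2] tT; apply: window_in; split; rewrite /= in_itv //.
by apply/andP; split; [apply/ltW/(lt_trans _ x1); rewrite ltrN2; exact: JK|exact: lt_trans x2 JK].
Qed.

Let sqr_restrict (k : R -> R) x : (k \_ I) x ^+ 2 = \1_I x * k x ^+ 2.
Proof. by rewrite patchE indicE; case: (x \in I); rewrite ?mul1r // expr0n mul0r. Qed.

Let H z := \1_I z.1 * (w z ^+ 2 + g z ^+ 2).

Let mI : measurable (I : set (measurableTypeR R)). Proof. exact: measurable_itv. Qed.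

Let section_restrict (k : R * R -> R) t : mfun2 k ->
  @measurable_fun _ _ (measurableTypeR R) _ setT ((fun x => k (x, t)) \_ I).
Proof.
move=> mk; apply/(measurable_restrictT _ _).1 => //.
by apply: measurable_funTS; exact: measurable_fun_pair1.
Qed.

Lemma section_square_finite : {ae leb R, forall t, 0 < t < T ->
  (\int[leb R]_x (((fun x => g (x, t)) \_ I) x ^+ 2)%:E < +oo)%E}.
Proof.
have mF : mfun2 (fun z => (win K z * g z ^+ 2)%:E).
  apply/measurable_EFinP; apply: measurable_funM; first by have [[m _] _] := @bfs_window R T K; exact: m.
  exact: measurable_funX.
have F0 z : (0 <= (win K z * g z ^+ 2)%:E)%E by rewrite lee_fin mulr_ge0 ?sqr_ge0 // indicE.
have := dyad_limit_sqr bw energy mm_mono mm_inc K; rewrite (fubini_tonelli2 _ mF F0).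
set G := fubini_G _ _ => GT.
have mG : measurable_fun setT G by exact: measurable_fun_fubini_tonelli_G.
have G0 t : (0 <= G t)%E by apply: integral_ge0 => x _; exact: F0.
have iG : (leb R).-integrable setT G.
  by apply/integrableP; split=> //; under eq_integral do rewrite gee0_abs ?G0 //.
apply: filterS (integrable_ae measurableT iG) => t /(_ Logic.I) Gt tT.
apply: (@le_lt_trans _ _ (G t)); last by rewrite ltey_eq Gt.
apply: ge0_le_integral => //.
- by move=> x _; rewrite lee_fin sqr_ge0.
- apply/measurable_EFinP; apply: measurable_funX; exact: (section_restrict t mg).
- exact: (measurable_fun_pair1 t mF).
move=> x _; rewrite lee_fin sqr_restrict indicE; have [xI|_] := boolP (x \in I); last first.
  by rewrite mul0r mulr_ge0 ?sqr_ge0 // indicE.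
by rewrite winE //; exact: set_mem.
Qed.

Lemma W12_section : {ae leb R, forall t, t \in `]0, T[ ->
  W12 I (fun x => w (x, t)) (fun x => g (x, t))}.
Proof.
have A := section_square_finite.
have A2 := dyad_limit_weak_derivative bw mm_ge mm_mono mm_inc K.
(* Two null sets of times are discarded, one for square integrability and one for the weak
   derivative. Neither depends on the test function. *)
have := negligibleU A A2; apply: negligibleS => t /=; rewrite in_itv /= => nW.
have [tT|tT] := pselect (0 < t < T); last by exfalso; apply: nW => /tT.
apply: contrapT => /not_orP [/contrapT/(_ tT) sq /contrapT/(_ tT) wd]; apply: nW => _; split.
- have [mw [M wM]] := bw.
  have b : bfs (leb R) ((fun x => w (x, t)) \_ I).
    split; last by exists I; split=> //; [exact: lebesgue_itv_fin|move=> x xI; rewrite patchE memNset].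
    split; first exact: section_restrict.
    exists M => x; rewrite patchE; case: ifP => _; first exact: wM.
    by rewrite normr0 (le_trans _ (wM (x, t))).
  apply: Lfun2; first by have [[m _] _] := b; exact: m.
  have := bfs_integrable (bfsMl b.1 b) => /integrableP[_]; apply: le_lt_trans.
  rewrite le_eqVlt; apply/orP; left; apply/eqP; apply: eq_integral => x _ /=.
  by rewrite ger0_norm -expr2 // sqr_ge0.
- by apply: Lfun2 => //; exact: section_restrict.
move=> psi [Cpsi _ supp].
have [dpsi cpsi'] := Cpsi 1%N.
have cpsi : continuous (derive1 psi) by exact: cpsi'.
have psi0 x : ~ I x -> psi x = 0.
  move=> xI; apply/eqP; apply: contraT => px; exfalso; apply: xI; apply: supp.
  exact: (@subset_closure _ [set x | psi x != 0]).
have der x : derivable psi x 1 by exact: (dpsi 0%N x).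
have dpsi0 x : ~ I x -> derive1 psi x = 0.
  move=> xI; have nc : ~ closure [set x | psi x != 0] x by move=> c; apply: xI; exact: supp.
  have : nbhs x (fun y => psi y = 0).
    move: nc => /existsNP[U /not_implyP[xU nU]]; apply: filterS xU => y Uy.
    by apply/eqP; apply: contraT => py; exfalso; apply: nU; exists y.
  move=> nz; rewrite derive1E -[RHS](derive_cst (0 : R) x 1); apply: near_eq_derive => //.
have bpsi : bm1 R (derive1 psi).
  have mcont (f : R -> R) : continuous f -> measurable_fun [set: measurableTypeR R] f.
    exact: continuous_measurable_fun.
  split; first exact: mcont cpsi.
  have Jle : - J <= J by rewrite (@le_trans _ _ 0) ?oppr_le0 ?ltW.
  have cN : {within `[- J, J], continuous (fun x => `|derive1 psi x|)}.
    by apply: continuous_subspaceT => x; apply: continuous_comp; [exact: cpsi|exact: norm_continuous].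
  have [c _ Hc] := EVT_max Jle cN; exists `|derive1 psi c| => x.
  have [xI|xI] := pselect (I x); last by rewrite dpsi0 // normr0.
  by apply: Hc; move: xI; rewrite /= !in_itv /= => /andP[x1 x2]; rewrite !ltW.
have contt : continuous (fun x => w (x, t)) by move=> x; exact: w_cont.
have psiK x : ~ (- K%:R <= x < K%:R) -> psi x = 0.
  move=> xK; apply: psi0 => /=; rewrite in_itv /= => /andP[x1 x2]; apply: xK.
  by apply/andP; split; [apply/ltW/(lt_trans _ x1); rewrite ltrN2; exact: JK|exact: lt_trans x2 JK].
have E := wd contt psi der bpsi psiK.
rewrite [LHS]Rintegral_mkcond [X in _ = - X]Rintegral_mkcond.
transitivity (\int[leb R]_x (w (x, t) * derive1 psi x)).
  apply: eq_Rintegral => x _; rewrite patchE; case: ifPn => // /negP xI.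
  by rewrite dpsi0 ?mulr0 // => ?; apply: xI; rewrite inE.
rewrite E; congr (- _); apply: eq_Rintegral => x _; rewrite patchE; case: ifPn => // /negP xI.
by rewrite psi0 ?mulr0 // => ?; apply: xI; rewrite inE.
Qed.

Lemma W12_norm_finite :
  (\int[leb R]_(t in `]0%R, T[)
     W12_norm2 I (fun x => w (x, t)) (fun x => g (x, t)) < +oo)%E.
Proof.
pose F z := (\1_(QT T) z * H z)%:E.
have mH : mfun2 H.
  apply: measurable_funM; last by apply: measurable_funD; apply: measurable_funX => //; have [m _] := bw; exact: m.
  apply: (measurableT_comp (f := (\1_I : R -> R))); last exact: measurable_fst.
  by apply: measurable_indic.
have mF : mfun2 F.
  by apply/measurable_EFinP; apply: measurable_funM => //; have [m _] := bm_QT T; exact: m.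
have H0 z : 0 <= H z by rewrite mulr_ge0 ?addr_ge0 ?sqr_ge0 // indicE.
have F0 z : (0 <= F z)%E by rewrite lee_fin mulr_ge0 // indicE.
have norm t : W12_norm2 I (fun x => w (x, t)) (fun x => g (x, t)) = (\int[leb R]_x (H (x, t))%:E)%E.
  rewrite /W12_norm2 !Lnorm2_sqr -ge0_integralD //.
  - by apply: eq_integral => x _; rewrite !sqr_restrict -EFinD -mulrDr.
  - by move=> x _; rewrite lee_fin sqr_ge0.
  - by apply/measurable_EFinP; apply: measurable_funX; apply: section_restrict; have [m _] := bw; exact: m.
  - by move=> x _; rewrite lee_fin sqr_ge0.
  - by apply/measurable_EFinP; apply: measurable_funX; exact: section_restrict.
under eq_integral do rewrite norm.
have -> : (\int[leb R]_(t in `]0%R, T[) \int[leb R]_x (H (x, t))%:E =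
    \int[leb R]_t fubini_G (leb R) F t)%E.
  rewrite integral_mkcond; apply: eq_integral => t _; rewrite patchE mem_setE in_itv /= /fubini_G /F.
  case: ifPn => tT; first by apply: eq_integral => x _; rewrite QTE /= tT mul1r.
  by under eq_integral do rewrite QTE /= (negbTE tT) mul0r; rewrite integral0.
rewrite -(fubini_tonelli2 _ mF F0).
have mwin : mfun2 (win K) by have [[m _] _] := @bfs_window R T K; exact: m.
have [mw [M wM]] := bw.
have bw2 : bfs (leb2 R) (fun z => win K z * (w z * w z)) by apply: bfsMr; [exact: bfs_window|exact: bmM].
apply: (@le_lt_trans _ _ (\int[leb2 R]_z ((win K z * (w z * w z))%:E + (win K z * g z ^+ 2)%:E))%E).
  apply: ge0_le_integral => //.
  - by apply/measurable_EFinP; apply: measurable_funD; apply: measurable_funM => //; [exact: measurable_funM|exact: measurable_funX].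
  move=> [x t] _; rewrite /F /H -EFinD lee_fin -mulrDr QTE /= -expr2.
  have [tT|_] := boolP (0 < t < T); last by rewrite mul0r mulr_ge0 ?addr_ge0 ?sqr_ge0 // indicE.
  rewrite mul1r [\1_I x]indicE; have [xI|_] := boolP (x \in I).
    by rewrite winE //; exact: set_mem.
  by rewrite mul0r mulr_ge0 ?addr_ge0 ?sqr_ge0 // indicE.
rewrite ge0_integralD //.
- apply: lte_add_pinfty; last exact: (dyad_limit_sqr bw energy mm_mono mm_inc K).
  have /integrableP[_] := bfs_integrable bw2; apply: le_lt_trans.
  rewrite le_eqVlt; apply/orP; left; apply/eqP; apply: eq_integral => z _ /=.
  by rewrite ger0_norm // mulr_ge0 -?expr2 ?sqr_ge0 // indicE.
- by move=> z _; rewrite lee_fin mulr_ge0 -?expr2 ?sqr_ge0 // indicE.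
- by apply/measurable_EFinP; have [[m _] _] := bw2; exact: m.
- by move=> z _; rewrite lee_fin mulr_ge0 ?sqr_ge0 // indicE.
- by apply/measurable_EFinP; apply: measurable_funM => //; exact: measurable_funX.
Qed.

Lemma L2_W12_limit : L2_W12 T I w g.
Proof.
have [mw _] := bw; split.
- exact: measurable_funTS mw.
- exact: measurable_funTS mg.
- exact: W12_section.
- exact: W12_norm_finite.
Qed.

End sobolev_limit.

Lemma Rintegral_QT (R : realType) (T : R) (f : R * R -> R) :
  \int[leb2 R]_(z in QT T) f z = \int[leb2 R]_z ((\1_(QT T) : R * R -> R) z * f z).
Proof.
rewrite [LHS]Rintegral_mkcond; apply: eq_Rintegral => z _.
by rewrite patchE indicE; case: (z \in QT T); rewrite ?mul1r ?mul0r.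
Qed.

(** * Weak solution of one equation *)

Section species_solution.
Context (R : realType) (phi : R -> R) (lam D B L S : R) (a0 : R -> R)
  (a s : nat -> nat -> int -> R).
Hypothesis sc : scheme phi lam D B L S a0 a s.
Hypotheses (phi_cont : continuous phi) (a0_cont : continuous a0).
Variables (T : R) (sigma : nat -> nat) (u r : R * R -> R).
Hypotheses (T0 : 0 < T) (sigma_ge : forall j, (j <= sigma j)%N).
Hypothesis u_cvg : forall z, 0 < z.2 < T -> grid_state lam a (sigma j) z @[j --> \oo] --> u z.
Hypothesis u_out : forall z, ~~ (0 < z.2 < T) -> u z = 0.
Hypothesis r_cvg : forall z, 0 < z.2 < T ->
  interp (mesh R (sigma j)) (lam * mesh R (sigma j) ^+ 2) (s (sigma j)) z @[j --> \oo] --> r z.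
Hypothesis r_out : forall z, ~~ (0 < z.2 < T) -> r z = 0.
Hypothesis flux_cont : forall x t : R, 0 < t < T ->
  {for x, continuous (fun x => phi (u (x, t)))}.

(** The limit [r] of the reaction stays abstract, so that both equations are instances; [D / lam] is
    the diffusivity, 1 for [u] and [eps] for [v]. *)
Lemma species_solution : exists g : R * R -> R,
  (forall J : R, 0 < J -> L2_W12 T `]- J, J[ (phi \o u) g) /\
  forall Psi, FT T Psi ->
    \int[leb R]_x (a0 x * Psi (x, 0)) + \int[leb2 R]_(z in QT T) (u z * dt Psi z) =
    \int[leb2 R]_(z in QT T) (D / lam * g z * dx Psi z) + \int[leb2 R]_(z in QT T) (Psi z * r z).
Proof.
have bw := bm_species_flux sc phi_cont u_cvg u_out.
have energy K : exists C, forall m,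
    \int[leb2 R]_z ((\1_(window K T) : R * R -> R) z * dyad m (fun z => phi (u z)) z ^+ 2) <= C.
  by have [C [_ [_ H]]] := species_energy sc phi_cont T0 sigma_ge u_cvg u_out K; exists C.
have [mm [mm_ge mm_mono mm_inc]] := dyad_subsequence bw energy.
exists (dyad_limit (fun z => phi (u z)) mm); split.
  by move=> J J0; exact: (L2_W12_limit bw energy mm_ge mm_mono mm_inc flux_cont J0).
move=> Psi FTPsi; have [J supJ] := FT_support FTPsi.
rewrite !Rintegral_QT.
have := weak_form sc phi_cont a0_cont T0 sigma_ge u_cvg u_out r_cvg r_out mm_ge mm_mono mm_inc FTPsi.
under [X in _ + X = _ -> _]eq_Rintegral do rewrite mulrCA.
move=> ->; congr (_ + _); last by apply: eq_Rintegral => z _; rewrite mulrA.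
have ig := window_test_integrable (measurable_dyad_limit bw mm)
  (dyad_limit_sqr_integrable bw energy mm_mono mm_inc J.+1) (FT_dx_bm T0 FTPsi supJ)
  (FT_dx_window FTPsi supJ).
by rewrite -RintegralZl //; apply: eq_Rintegral => z _; ring.
Qed.

End species_solution.

Lemma Cn2_continuous (R : realType) (f : R -> R) : Cn 2 f -> continuous f.
Proof.
move=> [df _] x; apply/differentiable_continuous/derivable1_diffP; exact: (df 0%N x).
Qed.

Lemma Lp_on_bounded (R : realType) (T : R) (u : R * R -> R) :
  bm2 R u -> Lp_on (leb2 R) +oo%E (QT T) u.
Proof.
move=> bu; rewrite /Lp_on; have -> : u \_ (QT T) = fun z => (\1_(QT T) : R * R -> R) z * u z.
  by apply/funext => z; rewrite patchE indicE; case: (z \in QT T); rewrite ?mul1r ?mul0r.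
by apply: Lfun_bounded; apply: bmM => //; exact: bm_QT.
Qed.
Theorem theorem5p1 (R : realType) (T U0 V0 : R) (phi : R -> R)
  (u0 v0 : R -> R -> R) (eps : R)
  (T_gt0 : 0 < T) (U0_gt0 : 0 < U0) (V0_gt0 : 0 < V0)
  (phi_C2 : Cn 2 phi)
  (phi_incr : {homo phi : x y / x < y})
  (dphi_incr : {in `[0, +oo[ &, {homo derive1 phi : x y / x < y}})
  (phi_gt0 : forall s : R, 0 < s -> 0 < phi s)
  (phi0 : phi 0 = 0) (dphi0 : derive1 phi 0 = 0)
  (u0_C2 : forall k : R, 0 < k -> Cn 2 (u0 k))
  (v0_C2 : forall k : R, 0 < k -> Cn 2 (v0 k))
  (u0_bnd : forall k x : R, 0 < k -> 0 <= u0 k x <= U0)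
  (v0_bnd : forall k x : R, 0 < k -> 0 <= v0 k x <= V0)
  (u0_L1 : forall k : R, 0 < k -> (u0 k \- u0_infty U0) \in Lfun (leb R) 1%E)
  (v0_L1 : forall k : R, 0 < k -> (v0 k \- v0_infty V0) \in Lfun (leb R) 1%E)
  (u0_cvg : 'N[leb R]_1[EFin \o (u0 k \- u0_infty U0)%R]%E @[k --> +oo] --> 0%E)
  (v0_cvg : 'N[leb R]_1[EFin \o (v0 k \- v0_infty V0)%R]%E @[k --> +oo] --> 0%E)
  (u0v0_shift : exists omega : R -> R,
    [/\ {within `[0, +oo[, continuous omega},
        (forall mu : R, 0 <= mu -> 0 <= omega mu),
        omega mu @[mu --> 0^'+] --> 0 &
        forall k delta : R, 0 < k ->
          ('N[leb R]_1[EFin \o (fun x => u0 k (x + delta)%R - u0 k x)%R] +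
           'N[leb R]_1[EFin \o (fun x => v0 k (x + delta)%R - v0 k x)%R]
             <= (omega `|delta|%R)%:E)%E])
  (eps_gt0 : 0 < eps) :
  forall k : R, 0 < k ->
  exists u v phiu_x phiv_x : R * R -> R,
    [/\ Lp_on (leb2 R) +oo%E (QT T) u,
        Lp_on (leb2 R) +oo%E (QT T) v,
        (forall J : R, 0 < J ->
           L2_W12 T `]- J, J[ (phi \o u) phiu_x /\
           L2_W12 T `]- J, J[ (phi \o v) phiv_x) &
        forall Psi, FT T Psi ->
          \int[leb R]_x (u0 k x * Psi (x, 0)) +
          \int[leb2 R]_(z in QT T) (u z * dt Psi z) =
          \int[leb2 R]_(z in QT T) (phiu_x z * dx Psi z) +
          k * \int[leb2 R]_(z in QT T) (Psi z * u z * v z)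
          /\
          \int[leb R]_x (v0 k x * Psi (x, 0)) +
          \int[leb2 R]_(z in QT T) (v z * dt Psi z) =
          \int[leb2 R]_(z in QT T) (eps * phiv_x z * dx Psi z) +
          k * \int[leb2 R]_(z in QT T) (Psi z * u z * v z)].

Proof.
move=> k k_gt0; set B := Num.max U0 V0; set L := derive1 phi B.
have B0 : 0 < B by rewrite lt_max U0_gt0.
have L0 : 0 < L by rewrite /L -dphi0 dphi_incr // in_itv /= ?lexx // ltW.
have lip := diffusion_lip B0 phi_C2 phi_incr dphi_incr.
have epsL := mulr_gt0 eps_gt0 L0; have kB := mulr_gt0 k_gt0 B0.
have c0 : 0 < 1 + 24 * (1 + eps) * L + k * B by lra.
(* The summands ensure in turn [lam <= 1], the bound [24 * D * L <= 1] for both diffusivities, and,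
   jointly, that diffusion and reaction keep the grid values nonnegative. *)
pose lam := (1 + 24 * (1 + eps) * L + k * B)^-1.
have lam0 : 0 < lam by rewrite invr_gt0.
have cfl : lam * (1 + 24 * (1 + eps) * L + k * B) = 1 by rewrite mulVf // lt0r_neq0.
have u0k x : 0 <= u0 k x <= U0 by exact: u0_bnd.
have v0k x : 0 <= v0 k x <= V0 by exact: v0_bnd.
have scu := system_scheme_u lam0 eps_gt0 k_gt0 U0_gt0 L0 cfl u0k v0k phi0 phi_incr lip.
have scv := system_scheme_v lam0 eps_gt0 k_gt0 U0_gt0 L0 cfl u0k v0k phi0 phi_incr lip.
have phi_cont := Cn2_continuous phi_C2.
have [sigma [u [v [sigma_ge uc vc fc]]]] := scheme_extraction phi_cont phi_incr T scu scv.
(* Outside the open time interval the extracted limits are only ultrafilter values, with no known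
   convergence along [sigma]; replacing them by 0 makes the functions measurable on the plane. *)
pose cut (f : R * R -> R) z := if 0 < z.2 < T then f z else 0.
have cut_out f z : ~~ (0 < z.2 < T) -> cut f z = 0 by rewrite /cut => /negbTE ->.
have uc' z : 0 < z.2 < T ->
    grid_state lam (fun n m => (system phi lam eps k (u0 k) (v0 k) n m).1) (sigma j) z @[j --> \oo] --> cut u z.
  by move=> zT; rewrite /cut zT; exact: uc.
have vc' z : 0 < z.2 < T ->
    grid_state lam (fun n m => (system phi lam eps k (u0 k) (v0 k) n m).2) (sigma j) z @[j --> \oo] --> cut v z.
  by move=> zT; rewrite /cut zT; exact: vc.
pose r z := k * (cut u z * cut v z).
have rc z : 0 < z.2 < T -> interp (mesh R (sigma j)) (lam * mesh R (sigma j) ^+ 2)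
    (fun m i => k * ((system phi lam eps k (u0 k) (v0 k) (sigma j) m).1 i *
      (system phi lam eps k (u0 k) (v0 k) (sigma j) m).2 i)) z @[j --> \oo] --> r z.
  by move=> zT; apply: cvgM; [exact: cvg_cst|apply: cvgM; [exact: uc'|exact: vc']].
have r_out z : ~~ (0 < z.2 < T) -> r z = 0 by move=> zT; rewrite /r cut_out // mul0r mulr0.
have fu x t : 0 < t < T -> {for x, continuous (fun x => phi (cut u (x, t)))}.
  by move=> tT; have [+ _] := fc x t tT; rewrite /cut /= tT.
have fv x t : 0 < t < T -> {for x, continuous (fun x => phi (cut v (x, t)))}.
  by move=> tT; have [_] := fc x t tT; rewrite /cut /= tT.
have [gu [gu1 gu2]] := species_solution scu phi_cont (Cn2_continuous (@u0_C2 k k_gt0)) T_gt0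
  sigma_ge uc' (cut_out u) rc r_out fu.
have [gv [gv1 gv2]] := species_solution scv phi_cont (Cn2_continuous (@v0_C2 k k_gt0)) T_gt0
  sigma_ge vc' (cut_out v) rc r_out fv.
have bu := bm_species scu uc' (cut_out u).
have bv := bm_species scv vc' (cut_out v).
exists (cut u), (cut v), gu, gv; split.
- exact: Lp_on_bounded.
- exact: Lp_on_bounded.
- by move=> J J0; split; [exact: gu1|exact: gv1].
move=> Psi FTPsi; have [J supJ] := FT_support FTPsi.
have reaction : \int[leb2 R]_(z in QT T) (Psi z * r z) =
    k * \int[leb2 R]_(z in QT T) (Psi z * cut u z * cut v z).
  have b := bfsMr (bfsMr (FT_bfs T_gt0 FTPsi supJ) bu) bv.
  rewrite !Rintegral_QT [RHS](_ : _ = k * \int[leb2 R]_z ((\1_(QT T) : R * R -> R) z * Psi z * cut u z * cut v z)).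
    by rewrite -(bfs_integralZ _ b); apply: eq_Rintegral => z _; rewrite /r; ring.
  by congr (_ * _); apply: eq_Rintegral => z _; ring.
have lamN : lam != 0 by exact: lt0r_neq0.
split; rewrite -reaction.
  rewrite gu2 //; congr (_ + _); apply: eq_Rintegral => z _.
  by rewrite divff // mul1r.
rewrite gv2 //; congr (_ + _); apply: eq_Rintegral => z _.
by rewrite [lam * eps]mulrC mulfK.
Qed.
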